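(* Let $E$ be a Bryant surface end with Bryant representation $F=\begin{pmatrix}A&B\\C&D\end{pmatrix}$ (defined on the universal cover of $\Omega^*$). Put $\varphi_0=4\pi\operatorname{Res}(D\,dC-C\,dD)$, $\varphi_1=4\pi\operatorname{Res}(C\,dB-D\,dA)$, $\varphi_2=4\pi\operatorname{Res}(B\,dA-A\,dB)$. Let $\mathcal C$ and $\mathcal D$ be two distinct points of $\overline{\mathbb C}$ and let $Y$ be the Killing field associated to the rotation about the geodesic $(\mathcal C,\mathcal D)$. Then the flux of $Y$ through $E$ is $$\varphi=-\operatorname{Im}\left(\frac{\varphi_2\,\mathcal C\mathcal D+\varphi_1(\mathcal C+\mathcal D)+\varphi_0}{\mathcal C-\mathcal D}\right).$$
   Context: Hyperbolic space is $\mathbb H^3=\{(\zeta,w)\in\mathbb C\times\mathbb R: w>0\}$, $\zeta=u+iv$, with metric $\langle\cdot,\cdot\rangle=(|d\zeta|^2+dw^2)/w^2$ and orientation $du\wedge dv\wedge dw$; its asymptotic boundary is identified with $\overline{\mathbb C}=\mathbb C\cup\{\infty\}$. For distinct $\mathcal A,\mathcal B\in\overline{\mathbb C}$, $(\mathcal A,\mathcal B)$ is the oriented geodesic from $\mathcal A$ to $\mathcal B$. A Bryant surface is a surface of constant mean curvature $1$ in $\mathbb H^3$ (mean curvature $=$ half the trace of the second fundamental form). $\Omega$ is a neighbourhood of $0$ in $\mathbb C$ and $\Omega^*=\Omega\setminus\{0\}$. A Bryant surface end $E$ is given by a conformal immersion $X=(\zeta,w):\Omega^*\to\mathbb H^3$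 of constant mean curvature $1$ (the puncture $0$ corresponding to the end), the orientation induced by $X$ being the one induced by the mean curvature vector $\vec H$. A Bryant representation of $E$ is a holomorphic map $F=\begin{pmatrix}A&B\\C&D\end{pmatrix}$ from the universal cover of $\Omega^*$ to $\mathrm{SL}_2(\mathbb C)$ with $dA\,dD-dB\,dC=0$ and $\zeta=\frac{\bar A C+\bar B D}{|A|^2+|B|^2}$, $w=\frac1{|A|^2+|B|^2}$. The one-forms $B\,dA-A\,dB$, $C\,dB-D\,dA$, $D\,dC-C\,dD$ are single-valued holomorphic on $\Omega^*$; $\operatorname{Res}$ denotes the residue at $0$, i.e. $\frac1{2\pi i}$ times the integral over a small positively oriented loop around $0$. Killing field of a rotation: if $R_\theta$ is the rotation of angle $\theta$ in the direct sense about the oriented geodesic $(\mathcal A,\mathcal B)$, the associated Killing field $Y$ is defined by $\frac{dR_\theta}{d\theta}=Y(R_\theta)$; for $(0,\infty)$, $Y(\zeta,w)=(i\zeta,0)$, and the direct sense for a general oriented geodesic is obtained by conjugation with direct (orientation-preserving) isometries. Flux of a Killing field $Y$ through $E$: $\varphi=\int_\Gamma\langle\eta,Y\rangle-2\int_K\langle\nu,Y\rangle$, where $\Gamma$ is a generator of $\pi_1(E)$, $K$ a topological disk with boundary $\Gamma$, $\eta$ the unit conormal to $\Gamma$ pointing towards the asymptotic boundary of the end; $\Gamma$ is oriented so that $(\Gamma,\eta,-\vec H)$ is positively oriented, and $\nu$ is the unit normal to $K$ inducing this same orientation on $\Gamma$. It does not depend on the choices of $\Gamma$ and $K$. Convention: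 when $\mathcal C$ or $\mathcal D$ is $\infty$ the fraction is understood as its limit, i.e. $\varphi_2\mathcal D+\varphi_1$ if $\mathcal C=\infty$ and $-(\varphi_2\mathcal C+\varphi_1)$ if $\mathcal D=\infty$. *)

(* Defs.v *)
From Stdlib Require Import Reals.
From Coquelicot Require Export Coquelicot.
Open Scope R_scope.

(** * Vectors

    Points of the upper half-space and tangent vectors are pairs [(zeta, w)]
    with [zeta = u + i v]; the ordered coordinates [u, v, w] fix the
    orientation [du /\ dv /\ dw]. *)

Definition E3 : Type := (C * R)%type.

Definition cu (p : E3) : R := Re (fst p).
Definition cv (p : E3) : R := Im (fst p).
Definition cw (p : E3) : R := snd p.

Definition H3 (p : E3) : Prop := 0 < cw p.

Definition vadd (V W : E3) : E3 := ((cu V + cu W, cv V + cv W), cw V + cw W).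
Definition vscal (a : R) (V : E3) : E3 := ((a * cu V, a * cv V), a * cw V).
Definition vopp (V : E3) : E3 := vscal (-1) V.
Definition vsub (V W : E3) : E3 := vadd V (vopp W).
Definition vdot (V W : E3) : R := cu V * cu W + cv V * cv W + cw V * cw W.
Definition vcross (V W : E3) : E3 :=
  ((cv V * cw W - cw V * cv W, cw V * cu W - cu V * cw W),
   cu V * cv W - cv V * cu W).
Definition det3 (V1 V2 V3 : E3) : R := vdot (vcross V1 V2) V3.

(** Hyperbolic metric at [q], for tangent vectors [V] and [W]. *)
Definition hyp (q V W : E3) : R := vdot V W / (cw q) ^ 2.
Definition hnorm (q V : E3) : R := sqrt (hyp q V V).

(** The metric being conformal to the Euclidean one, the unit normal [N] to
    the plane spanned by [V], [W] with [(V, W, N)] direct is the rescaled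
    Euclidean cross product.  The value is irrelevant when [V] and [W] are
    dependent. *)
Definition unit_normal (q V W : E3) : E3 :=
  let n := vcross V W in vscal (/ hnorm q n) n.

Definition area_element (q V W : E3) : R :=
  sqrt (hyp q V V * hyp q W W - (hyp q V W) ^ 2).

(** * Differential calculus *)

Definition d1 (f : C -> R) (z : C) : R := Derive (fun x : R => f (x, Im z)) (Re z).
Definition d2 (f : C -> R) (z : C) : R := Derive (fun y : R => f (Re z, y)) (Im z).

Fixpoint Ck (n : nat) (W : C -> Prop) (f : C -> R) : Prop :=
  (forall z, W z -> continuous f z) /\
  match n with
  | O => True
  | S m =>
      (forall z, W z ->
         ex_derive (fun x : R => f (x, Im z)) (Re z) /\
         ex_derive (fun y : R => f (Re z, y)) (Im z)) /\
      Ck m W (d1 f) /\ Ck m W (d2 f)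
  end.

Definition CkE (n : nat) (W : C -> Prop) (X : C -> E3) : Prop :=
  Ck n W (fun z => cu (X z)) /\ Ck n W (fun z => cv (X z)) /\
  Ck n W (fun z => cw (X z)).

Definition D1 (X : C -> E3) (z : C) : E3 :=
  ((d1 (fun z => cu (X z)) z, d1 (fun z => cv (X z)) z), d1 (fun z => cw (X z)) z).
Definition D2 (X : C -> E3) (z : C) : E3 :=
  ((d2 (fun z => cu (X z)) z, d2 (fun z => cv (X z)) z), d2 (fun z => cw (X z)) z).

(** [dX_z (v)] for a tangent vector [v] of the plane. *)
Definition dmap (X : C -> E3) (z v : C) : E3 :=
  vadd (vscal (Re v) (D1 X z)) (vscal (Im v) (D2 X z)).

Definition dcurve (c : R -> C) (t : R) : C :=
  (Derive (fun s => Re (c s)) t, Derive (fun s => Im (c s)) t).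

Definition is_derive_E3 (c : R -> E3) (t : R) (V : E3) : Prop :=
  is_derive (fun s => cu (c s)) t (cu V) /\ is_derive (fun s => cv (c s)) t (cv V) /\
  is_derive (fun s => cw (c s)) t (cw V).

Definition holomorphic_on (W : C -> Prop) (f : C -> C) : Prop :=
  forall z, W z -> ex_derive f z.

Definition expi (t : R) : C := (cos t, sin t).

(** * Surfaces in hyperbolic space *)

(** Covariant derivative [nabla_V W] for the Levi-Civita connection of
    [(du^2 + dv^2 + dw^2) / w^2] at [q], where [S] is the coordinatewise
    derivative of [W] along [V]: the conformal factor [w^-2] adds
    [- (dw(V)/w) W - (dw(W)/w) V + (V.W / w) d/dw]. *)
Definition cov (q V W S : E3) : E3 :=
  vadd (vsub S (vadd (vscal (cw V / cw q) W) (vscal (cw W / cw q) V)))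
       (vscal (vdot V W / cw q) (RtoC 0, 1)).

(** Half the trace, with respect to the first fundamental form, of the second
    fundamental form [(V, W) |-> <nabla_V W, N>]. *)
Definition mean_curvature (X : C -> E3) (N : E3) (z : C) : R :=
  let q := X z in
  let X1 := D1 X z in
  let X2 := D2 X z in
  let g11 := hyp q X1 X1 in
  let g12 := hyp q X1 X2 in
  let g22 := hyp q X2 X2 in
  let h11 := hyp q (cov q X1 X1 (D1 (D1 X) z)) N in
  let h12 := hyp q (cov q X1 X2 (D1 (D2 X) z)) N in
  let h22 := hyp q (cov q X2 X2 (D2 (D2 X) z)) N in
  (g22 * h11 - 2 * g12 * h12 + g11 * h22) / (2 * (g11 * g22 - g12 ^ 2)).

(** Independent of the choice of one of the two unit normals. *)
Definition mean_curvature_vector (X : C -> E3) (z : C) : E3 :=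
  let N := unit_normal (X z) (D1 X z) (D2 X z) in
  vscal (mean_curvature X N z) N.

Definition conformal_immersion_at (X : C -> E3) (z : C) : Prop :=
  0 < hyp (X z) (D1 X z) (D1 X z) /\
  hyp (X z) (D1 X z) (D1 X z) = hyp (X z) (D2 X z) (D2 X z) /\
  hyp (X z) (D1 X z) (D2 X z) = 0.

Definition punctured (Omega : C -> Prop) (z : C) : Prop := Omega z /\ z <> RtoC 0.

(** The last two fields say that the mean curvature is [1] and that the
    orientation induced by [X] is the one induced by the mean curvature
    vector. *)
Record bryant_end (Omega : C -> Prop) (X : C -> E3) : Prop := {
  be_open : open Omega;
  be_zero : Omega (RtoC 0);
  be_C2 : CkE 2 (punctured Omega) X;
  be_H3 : forall z, punctured Omega z -> H3 (X z);
  be_conformal : forall z, punctured Omega z -> conformal_immersion_at X z;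
  be_cmc1 : forall z, punctured Omega z ->
    hnorm (X z) (mean_curvature_vector X z) = 1;
  be_orientation : forall z, punctured Omega z ->
    0 < det3 (D1 X z) (D2 X z) (mean_curvature_vector X z)
}.

(** * Universal covering and Bryant representation *)

(** Paths are parametrized by [0, 1]; a path on [0, 1] extends continuously
    to [R], so continuity is required everywhere. *)
Definition path_in (W : C -> Prop) (c : R -> C) : Prop :=
  (forall s, continuous c s) /\ (forall s, 0 <= s <= 1 -> W (c s)).

Definition simply_connected (W : C -> Prop) : Prop :=
  (exists z, W z) /\
  (forall z z', W z -> W z' -> exists c, path_in W c /\ c 0 = z /\ c 1 = z') /\
  (forall c, path_in W c -> c 0 = c 1 ->
     exists h : R * R -> C,
       (forall x, continuous h x) /\
       (forall s t, 0 <= s <= 1 -> 0 <= t <= 1 -> W (h (s, t))) /\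
       (forall t, 0 <= t <= 1 -> h (0, t) = c t /\ h (1, t) = c 0) /\
       (forall s, 0 <= s <= 1 -> h (s, 0) = c 0 /\ h (s, 1) = c 0)).

(** Every point of [V] has an evenly covered neighbourhood [N]: the preimage
    of [N] is the disjoint union of the open sheets [sigma i (N)].  The
    sections are holomorphic because the total space carries the complex
    structure lifted from [V]. *)
Definition holomorphic_covering (U V : C -> Prop) (p : C -> C) : Prop :=
  open U /\ holomorphic_on U p /\ (forall s, U s -> V (p s)) /\
  forall z, V z ->
    exists (N : C -> Prop) (I : Type) (sigma : I -> C -> C),
      inhabited I /\ open N /\ N z /\ (forall y, N y -> V y) /\
      (forall i, holomorphic_on N (sigma i) /\
         (forall y, N y -> U (sigma i y) /\ p (sigma i y) = y) /\
         open (fun s => exists y, N y /\ s = sigma i y)) /\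
      (forall s, U s -> N (p s) -> exists! i, sigma i (p s) = s).

(** By uniformization the universal covering surface of a plane domain minus
    a point is biholomorphic to an open subset [U] of the plane.  When the
    domain [Omega] is simply connected one may take [p = exp] and
    [U = exp^-1 (Omega)]. *)
Definition universal_covering (U V : C -> Prop) (p : C -> C) : Prop :=
  simply_connected U /\ holomorphic_covering U V p.

Record bryant_representation (U : C -> Prop) (p : C -> C) (X : C -> E3)
    (FA FB FC FD : C -> C) : Prop := {
  br_holA : holomorphic_on U FA;
  br_holB : holomorphic_on U FB;
  br_holC : holomorphic_on U FC;
  br_holD : holomorphic_on U FD;
  br_det : forall s, U s -> (FA s * FD s - FB s * FC s = 1)%C;
  br_null : forall s, U s ->
    (C_derive FA s * C_derive FD s - C_derive FB s * C_derive FC s = 0)%C;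
  br_X : forall s, U s ->
    let n := Cmod (FA s) ^ 2 + Cmod (FB s) ^ 2 in
    X (p s) = (((Cconj (FA s) * FC s + Cconj (FB s) * FD s) / RtoC n)%C, 1 / n)
}.

(** * Residues *)

(** The residue at [0] of [f(z) dz]. *)
Definition is_residue (f : C -> C) (rho : C) : Prop :=
  exists delta : R, 0 < delta /\ forall r : R, 0 < r < delta ->
    is_RInt (V := C_R_NormedModule)
      (fun t => f (RtoC r * expi t) * (Ci * RtoC r * expi t))%C
      0 (2 * PI) (RtoC (2 * PI) * Ci * rho)%C.

(** [rho] is the residue at [0] of the holomorphic one-form [f(z) dz] on
    [V] whose pull-back by [p : U -> V] is [g(s) ds]. *)
Definition is_form_residue (U V : C -> Prop) (p g : C -> C) (rho : C) : Prop :=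
  exists f : C -> C,
    holomorphic_on V f /\
    (forall s, U s -> (f (p s) * C_derive p s)%C = g s) /\
    is_residue f rho.

(** [f dg - g df] as a coefficient of [ds]. *)
Definition wronskian (f g : C -> C) (s : C) : C :=
  (f s * C_derive g s - g s * C_derive f s)%C.

(** * Rotations and Killing fields *)

Inductive sphere : Type :=
| Pt (z : C)
| Infty.

Record SL2 : Type := {
  m11 : C; m12 : C; m21 : C; m22 : C;
  SL2_det : (m11 * m22 - m12 * m21 = 1)%C
}.

Definition mobius (M : SL2) (x : sphere) : sphere :=
  match x with
  | Pt z =>
      if Ceq_dec (m21 M * z + m22 M)%C (RtoC 0) then Infty
      else Pt ((m11 M * z + m12 M) / (m21 M * z + m22 M))%C
  | Infty =>
      if Ceq_dec (m21 M) (RtoC 0) then Infty else Pt (m11 M / m21 M)%C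
  end.

Lemma SL2_inv_det (M : SL2) :
  (m22 M * m11 M - (- m12 M) * (- m21 M) = 1)%C.
Proof. rewrite <- (SL2_det M); ring. Qed.

Definition SL2_inv (M : SL2) : SL2 :=
  {| m11 := m22 M; m12 := (- m12 M)%C; m21 := (- m21 M)%C; m22 := m11 M;
     SL2_det := SL2_inv_det M |}.

(** Poincare extension: the direct isometry of [H3] which extends [mobius M]. *)
Definition isom (M : SL2) (p : E3) : E3 :=
  let z := fst p in
  let w := cw p in
  let n := Cmod (m21 M * z + m22 M)%C ^ 2 + Cmod (m21 M) ^ 2 * w ^ 2 in
  ((((m11 M * z + m12 M) * Cconj (m21 M * z + m22 M)
     + m11 M * Cconj (m21 M) * RtoC (w ^ 2)) / RtoC n)%C,
   w / n).

(** Rotation about the oriented geodesic from [0] to infinity. *)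
Definition rot0 (theta : R) (p : E3) : E3 := ((expi theta * fst p)%C, cw p).

(** [Rot theta] is the rotation of angle [theta], in the direct sense, about
    the oriented geodesic from [P] to [Q]. *)
Definition is_rotation (P Q : sphere) (Rot : R -> E3 -> E3) : Prop :=
  exists M : SL2,
    mobius M (Pt (RtoC 0)) = P /\ mobius M Infty = Q /\
    forall theta p, H3 p -> Rot theta p = isom M (rot0 theta (isom (SL2_inv M) p)).

Definition is_rotation_killing_field (P Q : sphere) (Y : E3 -> E3) : Prop :=
  exists Rot : R -> E3 -> E3,
    is_rotation P Q Rot /\
    forall theta p, H3 p -> is_derive_E3 (fun t => Rot t p) theta (Y (Rot theta p)).

(** * Flux *)

(** The class of [gamma] generates the fundamental group of the end: it is
    freely homotopic, in the punctured neighbourhood, to a small circle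
    around the puncture run once in one of the two directions. *)
Definition pi1_generator (Omega : C -> Prop) (gamma : R -> C) : Prop :=
  exists (r eps : R) (h : R * R -> C),
    0 < r /\ (forall z, Cmod z <= r -> Omega z) /\ (eps = 1 \/ eps = -1) /\
    (forall x, continuous h x) /\
    (forall s t, 0 <= s <= 1 -> 0 <= t <= 2 * PI -> punctured Omega (h (s, t))) /\
    (forall t, 0 <= t <= 2 * PI ->
       h (0, t) = gamma t /\ h (1, t) = (RtoC r * expi (eps * t))%C) /\
    (forall s, 0 <= s <= 1 -> h (s, 0) = h (s, 2 * PI)).

(** A regular simple closed curve of class C^1; the curve on the surface is
    [X o gamma]. *)
Record generating_loop (Omega : C -> Prop) (gamma : R -> C) : Prop := {
  gl_periodic : forall t, gamma (t + 2 * PI) = gamma t;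
  gl_in : forall t, punctured Omega (gamma t);
  gl_derivable : forall t,
    ex_derive (fun s => Re (gamma s)) t /\ ex_derive (fun s => Im (gamma s)) t;
  gl_C1 : forall t, continuous (dcurve gamma) t;
  gl_regular : forall t, dcurve gamma t <> RtoC 0;
  gl_simple : forall s t, 0 <= s < 2 * PI -> 0 <= t < 2 * PI ->
    gamma s = gamma t -> s = t;
  gl_generator : pi1_generator Omega gamma
}.

(** Velocity of [X o gamma]. *)
Definition velocity (X : C -> E3) (gamma : R -> C) (t : R) : E3 :=
  dmap X (gamma t) (dcurve gamma t).

(** The tangent vector [v] at [gamma t] points to the side of the curve on
    which the puncture lies. *)
Definition points_to_puncture (Omega : C -> Prop) (gamma : R -> C) (t : R) (v : C) : Prop :=
  exists e0 : R, 0 < e0 /\ forall e : R, 0 < e < e0 ->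
    exists c : R -> C,
      path_in (fun z => Omega z /\ forall s, z <> gamma s) c /\
      c 0 = (gamma t + RtoC e * v)%C /\ c 1 = RtoC 0.

(** [eta] is the unit conormal along [X o gamma] pointing towards the
    asymptotic boundary of the end, and [gamma] runs in the direction for
    which (velocity, [eta], minus mean curvature vector) is direct. *)
Record oriented_conormal (Omega : C -> Prop) (X : C -> E3) (gamma : R -> C)
    (eta : R -> E3) : Prop := {
  oc_unit : forall t, hnorm (X (gamma t)) (eta t) = 1;
  oc_normal : forall t, hyp (X (gamma t)) (eta t) (velocity X gamma t) = 0;
  oc_tangent : forall t, exists v : C,
    eta t = dmap X (gamma t) v /\ points_to_puncture Omega gamma t v;
  oc_oriented : forall t,
    0 < det3 (velocity X gamma t) (eta t)
          (vopp (mean_curvature_vector X (gamma t)))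
}.

(** A disk [k], parametrized by the closed unit disk, which is of class C^2 up
    to the boundary and is bounded by [X o gamma].  As the boundary circle runs
    counterclockwise, the unit normal inducing the orientation of [gamma] is
    [unit_normal] of the two partial derivatives.  Neither immersivity nor
    injectivity of [k] is needed: where [k] is not immersed the area element
    vanishes. *)
Record spanning_disk (X : C -> E3) (gamma : R -> C) (k : C -> E3) : Prop := {
  sd_C2 : exists W : C -> Prop,
    open W /\ (forall x, Cmod x <= 1 -> W x) /\ CkE 2 W k;
  sd_H3 : forall x, Cmod x <= 1 -> H3 (k x);
  sd_boundary : forall t, k (expi t) = X (gamma t)
}.

Definition curve_term (X : C -> E3) (gamma : R -> C) (eta Y : R -> E3) : R :=
  RInt (fun t => hyp (X (gamma t)) (eta t) (Y t)
                 * hnorm (X (gamma t)) (velocity X gamma t)) 0 (2 * PI).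

(** Integral over the unit disk, in polar coordinates. *)
Definition disk_RInt (f : C -> R) : R :=
  RInt (fun r => RInt (fun t => f (RtoC r * expi t)%C * r) 0 (2 * PI)) 0 1.

Definition disk_term (k : C -> E3) (Y : E3 -> E3) : R :=
  disk_RInt (fun x =>
    hyp (k x) (unit_normal (k x) (D1 k x) (D2 k x)) (Y (k x))
    * area_element (k x) (D1 k x) (D2 k x)).

Definition is_flux (Omega : C -> Prop) (X : C -> E3) (Y : E3 -> E3) (phi : R) : Prop :=
  forall (gamma : R -> C) (eta : R -> E3) (k : C -> E3),
    generating_loop Omega gamma ->
    oriented_conormal Omega X gamma eta ->
    spanning_disk X gamma k ->
    phi = curve_term X gamma eta (fun t => Y (X (gamma t))) - 2 * disk_term k Y.

(** [(phi2 P Q + phi1 (P + Q) + phi0) / (P - Q)], extended by its limits when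
    [P] or [Q] is infinite; the value for [P = Q] is irrelevant. *)
Definition flux_fraction (phi0 phi1 phi2 : C) (P Q : sphere) : C :=
  match P, Q with
  | Pt a, Pt b => ((phi2 * a * b + phi1 * (a + b) + phi0) / (a - b))%C
  | Infty, Pt b => (phi2 * b + phi1)%C
  | Pt a, Infty => (- (phi2 * a + phi1))%C
  | Infty, Infty => RtoC 0
  end.

(* Main.v *)
Require Import Defs.
From Stdlib Require Import Reals Lra Lia Psatz Classical IndefiniteDescription ZArith.
From Coquelicot Require Import Coquelicot.
From Corelib Require Import ssreflect.
(* Repeated so that [d1] and [d2] denote the partial derivatives. *)
Require Import Defs.

(** The flux is the period of a closed 1-form on the punctured domain, and
    that form is the imaginary part of a combination of the three holomorphic
    forms [B dA - A dB], [C dB - D dA], [D dC - C dD].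

    The Killing field extending [(a + b z + c z^2) d/dz] is [killing a b c];
    write [Y] for it and [Z] for [killing (i a) (i b) (i c)].  The rotation
    about the geodesic from [P] to [Q] corresponds to the coefficients [a],
    [b], [c] proportional to [P Q], [- (P + Q)], [1] with factor
    [i / (P - Q)], also in the limit cases; this produces the fraction of the
    theorem ([rotation_killing_field]).

    Disk term.  The 2-form [<Y, nu> dA] is the exterior derivative of the
    1-form [V |-> <V, Z> / 2], so Green's formula on the parameter disk turns
    twice the disk term into the integral of [<Z, d/dt X (gamma t)>]
    ([killing_disk_term]).

    Curve term.  As [X] is conformal and is oriented by its mean curvature
    vector, the conormal times the length element is [dX (- i gamma')]
    ([conormal_eq]).  The flux is therefore the integral along [gamma] of
    [v |-> <dX (- i v), Y> - <dX v, Z>].  Substituting the formula for [X] in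
    terms of [A], [B], [C], [D] gives at each point exactly
    [- 2 Im ((a f2 - b f1 + c f0) v)], where [f0], [f1], [f2] are the
    single-valued coefficients of the three forms ([local_frame_density]).
    No exact term is left over.

    Closedness.  The real form so obtained has C1 coefficients because [X] is
    of class C2, and is closed by the Cauchy-Riemann equations
    ([flux_form_closed]).  Closed C1 forms have primitives on squares, hence
    the same integral on freely homotopic loops ([homotopy_invariance]), and
    [gamma] can be replaced by a small circle, where the integral is given by
    the residues.

    Direction.  The circle may a priori be run in either direction, and the
    sign of the result depends on it.  The conormal points to the side of the
    puncture and is [- i gamma'] up to a positive factor, so the points just
    to the right of [gamma] have the same winding number as the puncture,
    namely [1] or [-1].  At a point where the real part of [gamma] is maximal
    one side of the curve has winding number [0], so that side is the left
    one, and comparing the two sides there shows that the right one has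
    nonpositive winding number.  Hence [gamma] is homotopic to a clockwise
    circle ([orientation_clockwise]). *)

(** * C1 functions of two real variables *)

(** The gradient is explicit so that mixed derivatives of two functions can be
    compared, as closedness of a 1-form requires. *)
Definition C1_grad (W : C -> Prop) (F P Q : C -> R) : Prop :=
  forall z, W z ->
    is_derive (fun x : R => F (x, Im z)) (Re z) (P z) /\
    is_derive (fun y : R => F (Re z, y)) (Im z) (Q z) /\
    continuous P z /\ continuous Q z.

Lemma C1_grad_filterdiff (W : C -> Prop) (F P Q : C -> R) (z : C) :
  open W -> C1_grad W F P Q -> W z ->
  filterdiff (U := prod_NormedModule R_AbsRing R_NormedModule R_NormedModule) (V := R_NormedModule)
    F (locally z) (fun v : C => Re v * P z + Im v * Q z).
Proof.
  intros HW HF Hz.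
  destruct z as [x y].
  pose proof (is_derive_filterdiff (fun a b => F (a, b)) x y (fun a b => P (a, b)) (Q (x, y))) as H.
  eapply filterdiff_ext_lin.
  - eapply filterdiff_ext; [ | apply H].
    + intros [a b]; reflexivity.
    + generalize (HW _ Hz). apply filter_imp. intros [a b] Hab. exact (proj1 (HF _ Hab)).
    + exact (proj1 (proj2 (HF _ Hz))).
    + apply continuous_ext with (f := P). intros [a b]; reflexivity.
      exact (proj1 (proj2 (proj2 (HF _ Hz)))).
  - intros [a b]; reflexivity.
Qed.

Lemma C1_grad_continuous (W : C -> Prop) (F P Q : C -> R) (z : C) :
  open W -> C1_grad W F P Q -> W z -> continuous F z.
Proof.
  intros HW HF Hz.
  apply (@filterdiff_continuous R_AbsRing (prod_NormedModule R_AbsRing R_NormedModule R_NormedModule) R_NormedModule).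
  eexists. apply (C1_grad_filterdiff W); eauto.
Qed.

(** Continuity of the partial derivatives makes [F] differentiable as a function
    of two variables, which is what the chain rule along a curve needs. *)
Lemma C1_grad_comp_curve (W : C -> Prop) (F P Q : C -> R) (c : R -> C) (t c1 c2 : R) :
  open W -> C1_grad W F P Q -> W (c t) ->
  is_derive (fun s => Re (c s)) t c1 -> is_derive (fun s => Im (c s)) t c2 ->
  is_derive (fun s => F (c s)) t (c1 * P (c t) + c2 * Q (c t)).
Proof.
  intros HW HF Hz D1 D2.
  pose proof (C1_grad_filterdiff W F P Q (c t) HW HF Hz) as H0.
  pose proof (filterdiff_comp'_2 (fun s => Re (c s)) (fun s => Im (c s)) (fun a b => F (a, b)) t
     (fun v : R => scal v c1) (fun v : R => scal v c2) (fun a b => a * P (c t) + b * Q (c t)) D1 D2) as H.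
  unfold is_derive. eapply filterdiff_ext_lin.
  - eapply filterdiff_ext; [ | apply H].
    + intros s; simpl. f_equal. now destruct (c s).
    + replace (Re (c t), Im (c t)) with (c t) by now destruct (c t).
      eapply filterdiff_ext_lin.
      * eapply filterdiff_ext; [ | exact H0].
        intros [a b]; reflexivity.
      * intros [a b]; reflexivity.
  - intros v; simpl. unfold scal; simpl; unfold mult; simpl. ring.
Qed.

Lemma locally_slice1 (W : C -> Prop) (z : C) :
  locally z W -> locally (Re z) (fun x : R => W (x, Im z)).
Proof.
  intros [e He]. exists e. intros x Hx. apply He. split; [exact Hx | apply ball_center].
Qed.

Lemma locally_slice2 (W : C -> Prop) (z : C) :
  locally z W -> locally (Im z) (fun y : R => W (Re z, y)).
Proof.
  intros [e He]. exists e. intros x Hx. apply He. split; [apply ball_center | exact Hx].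
Qed.

Lemma C1_grad_ext (W : C -> Prop) (F G P Q P' Q' : C -> R) :
  open W -> C1_grad W F P Q ->
  (forall z, W z -> F z = G z) -> (forall z, W z -> P z = P' z) -> (forall z, W z -> Q z = Q' z) ->
  C1_grad W G P' Q'.
Proof.
  intros HW HF E1 E2 E3 z Hz.
  destruct (HF z Hz) as (D1 & D2 & K1 & K2).
  assert (HL : locally z W) by now apply HW.
  refine (conj _ (conj _ (conj _ _))).
  - rewrite <- E2 by auto. apply (is_derive_ext_loc (V := R_NormedModule) (fun x : R => F (x, Im z)) (fun x : R => G (x, Im z))); [ | exact D1].
    generalize (locally_slice1 _ _ HL); apply filter_imp; auto.
  - rewrite <- E3 by auto. apply (is_derive_ext_loc (V := R_NormedModule) (fun y : R => F (Re z, y)) (fun y : R => G (Re z, y))); [ | exact D2].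
    generalize (locally_slice2 _ _ HL); apply filter_imp; auto.
  - eapply continuous_ext_loc; [ | exact K1]. revert HL; apply filter_imp; auto.
  - eapply continuous_ext_loc; [ | exact K2]. revert HL; apply filter_imp; auto.
Qed.

Lemma C1_grad_const (W : C -> Prop) (a : R) :
  C1_grad W (fun _ => a) (fun _ => 0) (fun _ => 0).
Proof.
  intros z _. refine (conj _ (conj _ (conj _ _))); try apply continuous_const; apply @is_derive_const.
Qed.

Lemma C1_grad_plus (W : C -> Prop) (F P Q F' P' Q' : C -> R) :
  C1_grad W F P Q -> C1_grad W F' P' Q' ->
  C1_grad W (fun z => F z + F' z) (fun z => P z + P' z) (fun z => Q z + Q' z).
Proof.
  intros H1 H2 z Hz. destruct (H1 z Hz) as (?&?&?&?). destruct (H2 z Hz) as (?&?&?&?).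
  refine (conj _ (conj _ (conj _ _))).
  - apply: is_derive_plus; auto.
  - apply: is_derive_plus; auto.
  - apply: continuous_plus; auto.
  - apply: continuous_plus; auto.
Qed.

Lemma C1_grad_mult (W : C -> Prop) (F P Q F' P' Q' : C -> R) :
  open W -> C1_grad W F P Q -> C1_grad W F' P' Q' ->
  C1_grad W (fun z => F z * F' z) (fun z => P z * F' z + F z * P' z)
    (fun z => Q z * F' z + F z * Q' z).
Proof.
  intros HW H1 H2 z Hz.
  pose proof (C1_grad_continuous _ _ _ _ _ HW H1 Hz).
  pose proof (C1_grad_continuous _ _ _ _ _ HW H2 Hz).
  destruct (H1 z Hz) as (D1&D2&?&?). destruct (H2 z Hz) as (D3&D4&?&?).
  destruct z as [x y].
  refine (conj _ (conj _ (conj _ _))).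
  - apply (is_derive_mult (K := R_AbsRing) _ _ _ _ _ D1 D3 Rmult_comm).
  - apply (is_derive_mult (K := R_AbsRing) _ _ _ _ _ D2 D4 Rmult_comm).
  - apply: continuous_plus; apply: continuous_mult; auto.
  - apply: continuous_plus; apply: continuous_mult; auto.
Qed.

Lemma C1_grad_scal (W : C -> Prop) (a : R) (F P Q : C -> R) :
  C1_grad W F P Q ->
  C1_grad W (fun z => a * F z) (fun z => a * P z) (fun z => a * Q z).
Proof.
  intros H1 z Hz. destruct (H1 z Hz) as (?&?&?&?).
  refine (conj _ (conj _ (conj _ _))).
  - apply: is_derive_scal; auto.
  - apply: is_derive_scal; auto.
  - apply: continuous_mult; auto. apply continuous_const.
  - apply: continuous_mult; auto. apply continuous_const.
Qed.

Lemma C1_grad_inv (W : C -> Prop) (F P Q : C -> R) :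
  open W -> C1_grad W F P Q -> (forall z, W z -> F z <> 0) ->
  C1_grad W (fun z => / F z) (fun z => - P z / (F z) ^ 2) (fun z => - Q z / (F z) ^ 2).
Proof.
  intros HW H1 H2 z Hz.
  pose proof (C1_grad_continuous _ _ _ _ _ HW H1 Hz) as K.
  pose proof (H2 z Hz).
  destruct (H1 z Hz) as (D1&D2&?&?).
  destruct z as [x y].
  assert (KI : continuous (fun z : C => / (F z) ^ 2) (x, y)).
  { apply (continuous_comp (fun z => F z) (fun a : R => / a ^ 2)); auto.
    apply: ex_derive_continuous. auto_derive. simpl; rewrite Rmult_1_r.
    now apply Rmult_integral_contrapositive_currified. }
  refine (conj _ (conj _ (conj _ _))).
  - apply (is_derive_inv (fun a => F (a, y)) x _ D1); auto.
  - apply (is_derive_inv (fun a => F (x, a)) y _ D2); auto.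
  - apply: continuous_mult; auto. apply: continuous_opp; auto.
  - apply: continuous_mult; auto. apply: continuous_opp; auto.
Qed.

Lemma Ck_1_grad (W : C -> Prop) (F : C -> R) : Ck 1 W F -> C1_grad W F (d1 F) (d2 F).
Proof.
  intros (H1 & H2 & (H3 & _) & (H4 & _)) z Hz.
  destruct (H2 z Hz). refine (conj _ (conj _ (conj _ _))); auto; now apply Derive_correct.
Qed.

Lemma Ck_2_1 (W : C -> Prop) (F : C -> R) : Ck 2 W F -> Ck 1 W F.
Proof.
  intros (H1 & H2 & H3 & H4).
  split; auto. split; auto. split; [destruct H3 as [H3 _] | destruct H4 as [H4 _]]; now split.
Qed.

Definition C1_on (W : C -> Prop) (F : C -> R) : Prop := exists P Q, C1_grad W F P Q.

Lemma C1_on_const W a : C1_on W (fun _ => a).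
Proof. eexists; eexists; apply C1_grad_const. Qed.

Lemma C1_on_plus W F G : C1_on W F -> C1_on W G -> C1_on W (fun z => F z + G z).
Proof. intros (P & Q & H) (P' & Q' & H'). eexists; eexists; apply C1_grad_plus; eauto. Qed.

Lemma C1_on_mult W F G : open W -> C1_on W F -> C1_on W G -> C1_on W (fun z => F z * G z).
Proof. intros HW (P & Q & H) (P' & Q' & H'). eexists; eexists; apply C1_grad_mult; eauto. Qed.

Lemma C1_on_inv W F : open W -> C1_on W F -> (forall z, W z -> F z <> 0) -> C1_on W (fun z => / F z).
Proof. intros HW (P & Q & H) H0. eexists; eexists; apply C1_grad_inv; eauto. Qed.

Lemma C1_on_ext W F G : open W -> C1_on W F -> (forall z, W z -> F z = G z) -> C1_on W G.
Proof. intros HW (P & Q & H) E. exists P, Q. eapply C1_grad_ext; eauto. Qed.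

Lemma C1_on_continuous W F z : open W -> C1_on W F -> W z -> continuous F z.
Proof. intros HW (P & Q & HF) Hz. now apply (C1_grad_continuous W F P Q). Qed.

(** * Closed 1-forms and their integrals along curves *)

Lemma continuous_slice1 (f : C -> R) (z : C) :
  continuous f z -> continuous (fun x : R => f (x, Im z)) (Re z).
Proof.
  intros Hf S HS. apply (locally_slice1 (fun z => S (f z))). apply Hf.
  destruct z; exact HS.
Qed.

Lemma continuous_slice2 (f : C -> R) (z : C) :
  continuous f z -> continuous (fun y : R => f (Re z, y)) (Im z).
Proof.
  intros Hf S HS. apply (locally_slice2 (fun z => S (f z))). apply Hf.
  destruct z; exact HS.
Qed.

Lemma continuous_2d_pt_of_continuous (f : C -> R) (x y : R) :
  continuous f (x, y) -> continuity_2d_pt (fun a b => f (a, b)) x y.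
Proof.
  intros Hf. apply continuity_2d_pt_filterlim.
  apply: (filterlim_ext f); [ | exact Hf]. now intros [a b].
Qed.

Definition square (z0 : C) (e : R) (z : C) : Prop :=
  Rabs (Re z - Re z0) < e /\ Rabs (Im z - Im z0) < e.

Lemma Rabs_between (a b s e : R) :
  Rmin a b <= s <= Rmax a b -> Rabs (b - a) < e -> Rabs (s - a) < e.
Proof.
  intros Hs Hb. apply Rabs_lt_between. apply Rabs_lt_between in Hb.
  revert Hs; unfold Rmin, Rmax; destruct (Rle_dec a b); lra.
Qed.

Lemma locally_Rabs_lt (a e x : R) :
  Rabs (x - a) < e -> locally x (fun y : R => Rabs (y - a) < e).
Proof.
  intros H. assert (Hp : 0 < e - Rabs (x - a)) by lra.
  exists (mkposreal _ Hp). intros y Hy. unfold ball in Hy; simpl in Hy.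
  unfold AbsRing_ball, abs, minus, plus, opp in Hy; simpl in Hy.
  replace (y - a) with ((y + - x) + (x - a)) by ring.
  eapply Rle_lt_trans; [apply Rabs_triang | lra].
Qed.

(** The integral of [P dx + Q dy] along the horizontal, then vertical, path from
    [z] to [z'].  It serves both as a primitive on a square and as a substitute
    for the integral along a short arc of a curve that is only continuous. *)
Definition corner_integral (P Q : C -> R) (z z' : C) : R :=
  RInt (fun s => P (s, Im z)) (Re z) (Re z') + RInt (fun s => Q (Re z', s)) (Im z) (Im z').

(** [P dx + Q dy] is closed of class C1: the function [M] is at once the
    [y]-derivative of [P] and the [x]-derivative of [Q]. *)
Definition closed_form (W : C -> Prop) (P Q : C -> R) : Prop :=
  exists Px M Qy : C -> R, C1_grad W P Px M /\ C1_grad W Q M Qy.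

(** The [y]-derivative is the fundamental theorem of calculus.  For the
    [x]-derivative, differentiation under the second integral gives the integral
    of [M], which by closedness is the increment of [P] along the vertical side. *)
Lemma square_primitive (W : C -> Prop) (P Q : C -> R) (z0 : C) (e : R) :
  open W -> closed_form W P Q -> (forall z, square z0 e z -> W z) ->
  C1_grad (square z0 e) (corner_integral P Q z0) P Q.
Proof.
  intros HW (Px & M & Qy & HP & HQ) Hsq [x y] [Hx Hy]. simpl in Hx, Hy.
  destruct z0 as [x0 y0]; simpl in *.
  assert (He : 0 < e) by (eapply Rle_lt_trans; [apply Rabs_pos | exact Hx]).
  assert (Hx0 : Rabs (x0 - x0) < e) by (rewrite Rminus_diag Rabs_R0; exact He).
  assert (Hy0 : Rabs (y0 - y0) < e) by (rewrite Rminus_diag Rabs_R0; exact He).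
  assert (KP : forall a b, Rabs (a - x0) < e -> Rabs (b - y0) < e -> continuous P (a, b)).
  { intros a b Ha Hb. apply (C1_grad_continuous _ _ _ _ _ HW HP). now apply Hsq. }
  assert (KQ : forall a b, Rabs (a - x0) < e -> Rabs (b - y0) < e -> continuous Q (a, b)).
  { intros a b Ha Hb. apply (C1_grad_continuous _ _ _ _ _ HW HQ). now apply Hsq. }
  assert (KM : forall a b, Rabs (a - x0) < e -> Rabs (b - y0) < e -> continuous M (a, b)).
  { intros a b Ha Hb. apply (HP (a, b)). now apply Hsq. }
  assert (IQ : forall a b, Rabs (a - x0) < e -> Rabs (b - y0) < e -> ex_RInt (fun s => Q (a, s)) y0 b).
  { intros a b Ha Hb. apply (ex_RInt_continuous (V := R_CompleteNormedModule)). intros s Hs.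
    apply (continuous_slice2 Q (a, s)). apply KQ; auto. eapply Rabs_between; eauto. }
  assert (IP : forall a, Rabs (a - x0) < e -> ex_RInt (fun s => P (s, y0)) x0 a).
  { intros a Ha. apply (ex_RInt_continuous (V := R_CompleteNormedModule)). intros s Hs.
    apply (continuous_slice1 P (s, y0)). apply KP; auto. eapply Rabs_between; eauto. }
  refine (conj _ (conj _ (conj _ _))); [ | | now apply KP | now apply KQ].
  - unfold corner_integral; simpl.
    replace (P (x, y)) with (P (x, y0) + (P (x, y) - P (x, y0))) by ring.
    apply: is_derive_plus.
    + apply (is_derive_RInt (fun s => P (s, y0)) _ x0 x).
      * generalize (locally_Rabs_lt _ _ _ Hx). apply filter_imp. intros a Ha. apply (RInt_correct (V:=R_CompleteNormedModule)). now apply IP.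
      * apply (continuous_slice1 P (x, y0)). now apply KP.
    + assert (E : RInt (fun t => Derive (fun u => Q (u, t)) x) y0 y = P (x, y) - P (x, y0)).
      { rewrite (RInt_ext _ (fun t => M (x, t))).
        - apply is_RInt_unique. apply: (is_RInt_derive (fun t => P (x, t)) (fun t => M (x, t))).
          + intros t Ht. apply (HP (x, t)). apply Hsq. split; simpl; auto. eapply Rabs_between; eauto.
          + intros t Ht. apply (continuous_slice2 M (x, t)). apply KM; auto. eapply Rabs_between; eauto.
        - intros t Ht. apply is_derive_unique. apply (HQ (x, t)). apply Hsq. split; simpl; auto.
          eapply Rabs_between; [ | exact Hy]. lra. }
      rewrite <- E.
      apply (is_derive_RInt_param (fun u t => Q (u, t))).
      * generalize (locally_Rabs_lt _ _ _ Hx). apply filter_imp. intros a Ha t Ht.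
        exists (M (a, t)). apply (HQ (a, t)). apply Hsq. split; simpl; auto. eapply Rabs_between; eauto.
      * intros t Ht.
        assert (Ht' : Rabs (t - y0) < e) by (eapply Rabs_between; eauto).
        apply continuity_2d_pt_ext_loc with (f := fun a b => M (a, b)).
        -- destruct (locally_Rabs_lt _ _ _ Hx) as [e1 He1]. destruct (locally_Rabs_lt _ _ _ Ht') as [e2 He2].
           assert (Hm : 0 < Rmin e1 e2) by (apply Rmin_pos; apply cond_pos).
           exists (mkposreal _ Hm). intros u v Hu Hv; simpl in Hu, Hv.
           symmetry; apply is_derive_unique. apply (HQ (u, v)). apply Hsq. split; simpl.
           ++ apply He1. eapply Rlt_le_trans; [exact Hu | apply Rmin_l].
           ++ apply He2. eapply Rlt_le_trans; [exact Hv | apply Rmin_r].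
        -- apply continuous_2d_pt_of_continuous. now apply KM.
      * generalize (locally_Rabs_lt _ _ _ Hx). apply filter_imp. intros a Ha. now apply IQ.
  - unfold corner_integral; simpl.
    replace (Q (x, y)) with (0 + Q (x, y)) by ring.
    apply: is_derive_plus; [apply: is_derive_const | ].
    apply (is_derive_RInt (fun s => Q (x, s)) _ y0 y).
    + generalize (locally_Rabs_lt _ _ _ Hy). apply filter_imp. intros a Ha. apply (RInt_correct (V:=R_CompleteNormedModule)). now apply IQ.
    + apply (continuous_slice2 Q (x, y)). now apply KQ.
Qed.

Lemma open_square (z0 : C) (e : R) : open (square z0 e).
Proof.
  intros [x y] [Hx Hy]. destruct z0 as [x0 y0]; simpl in *.
  destruct (locally_Rabs_lt _ _ _ Hx) as [e1 He1]. destruct (locally_Rabs_lt _ _ _ Hy) as [e2 He2].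
  assert (Hm : 0 < Rmin e1 e2) by (apply Rmin_pos; apply cond_pos).
  exists (mkposreal _ Hm). intros [u v] [Hu Hv]. split; simpl.
  - apply He1. eapply Rlt_le_trans; [exact Hu | apply Rmin_l].
  - apply He2. eapply Rlt_le_trans; [exact Hv | apply Rmin_r].
Qed.

Lemma corner_integral_primitive (F P Q : C -> R) (z0 : C) (e : R) (z z' : C) :
  C1_grad (square z0 e) F P Q -> square z0 e z -> square z0 e z' ->
  corner_integral P Q z z' = F z' - F z.
Proof.
  intros HF [Hx Hy] [Hx' Hy'].
  assert (HB : forall a b c s, Rabs (a - c) < e -> Rabs (b - c) < e -> Rmin a b <= s <= Rmax a b -> Rabs (s - c) < e).
  { intros a b c s Ha Hb Hs. apply Rabs_lt_between. apply Rabs_lt_between in Ha. apply Rabs_lt_between in Hb.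
    revert Hs; unfold Rmin, Rmax; destruct (Rle_dec a b); lra. }
  unfold corner_integral.
  assert (E1 : is_RInt (fun s => P (s, Im z)) (Re z) (Re z') (F (Re z', Im z) - F (Re z, Im z))).
  { apply: (is_RInt_derive (fun s => F (s, Im z))); intros s Hs;
     assert (Hsq : square z0 e (s, Im z)) by (split; simpl; eauto).
    - apply (HF _ Hsq).
    - apply (continuous_slice1 P (s, Im z)). apply (HF _ Hsq). }
  assert (E2 : is_RInt (fun s => Q (Re z', s)) (Im z) (Im z') (F (Re z', Im z') - F (Re z', Im z))).
  { apply: (is_RInt_derive (fun s => F (Re z', s))); intros s Hs;
     assert (Hsq : square z0 e (Re z', s)) by (split; simpl; eauto).
    - apply (HF _ Hsq).
    - apply (continuous_slice2 Q (Re z', s)). apply (HF _ Hsq). }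
  rewrite (is_RInt_unique _ _ _ _ E1) (is_RInt_unique _ _ _ _ E2).
  destruct z, z'; simpl. ring.
Qed.

Definition C1_curve (c : R -> C) : Prop :=
  forall t, (ex_derive (fun s => Re (c s)) t /\ ex_derive (fun s => Im (c s)) t) /\
    continuous (dcurve c) t.

Definition form_at (P Q : C -> R) (z v : C) : R := P z * Re v + Q z * Im v.

Definition form_integral (P Q : C -> R) (c : R -> C) (a b : R) : R :=
  RInt (fun t => form_at P Q (c t) (dcurve c t)) a b.

Lemma continuous_Re {T : UniformSpace} (f : T -> C) (x : T) :
  continuous f x -> continuous (fun y => Re (f y)) x.
Proof. intros H. apply (continuous_comp f (fun z : C => Re z)); auto. apply: continuous_fst. Qed.

Lemma continuous_Im {T : UniformSpace} (f : T -> C) (x : T) :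
  continuous f x -> continuous (fun y => Im (f y)) x.
Proof. intros H. apply (continuous_comp f (fun z : C => Im z)); auto. apply: continuous_snd. Qed.

Lemma continuous_Cpair {T : UniformSpace} (f g : T -> R) (x : T) :
  continuous f x -> continuous g x -> continuous (fun y => (f y, g y) : C) x.
Proof.
  intros Hf Hg S [e He].
  assert (Hf' := Hf (ball (f x) e) (locally_ball _ _)).
  assert (Hg' := Hg (ball (g x) e) (locally_ball _ _)).
  unfold filtermap in *.
  generalize (filter_and (F := locally x) _ _ Hf' Hg'). apply filter_imp. intros y [H1 H2]. apply He. now split.
Qed.

Lemma C1_curve_continuous (c : R -> C) (t : R) : C1_curve c -> continuous c t.
Proof.
  intros Hc. destruct (Hc t) as [[H1 H2] _].
  apply continuous_ext with (f := fun s => (Re (c s), Im (c s)) : C).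
  - intros s; now destruct (c s).
  - apply continuous_Cpair; apply: ex_derive_continuous; auto.
Qed.

Lemma continuous_form_at (W : C -> Prop) (P Q : C -> R) (c : R -> C) (t : R) :
  (forall z, W z -> continuous P z /\ continuous Q z) -> C1_curve c -> W (c t) ->
  continuous (fun s => form_at P Q (c s) (dcurve c s)) t.
Proof.
  intros H Hc Ht. destruct (H _ Ht) as [HP HQ].
  pose proof (C1_curve_continuous c t Hc). pose proof (proj2 (Hc t)) as K.
  apply: continuous_plus; apply: continuous_mult.
  - apply (continuous_comp c P); auto.
  - now apply: continuous_Re.
  - apply (continuous_comp c Q); auto.
  - now apply: continuous_Im.
Qed.

Lemma ex_RInt_form (W : C -> Prop) (P Q : C -> R) (c : R -> C) (a b : R) :
  (forall z, W z -> continuous P z /\ continuous Q z) -> C1_curve c ->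
  (forall t, Rmin a b <= t <= Rmax a b -> W (c t)) ->
  ex_RInt (fun t => form_at P Q (c t) (dcurve c t)) a b.
Proof.
  intros H Hc Ht. apply (ex_RInt_continuous (V := R_CompleteNormedModule)).
  intros t It. apply (continuous_form_at W); auto.
Qed.

Lemma form_integral_primitive (W : C -> Prop) (F P Q : C -> R) (c : R -> C) (a b : R) :
  open W -> C1_grad W F P Q -> C1_curve c -> (forall t, Rmin a b <= t <= Rmax a b -> W (c t)) ->
  form_integral P Q c a b = F (c b) - F (c a).
Proof.
  intros HW HF Hc Ht. apply is_RInt_unique.
  apply: (is_RInt_derive (fun t => F (c t))); intros t It.
  - destruct (Hc t) as [[D1 D2] _].
    replace (form_at P Q (c t) (dcurve c t)) with
     (Derive (fun s => Re (c s)) t * P (c t) + Derive (fun s => Im (c s)) t * Q (c t))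
     by (unfold form_at, dcurve; simpl; ring).
    apply (C1_grad_comp_curve W); auto; now apply Derive_correct.
  - apply (continuous_form_at W); auto. intros z Hz. split; apply (HF z Hz).
Qed.

Lemma square_ball (z0 : C) (e : posreal) (z : C) : ball z0 e z <-> square z0 e z.
Proof. destruct z0, z; reflexivity. Qed.

(** A Lebesgue number for the covering of the image of a homotopy by squares
    contained in [W]. *)
Lemma lebesgue_squares (W : C -> Prop) (h : R * R -> C) (a b a' b' : R) :
  open W -> (forall x, continuous h x) ->
  (forall s t, a <= s <= b -> a' <= t <= b' -> W (h (s, t))) ->
  exists d : posreal, forall s t, a <= s <= b -> a' <= t <= b' ->
    exists z0 e, (forall z, square z0 e z -> W z) /\
      forall s' t', Rabs (s' - s) < d -> Rabs (t' - t) < d -> square z0 e (h (s', t')).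
Proof.
  intros HW Hh Hin.
  assert (Hloc : forall st : R * R, exists d : posreal,
    a <= fst st <= b -> a' <= snd st <= b' ->
    exists z0 e, (forall z, square z0 e z -> W z) /\
      forall s' t', Rabs (s' - fst st) < 2 * d -> Rabs (t' - snd st) < 2 * d -> square z0 e (h (s', t'))).
  { intros [s t]; simpl.
    destruct (classic ((a <= s <= b) /\ (a' <= t <= b'))) as [[Hs Ht] | Hn].
    - destruct (HW _ (Hin s t Hs Ht)) as [e He].
      destruct (Hh (s, t) _ (locally_ball (h (s, t)) e)) as [d Hd].
      assert (Hd2 : 0 < d / 2) by (generalize (cond_pos d); lra).
      exists (mkposreal _ Hd2). intros _ _. exists (h (s, t)), e. split.
      + intros z Hz. apply He. now apply square_ball.
      + intros s' t' H1 H2; simpl in H1, H2. apply square_ball. apply Hd.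
        replace (2 * (d / 2)) with (pos d) in H1, H2 by field.
        split; assumption.
    - exists (mkposreal 1 Rlt_0_1). intros; exfalso; tauto. }
  apply functional_choice in Hloc. destruct Hloc as [delta Hdelta].
  destruct (compactness_value_2d a b a' b' (fun s t => delta (s, t))) as [d Hd].
  exists d. intros s t Hs Ht.
  destruct (NNPP _ (Hd s t Hs Ht)) as (u & v & Hu & Hv & H1 & H2 & H3).
  destruct (Hdelta (u, v) Hu Hv) as (z0 & e & He & Hsq). simpl in Hsq.
  exists z0, e. split; auto. intros s' t' H4 H5. apply Hsq.
  - replace (s' - u) with ((s' - s) + (s - u)) by ring.
    eapply Rle_lt_trans; [apply Rabs_triang | lra].
  - replace (t' - v) with ((t' - t) + (t - v)) by ring.
    eapply Rle_lt_trans; [apply Rabs_triang | lra].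
Qed.

Fixpoint polygon_integral (P Q : C -> R) (z : nat -> C) (n : nat) : R :=
  match n with
  | O => 0
  | S m => polygon_integral P Q z m + corner_integral P Q (z m) (z (S m))
  end.

Lemma fine_mesh (T : R) (d : posreal) : 0 <= T ->
  exists N : nat, (0 < N)%nat /\ T / INR N < d.
Proof.
  intros HT.
  destruct (INR_unbounded (T / d)) as [N HN].
  exists (S N). split; [lia | ].
  assert (Hd := cond_pos d). assert (HS : 0 < INR (S N)) by (apply lt_0_INR; lia).
  rewrite S_INR in HS |- *.
  apply Rmult_lt_reg_r with (INR N + 1); auto. unfold Rdiv; rewrite Rmult_assoc Rinv_l; [ | lra].
  apply Rmult_lt_compat_r with (r := d) in HN; auto.
  unfold Rdiv in HN; rewrite Rmult_assoc Rinv_l in HN; lra.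
Qed.

Lemma mesh_range (T : R) (N i : nat) : 0 <= T -> (0 < N)%nat -> (i <= N)%nat -> 0 <= INR i * (T / INR N) <= T.
Proof.
  intros HT HN Hi.
  assert (HN' : 0 < INR N) by (apply lt_0_INR; lia).
  assert (Hi' : INR i <= INR N) by (apply le_INR; lia).
  assert (H0 := pos_INR i).
  replace (INR i * (T / INR N)) with (T * (INR i / INR N)) by (field; lra).
  assert (0 <= INR i / INR N <= 1).
  { split. apply Rmult_le_pos; auto. left; now apply Rinv_0_lt_compat.
    apply Rmult_le_reg_r with (INR N); auto. unfold Rdiv; rewrite Rmult_assoc Rinv_l; lra. }
  nra.
Qed.

Lemma mesh_last (T : R) (N : nat) : (0 < N)%nat -> INR N * (T / INR N) = T.
Proof. intros HN. field. apply not_0_INR; lia. Qed.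

(** The parameter rectangle is cut into cells that [h] maps into squares
    contained in [W].  On each such square the form has a primitive, so the
    corner integrals around the image of a cell add up to zero.  Two consecutive
    horizontal lines of the grid thus give the same polygonal sum, the vertical
    contributions cancelling because the loops are closed. *)
Lemma homotopy_invariance (W : C -> Prop) (P Q : C -> R) (h : R * R -> C) (g0 g1 : R -> C) (T : R) :
  open W -> closed_form W P Q -> 0 <= T ->
  (forall x, continuous h x) ->
  (forall s t, 0 <= s <= 1 -> 0 <= t <= T -> W (h (s, t))) ->
  (forall s, 0 <= s <= 1 -> h (s, 0) = h (s, T)) ->
  (forall t, 0 <= t <= T -> h (0, t) = g0 t /\ h (1, t) = g1 t) ->
  C1_curve g0 -> C1_curve g1 ->
  form_integral P Q g0 0 T = form_integral P Q g1 0 T.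
Proof.
  intros HW Hform HT Hh Hin Hper Hends Hg0 Hg1.
  destruct (lebesgue_squares W h 0 1 0 T HW Hh Hin) as [d Hd].
  destruct (fine_mesh T d HT) as (N & HN & HNd).
  destruct (fine_mesh 1 d Rle_0_1) as (M & HM & HMd).
  set (tau := fun j : nat => INR j * (T / INR N)).
  set (sig := fun i : nat => INR i * (1 / INR M)).
  assert (HN' : 0 < INR N) by (apply lt_0_INR; lia).
  assert (HM' : 0 < INR M) by (apply lt_0_INR; lia).
  assert (Htau : forall j, (j <= N)%nat -> 0 <= tau j <= T) by (intros; now apply mesh_range).
  assert (Hsig : forall j, (j <= M)%nat -> 0 <= sig j <= 1) by (intros; apply mesh_range; auto; lra).
  assert (HtN : tau N = T) by now apply mesh_last.
  assert (HsM : sig M = 1) by now apply mesh_last.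
  assert (Ht0 : tau O = 0) by (unfold tau; simpl; ring).
  assert (Hs0 : sig O = 0) by (unfold sig; simpl; ring).
  assert (HtS : forall j, tau (S j) - tau j = T / INR N) by (intros; unfold tau; rewrite S_INR; ring).
  assert (HsS : forall j, sig (S j) - sig j = 1 / INR M) by (intros; unfold sig; rewrite S_INR; ring).
  assert (HT0 : 0 <= T / INR N) by (apply Rmult_le_pos; auto; left; now apply Rinv_0_lt_compat).
  assert (H10 : 0 <= 1 / INR M) by (apply Rmult_le_pos; [lra | left; now apply Rinv_0_lt_compat]).
  assert (Hd0 : Rabs 0 < d) by (rewrite Rabs_R0; apply cond_pos).
  (* Around the image of a cell the four corner integrals cancel; summing over
     the cells [0], ..., [j - 1] of one row leaves its two vertical ends. *)
  assert (Hrow : forall i, (i < M)%nat -> forall j, (j <= N)%nat ->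
    polygon_integral P Q (fun j => h (sig i, tau j)) j
      + corner_integral P Q (h (sig i, tau j)) (h (sig (S i), tau j))
    = corner_integral P Q (h (sig i, tau O)) (h (sig (S i), tau O))
      + polygon_integral P Q (fun j => h (sig (S i), tau j)) j).
  { intros i Hi j. induction j as [ | j IH]; intros Hj; [simpl; ring | ].
    simpl. specialize (IH ltac:(lia)).
    destruct (Hd (sig i) (tau j) ltac:(apply Hsig; lia) ltac:(apply Htau; lia)) as (z0 & e & He & Hsq).
    assert (HF := square_primitive W P Q z0 e HW Hform He).
    assert (Q1 : square z0 e (h (sig i, tau j))) by (apply Hsq; rewrite Rminus_diag; auto).
    assert (Q2 : square z0 e (h (sig (S i), tau j))).
    { apply Hsq; [rewrite HsS Rabs_pos_eq; auto | rewrite Rminus_diag; auto]. }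
    assert (Q3 : square z0 e (h (sig i, tau (S j)))).
    { apply Hsq; [rewrite Rminus_diag; auto | rewrite HtS Rabs_pos_eq; auto ]. }
    assert (Q4 : square z0 e (h (sig (S i), tau (S j)))).
    { apply Hsq; [rewrite HsS Rabs_pos_eq; auto | rewrite HtS Rabs_pos_eq; auto ]. }
    pose proof (corner_integral_primitive _ P Q z0 e _ _ HF Q1 Q2).
    pose proof (corner_integral_primitive _ P Q z0 e _ _ HF Q1 Q3).
    pose proof (corner_integral_primitive _ P Q z0 e _ _ HF Q2 Q4).
    pose proof (corner_integral_primitive _ P Q z0 e _ _ HF Q3 Q4).
    lra. }
  assert (Hall : forall i, (i <= M)%nat ->
    polygon_integral P Q (fun j => h (sig i, tau j)) N = polygon_integral P Q (fun j => h (sig O, tau j)) N).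
  { intros i. induction i as [ | i IH]; intros Hi; [reflexivity | ].
    rewrite <- IH by lia. pose proof (Hrow i ltac:(lia) N ltac:(lia)) as HR.
    rewrite HtN Ht0 in HR. rewrite -(Hper (sig i)) in HR; [ | apply Hsig; lia].
    rewrite -(Hper (sig (S i))) in HR; [ | apply Hsig; lia]. lra. }
  (* On each piece of the mesh the arc and the corner path lie in one square,
     where both integrals are the increment of a primitive. *)
  assert (Hend : forall (s : R) (g : R -> C), 0 <= s <= 1 -> C1_curve g ->
    (forall t, 0 <= t <= T -> h (s, t) = g t) ->
    forall j, (j <= N)%nat -> form_integral P Q g 0 (tau j) = polygon_integral P Q (fun j => h (s, tau j)) j).
  { intros s g Hs Hg Hsg.
    assert (HPQ : forall z, W z -> continuous P z /\ continuous Q z).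
    { destruct Hform as (Px & Mx & Qy & HP & HQ). intros z Hz. split; eapply C1_grad_continuous; eauto. }
    assert (HgW : forall t, 0 <= t <= T -> W (g t)) by (intros t Ht; rewrite <- Hsg; auto).
    induction j as [ | j IH]; intros Hj.
    - simpl. rewrite Ht0. unfold form_integral. apply: RInt_point.
    - simpl. rewrite <- IH by lia.
      assert (H1 := Htau j ltac:(lia)). assert (H2 := Htau (S j) Hj). assert (H3 := HtS j).
      unfold form_integral.
      rewrite -(RInt_Chasles (V := R_CompleteNormedModule) _ 0 (tau j) (tau (S j))).
      2: apply (ex_RInt_form W); auto; intros t; rewrite Rmin_left ?Rmax_right; try lra; intros; apply HgW; lra.
      2: apply (ex_RInt_form W); auto; intros t; rewrite Rmin_left ?Rmax_right; try lra; intros; apply HgW; lra.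
      apply (f_equal2 Rplus); [reflexivity | ].
      destruct (Hd s (tau j) Hs H1) as (z0 & e & He & Hsq).
      assert (HF := square_primitive W P Q z0 e HW Hform He).
      assert (Hg' : forall t, tau j <= t <= tau (S j) -> square z0 e (g t)).
      { intros t Ht. rewrite <- Hsg by lra. apply Hsq; [rewrite Rminus_diag; auto | ].
        rewrite Rabs_pos_eq; lra. }
      rewrite (corner_integral_primitive _ P Q z0 e _ _ HF).
      2,3: rewrite Hsg; auto; apply Hg'; lra.
      rewrite !Hsg; auto.
      apply (form_integral_primitive (square z0 e)); auto. apply open_square.
      intros t; rewrite Rmin_left ?Rmax_right; try lra. auto. }
  assert (E0 := Hend 0 g0 ltac:(lra) Hg0 (fun t Ht => proj1 (Hends t Ht)) N ltac:(lia)).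
  assert (E1 := Hend 1 g1 ltac:(lra) Hg1 (fun t Ht => proj2 (Hends t Ht)) N ltac:(lia)).
  rewrite HtN in E0 E1. rewrite E0 E1.
  assert (H := Hall M ltac:(lia)). rewrite HsM Hs0 in H. now symmetry.
Qed.

(** * Green's formula on the unit disk *)

(** Uniform continuity of the integrand near the compact segment. *)
Lemma continuous_RInt_param (f : R -> R -> R) (a b x : R) : a <= b ->
  (forall t, a <= t <= b -> continuity_2d_pt f x t) ->
  locally x (fun y : R => ex_RInt (f y) a b) ->
  continuous (fun y => RInt (f y) a b) x.
Proof.
  intros Hab Hf Hex.
  apply continuity_pt_filterlim. apply continuity_pt_locally. intros eps.
  assert (He : 0 < eps / (b - a + 1)) by (apply Rdiv_lt_0_compat; [apply cond_pos | lra]).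
  destruct (uniform_continuity_2d_1d' f a b x Hf (mkposreal _ He)) as [d Hd]. simpl in Hd.
  generalize (filter_and (F := locally x) _ _ Hex (locally_ball x d)). apply filter_imp. intros y [Hy Hyd].
  assert (Hx : ex_RInt (f x) a b) by (apply (locally_singleton _ _ Hex)).
  change (RInt (f y) a b - RInt (f x) a b) with (minus (RInt (f y) a b) (RInt (f x) a b)).
  rewrite -(RInt_minus (V := R_CompleteNormedModule)); auto.
  eapply Rle_lt_trans.
  - apply (abs_RInt_le_const (fun t => minus (f y t) (f x t)) a b (eps / (b - a + 1))); auto.
    + now apply: ex_RInt_minus.
    + intros t Ht. left. apply Hd; try lra.
      * generalize (cond_pos d); lra.
      * unfold ball in Hyd; simpl in Hyd; unfold AbsRing_ball, abs, minus, plus, opp in Hyd; simpl in Hyd.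
        apply Rabs_lt_between in Hyd. lra.
      * rewrite Rminus_diag Rabs_R0; apply cond_pos.
  - apply Rlt_le_trans with ((b - a + 1) * (eps / (b - a + 1))).
    + apply Rmult_lt_compat_r; lra.
    + right; field; lra.
Qed.

Definition polar (x : C) : C := (Re x * cos (Im x), Re x * sin (Im x)).

Lemma polar_expi (r t : R) : (RtoC r * expi t)%C = polar (r, t).
Proof. unfold polar, expi, RtoC, Cmult; simpl. f_equal; ring. Qed.

Lemma continuous_cos_snd (x : C) : continuous (fun y : C => cos (Im y)) x.
Proof. apply (continuous_comp (fun y : C => Im y) cos). apply: continuous_snd. apply continuous_cos. Qed.
Lemma continuous_sin_snd (x : C) : continuous (fun y : C => sin (Im y)) x.
Proof. apply (continuous_comp (fun y : C => Im y) sin). apply: continuous_snd. apply continuous_sin. Qed.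
Lemma continuous_fst_C (x : C) : continuous (fun y : C => Re y) x.
Proof. apply: continuous_fst. Qed.

Lemma continuous_polar (x : C) : continuous polar x.
Proof.
  apply continuous_Cpair; apply: continuous_mult.
  - apply continuous_fst_C.
  - apply continuous_cos_snd.
  - apply continuous_fst_C.
  - apply continuous_sin_snd.
Qed.

(** With [I r] the integral of the form along the circle of radius [r], the
    derivative of [I] is the integral of [r (Qx - Py)] over that circle: the
    [r]-derivative of the integrand differs from it by the [t]-derivative of the
    radial component [v] of the form, which has period [2 PI]. *)
Lemma green_unit_disk (W : C -> Prop) (P Px Py Q Qx Qy : C -> R) :
  open W -> (forall x, Cmod x <= 1 -> W x) -> C1_grad W P Px Py -> C1_grad W Q Qx Qy ->
  form_integral P Q expi 0 (2 * PI) = disk_RInt (fun z => Qx z - Py z).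
Proof.
  intros HW Hdisk HP HQ.
  assert (HPI := PI_RGT_0).
  assert (Hpol : forall r t, 0 <= r <= 1 -> W (polar (r, t))).
  { intros r t Hr. apply Hdisk. unfold polar, Cmod; simpl.
    rewrite -[X in _ <= X]sqrt_1. apply sqrt_le_1_alt.
    pose proof (sin2_cos2 t) as H; unfold Rsqr in H. nra. }
  (* Differentiating up to [r = 1] needs circles of radius slightly above [1]. *)
  destruct (lebesgue_squares W polar 0 1 0 (2 * PI) HW continuous_polar) as [d Hd].
  { intros; now apply Hpol. }
  assert (Htube : forall r t, - d < r < 1 + d -> 0 <= t <= 2 * PI -> W (polar (r, t))).
  { intros r t Hr Ht. assert (Hd0 := cond_pos d).
    assert (Hs : exists s, 0 <= s <= 1 /\ Rabs (r - s) < d).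
    { destruct (Rle_dec r 0). exists 0. split; [lra | apply Rabs_lt_between; lra].
      destruct (Rle_dec r 1). exists r. split; [lra | apply Rabs_lt_between; lra].
      exists 1. split; [lra | apply Rabs_lt_between; lra]. }
    destruct Hs as (s & Hs & Hrs).
    destruct (Hd s t Hs Ht) as (z0 & e & He & Hsq). apply He, Hsq; auto.
    rewrite Rminus_diag Rabs_R0; auto. }
  assert (KC : forall F Fx Fy x, C1_grad W F Fx Fy -> W (polar x) ->
     continuous (fun x => F (polar x)) x /\ continuous (fun x => Fx (polar x)) x /\ continuous (fun x => Fy (polar x)) x).
  { intros F Fx Fy x HF Hx.
    repeat split; apply (continuous_comp polar); try apply continuous_polar.
    now apply (C1_grad_continuous W F Fx Fy). all: now apply HF. }
  set (f := fun r t => P (polar (r, t)) * (- r * sin t) + Q (polar (r, t)) * (r * cos t)).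
  set (u := fun x : C => (Px (polar x) * cos (Im x) + Py (polar x) * sin (Im x)) * (- Re x * sin (Im x))
      + P (polar x) * - sin (Im x) +
      ((Qx (polar x) * cos (Im x) + Qy (polar x) * sin (Im x)) * (Re x * cos (Im x)) + Q (polar x) * cos (Im x))).
  (* [u] is the [r]-derivative of the integrand, [v] the radial component of the
     form; they satisfy [u - dv/dt = g]. *)
  set (v := fun x : C => P (polar x) * cos (Im x) + Q (polar x) * sin (Im x)).
  set (g := fun r t => (Qx (polar (r, t)) - Py (polar (r, t))) * r).
  assert (Dr : forall F Fx Fy r t, C1_grad W F Fx Fy -> W (polar (r, t)) ->
     is_derive (fun r => F (polar (r, t))) r (Fx (polar (r, t)) * cos t + Fy (polar (r, t)) * sin t)).
  { intros F Fx Fy r t HF Hx.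
    replace (Fx (polar (r, t)) * cos t + Fy (polar (r, t)) * sin t) with
      (cos t * Fx (polar (r, t)) + sin t * Fy (polar (r, t))) by ring.
    apply (C1_grad_comp_curve W F Fx Fy (fun r => polar (r, t))); auto; simpl; auto_derive; auto; ring. }
  assert (Dt : forall F Fx Fy r t, C1_grad W F Fx Fy -> W (polar (r, t)) ->
     is_derive (fun t => F (polar (r, t))) t (Fx (polar (r, t)) * (- r * sin t) + Fy (polar (r, t)) * (r * cos t))).
  { intros F Fx Fy r t HF Hx.
    replace (Fx (polar (r, t)) * (- r * sin t) + Fy (polar (r, t)) * (r * cos t)) with
      ((- r * sin t) * Fx (polar (r, t)) + (r * cos t) * Fy (polar (r, t))) by ring.
    apply (C1_grad_comp_curve W F Fx Fy (fun t => polar (r, t))); auto; simpl; auto_derive; auto; ring. }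
  assert (Df : forall r t, W (polar (r, t)) -> is_derive (fun r => f r t) r (u (r, t))).
  { intros r t Hx. unfold f, u; simpl.
    apply: is_derive_plus.
    - apply (is_derive_mult (K := R_AbsRing) (fun r => P (polar (r, t))) (fun r => - r * sin t)); [ | | exact Rmult_comm].
      now apply Dr. auto_derive; auto; ring.
    - apply (is_derive_mult (K := R_AbsRing) (fun r => Q (polar (r, t))) (fun r => r * cos t)); [ | | exact Rmult_comm].
      now apply Dr. auto_derive; auto; ring. }
  assert (Dv : forall r t, W (polar (r, t)) -> is_derive (fun t => v (r, t)) t (u (r, t) - g r t)).
  { intros r t Hx.
    assert (K : is_derive (fun t => v (r, t)) t
      ((Px (polar (r, t)) * (- r * sin t) + Py (polar (r, t)) * (r * cos t)) * cos t + P (polar (r, t)) * - sin t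
      + ((Qx (polar (r, t)) * (- r * sin t) + Qy (polar (r, t)) * (r * cos t)) * sin t + Q (polar (r, t)) * cos t))).
    { unfold v; simpl. apply: is_derive_plus.
      - apply (is_derive_mult (K := R_AbsRing) (fun t => P (polar (r, t))) cos); [ | | exact Rmult_comm].
        now apply Dt. auto_derive; auto; ring.
      - apply (is_derive_mult (K := R_AbsRing) (fun t => Q (polar (r, t))) sin); [ | | exact Rmult_comm].
        now apply Dt. auto_derive; auto; ring. }
    replace (u (r, t) - g r t) with
     ((Px (polar (r, t)) * (- r * sin t) + Py (polar (r, t)) * (r * cos t)) * cos t + P (polar (r, t)) * - sin t
      + ((Qx (polar (r, t)) * (- r * sin t) + Qy (polar (r, t)) * (r * cos t)) * sin t + Q (polar (r, t)) * cos t)); auto.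
    unfold u, g; simpl.
    set (a := Px _); set (b := Py _); set (a' := Qx _); set (b' := Qy _); set (p := P _); set (q := Q _).
    replace (a' - b) with ((a' - b) * (sin t * sin t + cos t * cos t)).
    ring. pose proof (sin2_cos2 t) as H; unfold Rsqr in H. rewrite H; ring. }
  assert (Ku : forall x, W (polar x) -> continuous u x).
  { intros x Hx. destruct (KC P Px Py x HP Hx) as (?&?&?). destruct (KC Q Qx Qy x HQ Hx) as (?&?&?).
    pose proof (continuous_cos_snd x). pose proof (continuous_sin_snd x). pose proof (continuous_fst_C x).
    repeat first [assumption | apply: continuous_plus | apply: continuous_mult | apply: continuous_opp]. }
  assert (Kf : forall x, W (polar x) -> continuous (fun x : C => f (Re x) (Im x)) x).
  { intros [r t] Hx. destruct (KC P Px Py (r,t) HP Hx) as (?&?&?). destruct (KC Q Qx Qy (r,t) HQ Hx) as (?&?&?).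
    pose proof (continuous_cos_snd (r,t)). pose proof (continuous_sin_snd (r,t)). pose proof (continuous_fst_C (r,t)).
    apply continuous_ext with (f := fun x : C => P (polar x) * (- Re x * sin (Im x)) + Q (polar x) * (Re x * cos (Im x))).
    intros [a b]; reflexivity.
    repeat first [assumption | apply: continuous_plus | apply: continuous_mult | apply: continuous_opp]. }
  assert (Kg : forall x, W (polar x) -> continuous (fun x : C => g (Re x) (Im x)) x).
  { intros [r t] Hx. destruct (KC P Px Py (r,t) HP Hx) as (?&?&?). destruct (KC Q Qx Qy (r,t) HQ Hx) as (?&?&?).
    pose proof (continuous_fst_C (r,t)).
    apply continuous_ext with (f := fun x : C => (Qx (polar x) - Py (polar x)) * Re x).
    intros [a b]; reflexivity.
    apply: continuous_mult; auto. apply: continuous_minus; auto. }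
  assert (Hloc : forall r, 0 <= r <= 1 -> locally r (fun r' : R => - d < r' < 1 + d)).
  { intros r Hr. exists d. intros y Hy. unfold ball in Hy; simpl in Hy.
    unfold AbsRing_ball, abs, minus, plus, opp in Hy; simpl in Hy. apply Rabs_lt_between in Hy. lra. }
  assert (Hmm : forall t, Rmin 0 (2 * PI) <= t <= Rmax 0 (2 * PI) -> 0 <= t <= 2 * PI).
  { intros t. rewrite Rmin_left ?Rmax_right; lra. }
  assert (If : forall r, - d < r < 1 + d -> ex_RInt (f r) 0 (2 * PI)).
  { intros r Hr. apply (ex_RInt_continuous (V := R_CompleteNormedModule)). intros t Ht.
    apply (continuous_slice2 (fun x : C => f (Re x) (Im x)) (r, t)). apply Kf. apply Htube; auto. }
  assert (Ig : forall r, - d < r < 1 + d -> ex_RInt (g r) 0 (2 * PI)).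
  { intros r Hr. apply (ex_RInt_continuous (V := R_CompleteNormedModule)). intros t Ht.
    apply (continuous_slice2 (fun x : C => g (Re x) (Im x)) (r, t)). apply Kg. apply Htube; auto. }
  assert (DI : forall r, 0 <= r <= 1 -> is_derive (fun r => RInt (f r) 0 (2 * PI)) r (RInt (g r) 0 (2 * PI))).
  { intros r Hr. assert (Hd0 := cond_pos d).
    assert (E : RInt (fun t => Derive (fun r => f r t) r) 0 (2 * PI) = RInt (g r) 0 (2 * PI)).
    { rewrite (RInt_ext _ (fun t => u (r, t))).
      2:{ intros t Ht. apply is_derive_unique. apply Df. apply Htube; try lra. apply Hmm; lra. }
      rewrite (RInt_ext _ (fun t => (u (r, t) - g r t) + g r t)); [ | intros; simpl; ring].
      assert (Ev : is_RInt (fun t => u (r, t) - g r t) 0 (2 * PI) (v (r, 2 * PI) - v (r, 0))).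
      { apply: (is_RInt_derive (fun t => v (r, t))); intros t Ht.
        - apply Dv. apply Htube; auto; lra.
        - apply: continuous_minus.
          + apply (continuous_slice2 u (r, t)). apply Ku. apply Htube; auto; lra.
          + apply (continuous_slice2 (fun x : C => g (Re x) (Im x)) (r, t)). apply Kg. apply Htube; auto; lra. }
      apply is_RInt_unique.
      replace (RInt (g r) 0 (2 * PI)) with ((v (r, 2 * PI) - v (r, 0)) + RInt (g r) 0 (2 * PI)).
      - apply: is_RInt_plus; auto. apply: RInt_correct. apply Ig; lra.
      - unfold v, polar; simpl. rewrite cos_2PI sin_2PI cos_0 sin_0. ring. }
    rewrite <- E.
    apply (is_derive_RInt_param f).
    - generalize (Hloc r Hr). apply filter_imp. intros r' Hr' t Ht. exists (u (r', t)). apply Df. apply Htube; auto.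
    - intros t Ht.
      apply continuity_2d_pt_ext_loc with (f := fun a b => u (a, b)).
      + assert (Hw : W (polar (r, t))) by (apply Hpol; auto).
        destruct (continuous_polar (r, t) W) as [e He]. { now apply HW. }
        exists e. intros a b Ha Hb. symmetry; apply is_derive_unique. apply Df. apply (He (a, b)). now split.
      + apply continuous_2d_pt_of_continuous. apply Ku. apply Hpol; auto.
    - generalize (Hloc r Hr). apply filter_imp. intros r' Hr'. now apply If. }
  assert (E : is_RInt (fun r => RInt (g r) 0 (2 * PI)) 0 1 (RInt (f 1) 0 (2 * PI) - RInt (f 0) 0 (2 * PI))).
  { apply: (is_RInt_derive (fun r => RInt (f r) 0 (2 * PI))).
    - intros r. rewrite Rmin_left ?Rmax_right; try lra. apply DI.
    - intros r. rewrite Rmin_left ?Rmax_right; try lra. intros Hr.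
      apply continuous_RInt_param; [lra | | ].
      + intros t Ht. apply (continuous_2d_pt_of_continuous (fun x : C => g (Re x) (Im x))). apply Kg, Hpol, Hr.
      + generalize (Hloc r Hr). apply filter_imp. intros r' Hr'. now apply Ig. }
  unfold disk_RInt.
  transitivity (RInt (fun r => RInt (g r) 0 (2 * PI)) 0 1).
  - rewrite (is_RInt_unique _ _ _ _ E).
    rewrite (RInt_ext (f 0) (fun _ => 0)); [ | intros; unfold f; simpl; ring].
    rewrite RInt_const. unfold scal; simpl; unfold mult; simpl. rewrite Rmult_0_r Rminus_0_r.
    apply RInt_ext. intros t _. unfold f, form_at, dcurve, expi, polar; simpl.
    rewrite !Rmult_1_l.
    replace (Derive (fun s => cos s) t) with (- sin t) by (symmetry; apply is_derive_unique; auto_derive; auto; ring).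
    replace (Derive (fun s => sin s) t) with (cos t) by (symmetry; apply is_derive_unique; auto_derive; auto; ring).
    simpl. ring.
  - apply RInt_ext. intros r _. apply RInt_ext. intros t _. rewrite polar_expi. reflexivity.
Qed.

(** * Rotations of hyperbolic space and their Killing fields *)

Lemma C_ext (x y : C) : Re x = Re y -> Im x = Im y -> x = y.
Proof. destruct x, y; simpl; intros; subst; reflexivity. Qed.

Ltac C_ring := apply C_ext; simpl; unfold Re, Im; ring.

(** Holomorphic functions and their conjugates are differentiated together
    along real curves, so the derivative is taken over the reals. *)
Definition is_derive_RC (f : R -> C) (t : R) (l : C) : Prop :=
  is_derive (fun s => Re (f s)) t (Re l) /\ is_derive (fun s => Im (f s)) t (Im l).

Lemma is_derive_RC_const (a : C) (t : R) : is_derive_RC (fun _ => a) t (RtoC 0).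
Proof. split; simpl; apply: is_derive_const. Qed.

Lemma is_derive_RC_plus (f g : R -> C) (t : R) (l m : C) :
  is_derive_RC f t l -> is_derive_RC g t m -> is_derive_RC (fun s => (f s + g s)%C) t (l + m)%C.
Proof. intros [H1 H2] [H3 H4]; split; simpl; apply: is_derive_plus; auto. Qed.

Lemma is_derive_RC_mult (f g : R -> C) (t : R) (l m : C) :
  is_derive_RC f t l -> is_derive_RC g t m ->
  is_derive_RC (fun s => (f s * g s)%C) t (l * g t + f t * m)%C.
Proof.
  intros [H1 H2] [H3 H4].
  assert (M : forall (a b : R -> R) a' b', is_derive a t a' -> is_derive b t b' ->
     is_derive (fun s => a s * b s) t (a' * b t + a t * b')).
  { intros. apply (is_derive_mult (K := R_AbsRing)); auto. exact Rmult_comm. }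
  split; simpl.
  - replace (_ + _) with ((Re l * Re (g t) + Re (f t) * Re m) - (Im l * Im (g t) + Im (f t) * Im m)) by (unfold Re, Im; ring).
    apply: (is_derive_minus (fun s => Re (f s) * Re (g s)) (fun s => Im (f s) * Im (g s))); now apply M.
  - replace (_ + _) with ((Re l * Im (g t) + Re (f t) * Im m) + (Im l * Re (g t) + Im (f t) * Re m)) by (unfold Re, Im; ring).
    apply: (is_derive_plus (fun s => Re (f s) * Im (g s)) (fun s => Im (f s) * Re (g s))); now apply M.
Qed.

Lemma is_derive_RC_conj (f : R -> C) (t : R) (l : C) :
  is_derive_RC f t l -> is_derive_RC (fun s => Cconj (f s)) t (Cconj l).
Proof. intros [H1 H2]; split; simpl; auto. apply: is_derive_opp; auto. Qed.

Lemma is_derive_RC_inv (f : R -> C) (t : R) (l : C) :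
  is_derive_RC f t l -> f t <> RtoC 0 -> is_derive_RC (fun s => (/ f s)%C) t (- l / (f t * f t))%C.
Proof.
  intros [H1 H2] H0.
  assert (Hn : Re (f t) ^ 2 + Im (f t) ^ 2 <> 0).
  { intros E. apply H0. apply C_ext; simpl; nra. }
  set (a := fun s => Re (f s)) in *. set (b := fun s => Im (f s)) in *.
  assert (Ea : ex_derive a t) by (eexists; eauto). assert (Eb : ex_derive b t) by (eexists; eauto).
  pose proof (is_derive_unique _ _ _ H1) as D1. pose proof (is_derive_unique _ _ _ H2) as D2.
  change (a t ^ 2 + b t ^ 2 <> 0) in Hn.
  split.
  - apply (is_derive_ext (fun s => a s / (a s ^ 2 + b s ^ 2))); [reflexivity | ].
    auto_derive; [repeat split; auto | ].
    rewrite D1 D2. unfold Cdiv, Cmult, Cinv, Copp; simpl. fold (Re l) (Im l).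
    change (fst (f t)) with (a t). change (snd (f t)) with (b t).
    unfold Re, Im. field. simpl in Hn. split; nra.
  - apply (is_derive_ext (fun s => - b s / (a s ^ 2 + b s ^ 2))); [reflexivity | ].
    auto_derive; [repeat split; auto | ].
    rewrite D1 D2. unfold Cdiv, Cmult, Cinv, Copp; simpl. fold (Re l) (Im l).
    change (fst (f t)) with (a t). change (snd (f t)) with (b t).
    unfold Re, Im. field. simpl in Hn. split; nra.
Qed.

Lemma RtoC_Cmod2 (z : C) : RtoC (Cmod z ^ 2) = (z * Cconj z)%C.
Proof.
  rewrite -Cmod2_conj. reflexivity.
Qed.

(** The restriction of this field to [w = 0] is [(a + b z + c z^2) d/dz]; the
    terms in [w] are those of the unique extension to a Killing field. *)
Definition killing (a b c : C) (q : E3) : E3 :=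
  ((a + b * fst q + c * (fst q * fst q) - Cconj c * RtoC (cw q ^ 2))%C,
   Re (b + 2 * c * fst q)%C * cw q).

Lemma isom_den_pos (M : SL2) (z : C) (w : R) : 0 < w ->
  0 < Cmod (m21 M * z + m22 M)%C ^ 2 + Cmod (m21 M) ^ 2 * w ^ 2.
Proof.
  intros Hw. destruct (Ceq_dec (m21 M) (RtoC 0)) as [E | E].
  - rewrite E Cmod_0. replace (RtoC 0 * z + m22 M)%C with (m22 M) by ring.
    assert (m22 M <> RtoC 0).
    { intros E2. pose proof (SL2_det M) as D. rewrite E E2 in D.
      replace (m11 M * 0 - m12 M * 0)%C with (RtoC 0) in D by ring. injection D; lra. }
    apply Cmod_gt_0 in H. nra.
  - apply Cmod_gt_0 in E. pose proof (pow2_ge_0 (Cmod (m21 M * z + m22 M)%C)).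
    assert (0 < Cmod (m21 M) ^ 2) by (apply pow_lt; auto). assert (0 < w ^ 2) by (apply pow_lt; auto). nra.
Qed.

(** The denominator of [isom M q] as a complex number in which the conjugates
    occur explicitly, so that [field] can treat them as independent variables. *)
Definition isom_den (M : SL2) (q : E3) : C :=
  ((m21 M * fst q + m22 M) * (Cconj (m21 M) * Cconj (fst q) + Cconj (m22 M))
   + m21 M * Cconj (m21 M) * (cw q * cw q))%C.

Lemma isom_den_RtoC (M : SL2) (q : E3) :
  isom_den M q = RtoC (Cmod (m21 M * fst q + m22 M)%C ^ 2 + Cmod (m21 M) ^ 2 * cw q ^ 2).
Proof.
  unfold isom_den. rewrite RtoC_plus RtoC_mult !RtoC_Cmod2 Cplus_conj Cmult_conj.
  replace (RtoC (cw q ^ 2)) with (cw q * cw q)%C by (rewrite -RtoC_mult; f_equal; ring). reflexivity.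
Qed.

Lemma isom_den_neq_0 (M : SL2) (q : E3) : H3 q -> isom_den M q <> RtoC 0.
Proof.
  intros Hq. rewrite isom_den_RtoC. pose proof (isom_den_pos M (fst q) (cw q) Hq).
  intros E. apply RtoC_inj in E. lra.
Qed.

Lemma fst_isom (M : SL2) (q : E3) :
  fst (isom M q) = (((m11 M * fst q + m12 M) * (Cconj (m21 M) * Cconj (fst q) + Cconj (m22 M))
     + m11 M * Cconj (m21 M) * (cw q * cw q)) / isom_den M q)%C.
Proof.
  unfold isom; cbn [fst]. rewrite -isom_den_RtoC Cplus_conj Cmult_conj.
  replace (RtoC (cw q ^ 2)) with (cw q * cw q)%C by (rewrite -RtoC_mult; f_equal; ring). reflexivity.
Qed.

Lemma cw_isom (M : SL2) (q : E3) : H3 q -> RtoC (cw (isom M q)) = (cw q / isom_den M q)%C.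
Proof.
  intros Hq. unfold isom, cw at 1; cbn [snd]. rewrite isom_den_RtoC -RtoC_div; auto.
  apply Rgt_not_eq. now apply isom_den_pos.
Qed.

Lemma isom_H3 (M : SL2) (q : E3) : H3 q -> H3 (isom M q).
Proof. intros Hq. unfold H3, isom, cw at 1; cbn [snd]. apply Rdiv_lt_0_compat; auto. now apply isom_den_pos. Qed.

Lemma E3_ext (p q : E3) : fst p = fst q -> RtoC (cw p) = RtoC (cw q) -> p = q.
Proof. destruct p, q; unfold cw; simpl. intros -> E. apply RtoC_inj in E. now rewrite E. Qed.

Lemma SL2_det_conj (M : SL2) :
  (Cconj (m11 M) * Cconj (m22 M) - Cconj (m12 M) * Cconj (m21 M) = 1)%C.
Proof.
  rewrite -!Cmult_conj -Cminus_conj SL2_det. apply C_ext; simpl; ring.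
Qed.

(** Here [a'], ..., [z'] stand for the conjugates of [a], ..., [z].  Every step
    is a polynomial identity after one factor [a d - b c = 1] has been inserted;
    the essential one is that the linear form [c z + d], evaluated at the image
    point, is the conjugate of [- c z + a] divided by [D]. *)
Lemma isom_inv_algebra (a b c d a' b' c' d' z z' w D : C) :
  (a * d - b * c = 1)%C -> (a' * d' - b' * c' = 1)%C ->
  D = ((- c * z + a) * (- c' * z' + a') + c * c' * (w * w))%C -> D <> RtoC 0 ->
  let N := ((d * z - b) * (- c' * z' + a') - d * c' * (w * w))%C in
  let N' := ((d' * z' - b') * (- c * z + a) - d' * c * (w * w))%C in
  let E := ((c * (N / D) + d) * (c' * (N' / D) + d') + c * c' * (w / D * (w / D)))%C in
  (((a * (N / D) + b) * (c' * (N' / D) + d') + a * c' * (w / D * (w / D))) / E = z)%C /\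
  (w / D / E = w)%C.
Proof.
  intros det det' ED HD N N' E.
  assert (L : (c * (N / D) + d = (- c' * z' + a') / D)%C).
  { transitivity ((c * N + d * D) / D)%C; [now field | ]. f_equal.
    transitivity ((a * d - b * c) * (- c' * z' + a'))%C; [ | rewrite det; ring].
    unfold N. rewrite ED. ring. }
  assert (L' : (c' * (N' / D) + d' = (- c * z + a) / D)%C).
  { transitivity ((c' * N' + d' * D) / D)%C; [now field | ]. f_equal.
    transitivity ((a' * d' - b' * c') * (- c * z + a))%C; [ | rewrite det'; ring].
    unfold N'. rewrite ED. ring. }
  assert (EE : E = (/ D)%C).
  { unfold E. rewrite L L'. transitivity (((- c * z + a) * (- c' * z' + a') + c * c' * (w * w)) / (D * D))%C; [now field | ].
    rewrite -ED. now field. }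
  rewrite EE L'. split; [ | now field].
  transitivity (((a * N + b * D) * (- c * z + a) + a * c' * (w * w)) / D)%C; [now field | ].
  replace (a * N + b * D)%C with ((- c' * z' + a') * z - c' * (w * w))%C.
  - transitivity (z * D / D)%C; [ | now field]. f_equal. rewrite ED. ring.
  - transitivity ((a * d - b * c) * ((- c' * z' + a') * z - c' * (w * w)))%C; [rewrite det; ring | ].
    unfold N. rewrite ED. ring.
Qed.

Lemma Cconj_RtoC (x : R) : Cconj (RtoC x) = RtoC x.
Proof. apply C_ext; simpl; ring. Qed.

Lemma isom_isom_inv (M : SL2) (q : E3) : H3 q -> isom M (isom (SL2_inv M) q) = q.
Proof.
  intros Hq. set (q' := isom (SL2_inv M) q).
  assert (Hq' : H3 q') by now apply isom_H3.
  pose proof (isom_den_neq_0 (SL2_inv M) q Hq) as HD.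
  pose proof (SL2_det M) as det. pose proof (SL2_det_conj M) as det'.
  pose proof (fst_isom (SL2_inv M) q) as Z. pose proof (cw_isom (SL2_inv M) q Hq) as Wz.
  fold q' in Z, Wz.
  assert (ED : isom_den (SL2_inv M) q = ((- m21 M * fst q + m11 M) * (- Cconj (m21 M) * Cconj (fst q) + Cconj (m11 M))
   + m21 M * Cconj (m21 M) * (cw q * cw q))%C).
  { unfold isom_den; cbn. rewrite !Copp_conj. ring. }
  assert (EDc : Cconj (isom_den (SL2_inv M) q) = isom_den (SL2_inv M) q).
  { rewrite isom_den_RtoC. apply Cconj_RtoC. }
  set (D := isom_den (SL2_inv M) q) in *.
  assert (Zc : Cconj (fst q') = (((Cconj (m22 M) * Cconj (fst q) - Cconj (m12 M)) * (- (m21 M) * fst q + m11 M)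
      - Cconj (m22 M) * (m21 M) * (cw q * cw q)) / D)%C).
  { rewrite Z Cdiv_conj; auto. rewrite EDc. f_equal. cbn -[cw].
    rewrite ?(Cplus_conj, Cmult_conj, Copp_conj, Cconj_conj, Cconj_RtoC). ring. }
  assert (Z' : fst q' = (((m22 M * fst q - m12 M) * (- Cconj (m21 M) * Cconj (fst q) + Cconj (m11 M))
      - m22 M * Cconj (m21 M) * (cw q * cw q)) / D)%C).
  { rewrite Z. f_equal. cbn -[cw]. rewrite Copp_conj. ring. }
  pose proof (isom_den_neq_0 M q' Hq') as HD'.
  pose proof (fst_isom M q') as Z2. pose proof (cw_isom M q' Hq') as W2.
  unfold isom_den in HD', Z2, W2. rewrite Wz Zc Z' in HD', Z2, W2.
  destruct (isom_inv_algebra _ _ _ _ _ _ _ _ _ _ _ D det det' ED HD) as [G1 G2].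
  apply E3_ext.
  - rewrite Z2 -[X in _ = X]G1. reflexivity.
  - rewrite W2 -[X in _ = X]G2. reflexivity.
Qed.

(** With primes for conjugates and [N / D] the first coordinate of the image
    point, the equalities say that the derivative of the image, when [z] moves
    with velocity [I z], is the value of the Killing field there.  They follow
    from the factorizations [H1], [H2], [H3], linear in [N] and [D], which hold
    because [a d - b c = 1]. *)
Lemma rotation_field_algebra (a b c d a' b' c' d' z z' w D I : C) :
  (a * d - b * c = 1)%C -> (a' * d' - b' * c' = 1)%C ->
  D = ((c * z + d) * (c' * z' + d') + c * c' * (w * w))%C -> D <> RtoC 0 ->
  let N := ((a * z + b) * (c' * z' + d') + a * c' * (w * w))%C in
  let N1 := (a * (I * z) * (c' * z' + d') + (a * z + b) * (c' * (- I * z')))%C in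
  let D1 := (c * (I * z) * (c' * z' + d') + (c * z + d) * (c' * (- I * z')))%C in
  (N1 / D + N * (- D1 / (D * D)) =
    - I * a * b + I * (a * d + b * c) * (N / D) + - I * c * d * (N / D * (N / D))
    - I * c' * d' * (w / D * (w / D)))%C /\
  (w * (- D1 / (D * D)) =
   ((I * (a * d + b * c) + 2 * (- I * c * d) * (N / D)) +
    (- I * (a' * d' + b' * c') + 2 * (I * c' * d') * (((a' * z' + b') * (c * z + d) + a' * c * (w * w)) / D))) / 2 * (w / D))%C.
Proof.
  intros det det' ED HD N N1 D1.
  assert (H1 : (a * D - c * N = c' * z' + d')%C).
  { transitivity ((a * d - b * c) * (c' * z' + d'))%C; [unfold N; rewrite ED; ring | rewrite det; ring]. }
  assert (H2 : (b * D - d * N = - ((c' * z' + d') * z + c' * (w * w)))%C).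
  { transitivity ((a * d - b * c) * (- ((c' * z' + d') * z + c' * (w * w))))%C; [unfold N; rewrite ED; ring | rewrite det; ring]. }
  set (N' := ((a' * z' + b') * (c * z + d) + a' * c * (w * w))%C).
  assert (H1' : (a' * D - c' * N' = c * z + d)%C).
  { transitivity ((a' * d' - b' * c') * (c * z + d))%C; [unfold N'; rewrite ED; ring | rewrite det'; ring]. }
  assert (H2' : (b' * D - d' * N' = - ((c * z + d) * z' + c * (w * w)))%C).
  { transitivity ((a' * d' - b' * c') * (- ((c * z + d) * z' + c * (w * w))))%C; [unfold N'; rewrite ED; ring | rewrite det'; ring]. }
  assert (H3 : ((a * z + b) * D - (c * z + d) * N = - (c' * (w * w)))%C).
  { transitivity ((a * d - b * c) * (- (c' * (w * w))))%C; [unfold N; rewrite ED; ring | rewrite det; ring]. }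
  split.
  - transitivity ((N1 * D - N * D1) / (D * D))%C; [now field | ].
    transitivity ((- I * ((a * D - c * N) * (b * D - d * N)) - I * c' * d' * (w * w)) / (D * D))%C; [ | now field].
    f_equal.
    transitivity (I * z * (c' * z' + d') * (a * D - c * N) - I * z' * c' * ((a * z + b) * D - (c * z + d) * N))%C.
    + unfold N1, D1. ring.
    + rewrite H1 H2 H3. ring.
  - transitivity ((- D1 * (w * D)) / (D * D * D))%C; [now field | ].
    transitivity ((I * (d * (a * D - c * N) + c * (b * D - d * N)) - I * (d' * (a' * D - c' * N') + c' * (b' * D - d' * N'))) / 2 * w / (D * D))%C.
    + rewrite H1 H2 H1' H2'. unfold D1. field; auto.
    + fold N'. field; auto.
Qed.

Lemma Cconj_Ci : Cconj Ci = (- Ci)%C.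
Proof. apply C_ext; simpl; ring. Qed.

Lemma is_derive_expi (t : R) : is_derive_RC expi t (Ci * expi t)%C.
Proof. split; simpl; auto_derive; auto; ring. Qed.

Lemma is_derive_E3_of_RC (f : R -> E3) (t : R) (V : E3) :
  is_derive_RC (fun s => fst (f s)) t (fst V) -> is_derive_RC (fun s => RtoC (cw (f s))) t (RtoC (cw V)) ->
  is_derive_E3 f t V.
Proof. intros [K1 K2] [K3 _]. exact (conj K1 (conj K2 K3)). Qed.

Lemma is_derive_RC_ext (f g : R -> C) (t : R) (l m : C) :
  (forall s, f s = g s) -> l = m -> is_derive_RC f t l -> is_derive_RC g t m.
Proof.
  intros E El [H1 H2]. rewrite -El. split.
  - apply (is_derive_ext (fun s => Re (f s))); auto. intros; now rewrite E.
  - apply (is_derive_ext (fun s => Im (f s))); auto. intros; now rewrite E.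
Qed.

(** The velocity of the conjugated rotation at time [0]; the coefficients are
    those of the matrix [M diag(i/2, -i/2) M^-1] acting on the sphere. *)
Lemma is_derive_isom_rot0 (M : SL2) (q : E3) : H3 q ->
  is_derive_E3 (fun t => isom M (rot0 t q)) 0
    (killing (- Ci * m11 M * m12 M) (Ci * (m11 M * m22 M + m12 M * m21 M)) (- Ci * m21 M * m22 M) (isom M q)).
Proof.
  intros Hq.
  assert (Hr : forall t, H3 (rot0 t q)) by (intros; exact Hq).
  assert (R0 : rot0 0 q = q).
  { unfold rot0, expi. rewrite cos_0 sin_0. destruct q as [z w]; unfold cw; simpl. f_equal. C_ring. }
  pose proof (SL2_det M) as det. pose proof (SL2_det_conj M) as det'.
  assert (DZ : is_derive_RC (fun t => (expi t * fst q)%C) 0 (Ci * fst q)%C).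
  { eapply is_derive_RC_ext; [intros; reflexivity | | apply is_derive_RC_mult; [apply is_derive_expi | apply is_derive_RC_const]].
    unfold expi; rewrite cos_0 sin_0. C_ring. }
  assert (E0 : (expi 0 * fst q = fst q)%C) by (unfold expi; rewrite cos_0 sin_0; C_ring).
  pose proof (isom_den_neq_0 M q Hq) as HD.
  assert (ED : isom_den M q = ((m21 M * fst q + m22 M) * (Cconj (m21 M) * Cconj (fst q) + Cconj (m22 M))
   + m21 M * Cconj (m21 M) * (cw q * cw q))%C) by reflexivity.
  destruct (rotation_field_algebra _ _ _ _ _ _ _ _ _ _ _ _ Ci det det' ED HD) as [G1 G2].
  assert (DX' : is_derive_RC (fun t => (Cconj (m21 M) * Cconj (expi t * fst q) + Cconj (m22 M))%C) 0
            (Cconj (m21 M) * (- Ci * Cconj (fst q)))%C).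
  { eapply is_derive_RC_ext; [intros; reflexivity | |
      apply is_derive_RC_plus; [apply is_derive_RC_mult; [apply is_derive_RC_const | apply is_derive_RC_conj, DZ] | apply is_derive_RC_const]].
    cbv beta. rewrite !Cmult_conj Cconj_Ci. ring. }
  assert (DD : is_derive_RC (fun t => isom_den M (rot0 t q)) 0
      (m21 M * (Ci * fst q) * (Cconj (m21 M) * Cconj (fst q) + Cconj (m22 M))
        + (m21 M * fst q + m22 M) * (Cconj (m21 M) * (- Ci * Cconj (fst q))))%C).
  { unfold isom_den, rot0, cw; cbn [fst snd].
    eapply is_derive_RC_ext; [intros; reflexivity | | apply is_derive_RC_plus; [apply is_derive_RC_mult;
     [apply is_derive_RC_plus; [apply is_derive_RC_mult; [apply is_derive_RC_const | exact DZ] | apply is_derive_RC_const]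
     | exact DX'] | apply is_derive_RC_const]].
    cbv beta. rewrite E0. ring. }
  assert (DI : is_derive_RC (fun t => (/ isom_den M (rot0 t q))%C) 0 _) by (apply is_derive_RC_inv; [exact DD | rewrite R0; exact HD]).
  rewrite R0 in DI.
  apply is_derive_E3_of_RC.
  - eapply (is_derive_RC_ext (fun t => (((m11 M * (expi t * fst q) + m12 M) *
        (Cconj (m21 M) * Cconj (expi t * fst q) + Cconj (m22 M)) + m11 M * Cconj (m21 M) * (cw q * cw q))
        * / isom_den M (rot0 t q))%C)); [intros t; rewrite fst_isom; reflexivity | | ].
    2: { apply is_derive_RC_mult; [ | exact DI].
      apply is_derive_RC_plus; [apply is_derive_RC_mult;
       [apply is_derive_RC_plus; [apply is_derive_RC_mult; [apply is_derive_RC_const | exact DZ] | apply is_derive_RC_const]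
       | exact DX'] | apply is_derive_RC_const]. }
    cbv beta. rewrite R0 E0. unfold killing; cbn [fst].
    replace (RtoC (cw (isom M q) ^ 2)) with (cw (isom M q) * cw (isom M q))%C by (rewrite -RtoC_mult; f_equal; ring).
    rewrite fst_isom cw_isom; auto.
    transitivity (- Ci * m11 M * m12 M + Ci * (m11 M * m22 M + m12 M * m21 M) * (fst (isom M q)) + - Ci * m21 M * m22 M * (fst (isom M q) * fst (isom M q))
    - Ci * Cconj (m21 M) * Cconj (m22 M) * (cw q / isom_den M q * (cw q / isom_den M q)))%C.
    + rewrite fst_isom -G1. unfold Cdiv. change (cw (rot0 0 q)) with (cw q). ring.
    + rewrite fst_isom !Cmult_conj Copp_conj Cconj_Ci. ring.
  - eapply (is_derive_RC_ext (fun t => (cw q * / isom_den M (rot0 t q))%C));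
      [intros t; rewrite cw_isom; [reflexivity | apply Hr] | | ].
    2: { apply is_derive_RC_mult; [apply is_derive_RC_const | exact DI]. }
    unfold killing, cw at 2; cbn [snd]. rewrite RtoC_mult re_alt cw_isom; auto.
    transitivity (cw q * (- (m21 M * (Ci * fst q) * (Cconj (m21 M) * Cconj (fst q) + Cconj (m22 M))
        + (m21 M * fst q + m22 M) * (Cconj (m21 M) * (- Ci * Cconj (fst q)))) / (isom_den M q * isom_den M q)))%C.
    { change (cw (rot0 0 q)) with (cw q). ring. }
    rewrite G2. f_equal. f_equal. f_equal.
    + rewrite fst_isom. reflexivity.
    + assert (EDc : Cconj (isom_den M q) = isom_den M q) by (rewrite isom_den_RtoC Cconj_RtoC; reflexivity).
      rewrite fst_isom. clear -HD EDc. revert HD EDc. generalize (isom_den M q) as D. intros D HD EDc.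
      rewrite ?(Cplus_conj, Cmult_conj, Copp_conj, Cconj_conj, Cconj_RtoC, Cconj_Ci).
      rewrite Cinv_conj; auto. rewrite ?(Cplus_conj, Cmult_conj, Copp_conj, Cconj_conj, Cconj_RtoC, Cconj_Ci) EDc.
      unfold Cdiv. ring.
Qed.

Lemma is_derive_E3_unique (c : R -> E3) (t : R) (V V' : E3) :
  is_derive_E3 c t V -> is_derive_E3 c t V' -> V = V'.
Proof.
  intros (H1 & H2 & H3) (K1 & K2 & K3).
  assert (A1 : cu V = cu V') by (rewrite -(is_derive_unique _ _ _ H1) -(is_derive_unique _ _ _ K1); reflexivity).
  assert (A2 : cv V = cv V') by (rewrite -(is_derive_unique _ _ _ H2) -(is_derive_unique _ _ _ K2); reflexivity).
  assert (A3 : cw V = cw V') by (rewrite -(is_derive_unique _ _ _ H3) -(is_derive_unique _ _ _ K3); reflexivity).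
  apply E3_ext; [apply C_ext; assumption | now rewrite A3].
Qed.

Lemma is_derive_E3_ext (f g : R -> E3) (t : R) (V : E3) :
  (forall s, f s = g s) -> is_derive_E3 f t V -> is_derive_E3 g t V.
Proof.
  intros E (H1 & H2 & H3). split; [ | split].
  - apply (is_derive_ext (fun s => cu (f s))); auto. intros; now rewrite E.
  - apply (is_derive_ext (fun s => cv (f s))); auto. intros; now rewrite E.
  - apply (is_derive_ext (fun s => cw (f s))); auto. intros; now rewrite E.
Qed.

(** Since [P = m12 / m22] and [Q = m11 / m21], the determinant gives
    [P - Q = - 1 / (m21 m22)].  After clearing denominators the expression is
    polynomial in the matrix entries, which is why the limit cases agree with it. *)
Lemma flux_fraction_mobius (M : SL2) (p0 p1 p2 : C) :
  flux_fraction p0 p1 p2 (mobius M (Pt (RtoC 0))) (mobius M Infty)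
  = (- (m11 M * m12 M * p2 + (m11 M * m22 M + m12 M * m21 M) * p1 + m21 M * m22 M * p0))%C.
Proof.
  pose proof (SL2_det M) as det. unfold mobius.
  replace (m21 M * 0 + m22 M)%C with (m22 M) by ring.
  replace (m11 M * 0 + m12 M)%C with (m12 M) by ring.
  destruct (Ceq_dec (m22 M) (RtoC 0)) as [E2 | E2]; destruct (Ceq_dec (m21 M) (RtoC 0)) as [E1 | E1]; unfold flux_fraction.
  - exfalso. rewrite E1 E2 in det. replace (m11 M * 0 - m12 M * 0)%C with (RtoC 0) in det by ring. injection det; lra.
  - rewrite E2 in det |- *.
    transitivity ((p2 * m11 M * (m11 M * 0 - m12 M * m21 M) + p1 * m21 M * (m11 M * 0 - m12 M * m21 M)) / m21 M)%C.
    + rewrite det. now field.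
    + now field.
  - rewrite E1 in det |- *.
    transitivity (- ((p2 * m12 M * (m11 M * m22 M - m12 M * 0) + p1 * m22 M * (m11 M * m22 M - m12 M * 0)) / m22 M))%C.
    + rewrite det. now field.
    + now field.
  - replace (m12 M / m22 M - m11 M / m21 M)%C with (- / (m21 M * m22 M))%C.
    + field. auto.
    + transitivity (- (m11 M * m22 M - m12 M * m21 M) / (m21 M * m22 M))%C; [rewrite det; field; auto | field; auto].
Qed.

(** The two descriptions of the coefficients of [Y] are matched here: as the
    field of the conjugated rotation, and through the fraction of the theorem. *)
Lemma rotation_killing_field (P Q : sphere) (Y : E3 -> E3) :
  is_rotation_killing_field P Q Y ->
  exists a b c : C, (forall q, H3 q -> Y q = killing a b c q) /\
    forall p0 p1 p2, Im (flux_fraction p0 p1 p2 P Q) = - Re (a * p2 - b * p1 + c * p0)%C.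
Proof.
  intros (Rot & (M & <- & <- & HM) & HY).
  exists (- Ci * m11 M * m12 M)%C, (Ci * (m11 M * m22 M + m12 M * m21 M))%C, (- Ci * m21 M * m22 M)%C.
  split.
  - intros q Hq.
    assert (R0 : Rot 0 q = q).
    { rewrite HM; auto. replace (rot0 0 (isom (SL2_inv M) q)) with (isom (SL2_inv M) q).
      now apply isom_isom_inv.
      unfold rot0, expi. rewrite cos_0 sin_0. apply E3_ext; [cbn [fst] | reflexivity].
      C_ring. }
    pose proof (HY 0 q Hq) as H. rewrite R0 in H.
    apply (is_derive_E3_unique _ _ _ _ H).
    apply (is_derive_E3_ext (fun t => isom M (rot0 t (isom (SL2_inv M) q)))).
    + intros s. rewrite HM; auto.
    + rewrite -{2}(isom_isom_inv M q Hq). apply is_derive_isom_rot0. now apply isom_H3.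
  - intros p0 p1 p2. rewrite flux_fraction_mobius. simpl. unfold Re, Im. ring.
Qed.

(** The second row of the matrix is [(C0 D)]: the name [C] is the type of
    complex numbers. *)
Definition bryant_point (A B C0 D : C) : E3 :=
  let n := Cmod A ^ 2 + Cmod B ^ 2 in
  (((Cconj A * C0 + Cconj B * D) / RtoC n)%C, 1 / n).

(** The differential of [bryant_point].  Its first component is the sum of a
    complex linear term in [A1], ..., [D1] and an antilinear one. *)
Definition bryant_tangent (A B C0 D A1 B1 C1 D1 : C) : E3 :=
  let n := (A * Cconj A + B * Cconj B)%C in
  let S := (A1 * Cconj A + B1 * Cconj B)%C in
  let N := (Cconj A * C0 + Cconj B * D)%C in
  ((((Cconj A * C1 + Cconj B * D1) * n - N * S) / (n * n)
    + ((Cconj A1 * C0 + Cconj B1 * D) * n - N * Cconj S) / (n * n))%C,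
   2 * Re (- S / (n * n))%C).

Lemma bryant_n_RtoC (A B : C) : RtoC (Cmod A ^ 2 + Cmod B ^ 2) = (A * Cconj A + B * Cconj B)%C.
Proof. rewrite RtoC_plus !RtoC_Cmod2. reflexivity. Qed.

Lemma bryant_n_pos (A B C0 D : C) : (A * D - B * C0 = 1)%C -> 0 < Cmod A ^ 2 + Cmod B ^ 2.
Proof.
  intros det. destruct (Ceq_dec A (RtoC 0)) as [E | E].
  - assert (HB : B <> RtoC 0).
    { intros E2. rewrite E E2 in det. replace (0 * D - 0 * C0)%C with (RtoC 0) in det by ring. injection det; lra. }
    apply Cmod_gt_0 in HB. pose proof (pow2_ge_0 (Cmod A)). assert (0 < Cmod B ^ 2) by (apply pow_lt; auto). lra.
  - apply Cmod_gt_0 in E. pose proof (pow2_ge_0 (Cmod B)). assert (0 < Cmod A ^ 2) by (apply pow_lt; auto). lra.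
Qed.

Lemma is_derive_bryant_point (A B C0 D : R -> C) (t : R) (A1 B1 C1 D1 : C) :
  (A t * D t - B t * C0 t = 1)%C ->
  is_derive_RC A t A1 -> is_derive_RC B t B1 -> is_derive_RC C0 t C1 -> is_derive_RC D t D1 ->
  is_derive_E3 (fun s => bryant_point (A s) (B s) (C0 s) (D s)) t
    (bryant_tangent (A t) (B t) (C0 t) (D t) A1 B1 C1 D1).
Proof.
  intros det HA HB HC HD.
  pose proof (bryant_n_pos _ _ _ _ det) as Hn.
  set (n := fun s => (A s * Cconj (A s) + B s * Cconj (B s))%C).
  assert (Hn0 : n t <> RtoC 0).
  { unfold n. rewrite -bryant_n_RtoC. intros E. apply RtoC_inj in E. lra. }
  assert (Dn : is_derive_RC n t ((A1 * Cconj (A t) + A t * Cconj A1) + (B1 * Cconj (B t) + B t * Cconj B1))%C).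
  { apply is_derive_RC_plus; apply is_derive_RC_mult; auto; now apply is_derive_RC_conj. }
  pose proof (is_derive_RC_inv _ _ _ Dn Hn0) as Di.
  apply is_derive_E3_of_RC.
  - unfold bryant_point, bryant_tangent; cbn [fst].
    apply (is_derive_RC_ext (fun s => ((Cconj (A s) * C0 s + Cconj (B s) * D s) * / n s)%C) _ t
      ((Cconj A1 * C0 t + Cconj (A t) * C1 + (Cconj B1 * D t + Cconj (B t) * D1)) * / n t
       + (Cconj (A t) * C0 t + Cconj (B t) * D t) * (- ((A1 * Cconj (A t) + A t * Cconj A1) + (B1 * Cconj (B t) + B t * Cconj B1)) / (n t * n t)))%C).
    + intros s. rewrite bryant_n_RtoC. reflexivity.
    + fold (n t). rewrite ?(Cplus_conj, Cmult_conj, Cconj_conj). field. auto.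
    + apply is_derive_RC_mult; [ | exact Di].
      apply is_derive_RC_plus; apply is_derive_RC_mult; auto; now apply is_derive_RC_conj.
  - unfold bryant_point, bryant_tangent, cw; cbn [snd].
    assert (Hr : is_derive (fun s => / (Cmod (A s) ^ 2 + Cmod (B s) ^ 2)) t
       (- (Re ((A1 * Cconj (A t) + A t * Cconj A1) + (B1 * Cconj (B t) + B t * Cconj B1))%C) / ((Cmod (A t) ^ 2 + Cmod (B t) ^ 2) ^ 2))).
    { apply (is_derive_inv (fun s => Cmod (A s) ^ 2 + Cmod (B s) ^ 2)); [ | lra].
      apply (is_derive_ext (fun s => Re (n s))); [ | apply Dn].
      intros s. unfold n. rewrite -bryant_n_RtoC. reflexivity. }
    split; simpl; [ | apply: is_derive_const].
    apply (is_derive_ext (fun s => / (Cmod (A s) ^ 2 + Cmod (B s) ^ 2))).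
    { intros s. unfold Rdiv. now rewrite Rmult_1_l. }
    match goal with |- is_derive _ _ ?r => replace r with
       (- (Re ((A1 * Cconj (A t) + A t * Cconj A1) + (B1 * Cconj (B t) + B t * Cconj B1))%C) / ((Cmod (A t) ^ 2 + Cmod (B t) ^ 2) ^ 2)) end; auto.
    set (S := (A1 * Cconj (A t) + B1 * Cconj (B t))%C).
    change (- Re ((A1 * Cconj (A t) + A t * Cconj A1) + (B1 * Cconj (B t) + B t * Cconj B1))%C / (Cmod (A t) ^ 2 + Cmod (B t) ^ 2) ^ 2
      = 2 * Re (- S / (n t * n t))%C).
    unfold n. rewrite -bryant_n_RtoC. set (r := Cmod (A t) ^ 2 + Cmod (B t) ^ 2) in *.
    rewrite -RtoC_mult -(Cmult_1_l (- S)%C). unfold Cdiv. rewrite -RtoC_inv; [ | nra].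
    unfold S. simpl. unfold Re, Im. simpl. field. lra.
Qed.

(** * Pointwise form of the flux density *)

(** [P + conj Q] and [2 Re T] are the components of [dX v]; those of
    [dX (- i v)] have [- i P] and [i conj Q] instead.  In the difference the terms
    that are not complex linear in [v] cancel. *)
Lemma vdot_killing_split (P Q T h k beta : C) (w : R) :
  vdot ((- Ci * P + Ci * Cconj Q)%C, 2 * Im T) ((h - Cconj k)%C, Re beta * w)
  - vdot ((P + Cconj Q)%C, 2 * Re T) ((Ci * h + Ci * Cconj k)%C, - Im beta * w)
  = 2 * Im (h * Q - k * P + RtoC w * (beta * T))%C.
Proof. unfold vdot, cu, cv, cw; simpl; unfold Re, Im; simpl. ring. Qed.

(** Primes stand for conjugates.  Compare the coefficients of [a], [b] and [c]:
    the determinant enters through that of [b], its derivative through that of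
    [c]. *)
Lemma bryant_flux_algebra (A B C0 D A' B' A1 B1 C1 D1 a b c : C) :
  (A * D - B * C0 = 1)%C -> (A1 * D + A * D1 - B1 * C0 - B * C1 = 0)%C ->
  let n := (A * A' + B * B')%C in
  let S := (A1 * A' + B1 * B')%C in
  let N := (A' * C0 + B' * D)%C in
  n <> RtoC 0 ->
  let P := (((A' * C1 + B' * D1) * n - N * S) / (n * n))%C in
  let Q := ((A * B1 - B * A1) / (n * n))%C in
  let T := (- S / (n * n))%C in
  ((a + b * (N / n) + c * (N / n * (N / n))) * Q - c * (1 / n * (1 / n)) * P
    + 1 / n * ((b + 2 * c * (N / n)) * T)
  = - (a * (B * A1 - A * B1) - b * (C0 * B1 - D * A1) + c * (D * C1 - C0 * D1)) / (n * n))%C.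
Proof.
  intros det det1 n S N Hn P Q T.
  assert (Hb : (N * (A * B1 - B * A1) - S = (C0 * B1 - D * A1) * n)%C).
  { transitivity (N * (A * B1 - B * A1) - S * (A * D - B * C0))%C; [rewrite det; ring | ].
    unfold N, S, n. ring. }
  assert (Hc : (N * (C0 * B1 - D * A1) - (A' * C1 + B' * D1) = - (D * C1 - C0 * D1) * n)%C).
  { transitivity (N * (C0 * B1 - D * A1) + N * 0 - (A' * C1 + B' * D1) * 1)%C; [ring | ].
    rewrite -det1 -det. unfold N, n. ring. }
  unfold P, Q, T.
  transitivity ((a * (A * B1 - B * A1) * (n * n) + b * (N * (A * B1 - B * A1) - S) * n
     + c * (N * (N * (A * B1 - B * A1) - S) - N * S - ((A' * C1 + B' * D1) * n - N * S))) / (n * n * (n * n)))%C.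
  { field. auto. }
  rewrite Hb.
  replace (N * ((C0 * B1 - D * A1) * n) - N * S - ((A' * C1 + B' * D1) * n - N * S))%C
    with ((N * (C0 * B1 - D * A1) - (A' * C1 + B' * D1)) * n)%C by ring.
  rewrite Hc. field. auto.
Qed.

(** The pointwise identity on which the theorem rests: its right side is the
    imaginary part of a form that is complex linear in [(A1, B1, C1, D1)]. *)
Lemma bryant_flux_density (A B C0 D A1 B1 C1 D1 a b c : C) :
  (A * D - B * C0 = 1)%C -> (A1 * D + A * D1 - B1 * C0 - B * C1 = 0)%C ->
  let q := bryant_point A B C0 D in
  hyp q (bryant_tangent A B C0 D (- Ci * A1) (- Ci * B1) (- Ci * C1) (- Ci * D1)) (killing a b c q)
  - hyp q (bryant_tangent A B C0 D A1 B1 C1 D1) (killing (Ci * a) (Ci * b) (Ci * c) q)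
  = - 2 * Im (a * (B * A1 - A * B1) - b * (C0 * B1 - D * A1) + c * (D * C1 - C0 * D1))%C.
Proof.
  intros det det1 q.
  pose proof (bryant_n_pos _ _ _ _ det) as Hn.
  set (n := (A * Cconj A + B * Cconj B)%C).
  set (r := Cmod A ^ 2 + Cmod B ^ 2) in *.
  assert (Er : n = RtoC r) by (unfold n, r; now rewrite bryant_n_RtoC).
  assert (Hn0 : n <> RtoC 0) by (rewrite Er; intros E; apply RtoC_inj in E; lra).
  set (S := (A1 * Cconj A + B1 * Cconj B)%C).
  set (N := (Cconj A * C0 + Cconj B * D)%C).
  set (P := (((Cconj A * C1 + Cconj B * D1) * n - N * S) / (n * n))%C).
  set (Q := ((A * B1 - B * A1) / (n * n))%C).
  set (T := (- S / (n * n))%C).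
  set (h := (a + b * (N / n) + c * (N / n * (N / n)))%C).
  set (k := (c * (1 / n * (1 / n)))%C).
  set (beta := (b + 2 * c * (N / n))%C).
  assert (Enc : Cconj n = n) by (rewrite Er; apply Cconj_RtoC).
  (* The antilinear part of [dX] simplifies thanks to the determinant. *)
  assert (EQ : forall A1 B1, (((Cconj A1 * C0 + Cconj B1 * D) * n - N * Cconj (A1 * Cconj A + B1 * Cconj B)) / (n * n) = Cconj ((A * B1 - B * A1) / (n * n)))%C).
  { intros A2 B2. rewrite Cdiv_conj; [ | apply Cmult_neq_0; auto].
    rewrite !Cmult_conj Enc. f_equal.
    rewrite ?(Cplus_conj, Cmult_conj, Cconj_conj, Cminus_conj).
    transitivity ((A * D - B * C0) * (Cconj A * Cconj B2 - Cconj B * Cconj A2))%C; [ | rewrite det; ring].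
    unfold n, N. ring. }
  assert (Ez : fst q = (N / n)%C) by (rewrite Er; reflexivity).
  assert (Ew : cw q = 1 / r) by reflexivity.
  assert (Ewc : RtoC (cw q) = (1 / n)%C) by (rewrite Er Ew -RtoC_div; [reflexivity | lra]).
  assert (Ew2 : RtoC (cw q ^ 2) = (1 / n * (1 / n))%C) by (rewrite -Ewc -RtoC_mult; f_equal; ring).
  assert (Ekc : Cconj k = (Cconj c * (1 / n * (1 / n)))%C).
  { unfold k. rewrite -Ew2 Cmult_conj Cconj_RtoC. reflexivity. }
  assert (EV : bryant_tangent A B C0 D A1 B1 C1 D1 = ((P + Cconj Q)%C, 2 * Re T)).
  { unfold bryant_tangent. fold n N. rewrite EQ. reflexivity. }
  assert (EiV : bryant_tangent A B C0 D (- Ci * A1) (- Ci * B1) (- Ci * C1) (- Ci * D1)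
     = ((- Ci * P + Ci * Cconj Q)%C, 2 * Im T)).
  { unfold bryant_tangent. fold n N. rewrite EQ. f_equal.
    - replace ((A * (- Ci * B1) - B * (- Ci * A1)) / (n * n))%C with (- Ci * Q)%C by (unfold Q, Cdiv; ring).
      rewrite Cmult_conj Copp_conj Cconj_Ci. unfold P, S, Cdiv. ring.
    - replace (- (- Ci * A1 * Cconj A + - Ci * B1 * Cconj B) / (n * n))%C with (- Ci * T)%C by (unfold T, S, Cdiv; ring).
      simpl. unfold Re, Im. ring. }
  assert (EK : killing a b c q = ((h - Cconj k)%C, Re beta * (1 / r))).
  { unfold killing. rewrite Ez Ekc Ew2. reflexivity. }
  assert (EiK : killing (Ci * a) (Ci * b) (Ci * c) q = ((Ci * h + Ci * Cconj k)%C, - Im beta * (1 / r))).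
  { unfold killing. rewrite Ez Ekc Ew2 Ew Cmult_conj Cconj_Ci. f_equal.
    - unfold h. ring.
    - f_equal. unfold beta. generalize (N / n)%C. intros z. simpl. unfold Re, Im. ring. }
  unfold hyp. rewrite EV EiV EK EiK.
  transitivity ((vdot ((- Ci * P + Ci * Cconj Q)%C, 2 * Im T) ((h - Cconj k)%C, Re beta * (1 / r))
  - vdot ((P + Cconj Q)%C, 2 * Re T) ((Ci * h + Ci * Cconj k)%C, - Im beta * (1 / r))) / cw q ^ 2).
  { unfold Rdiv. ring. }
  rewrite vdot_killing_split.
  replace (RtoC (1 / r)) with (1 / n)%C by (rewrite -Ew Ewc; reflexivity).
  unfold h, k, beta.
  rewrite (bryant_flux_algebra A B C0 D (Cconj A) (Cconj B) A1 B1 C1 D1 a b c det det1 Hn0).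
  fold n. rewrite Ew Er. set (G := (a * _ - _ + _)%C).
  unfold Cdiv. rewrite -RtoC_mult -RtoC_inv; [ | nra].
  simpl. unfold Re, Im. simpl. field. lra.
Qed.

Lemma vdot_vscal_l (x : R) (V W : E3) : vdot (vscal x V) W = x * vdot V W.
Proof. unfold vdot, vscal, cu, cv, cw; simpl. unfold Re, Im; simpl. ring. Qed.

Lemma E3_ext_R (V W : E3) : cu V = cu W -> cv V = cv W -> cw V = cw W -> V = W.
Proof. intros H1 H2 H3. apply E3_ext; [now apply C_ext | now rewrite H3]. Qed.

Ltac E3_simpl := unfold dmap, vadd, vscal, vopp, vsub, vdot; repeat (unfold cu, cv, cw, Re, Im; simpl).

(** Conformality makes [v] orthogonal to [g] in the plane; since [X1], [X2] and
    the mean curvature vector form a direct frame and [(dX g, dX v)] is completed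
    by the opposite vector, [v] lies to the right of [g].  The unit length of
    [dX v] then compensates the length of [dX g]. *)
Lemma conormal_eq (X : C -> E3) (z g v : C) (Yq : E3) :
  conformal_immersion_at X z ->
  0 < det3 (D1 X z) (D2 X z) (mean_curvature_vector X z) ->
  g <> RtoC 0 ->
  hnorm (X z) (dmap X z v) = 1 ->
  hyp (X z) (dmap X z v) (dmap X z g) = 0 ->
  0 < det3 (dmap X z g) (dmap X z v) (vopp (mean_curvature_vector X z)) ->
  (exists mu, 0 < mu /\ v = (RtoC mu * (- Ci * g))%C) /\
  hyp (X z) (dmap X z v) Yq * hnorm (X z) (dmap X z g) = hyp (X z) (dmap X z (- Ci * g)%C) Yq.
Proof.
  intros (HE & HE2 & HF) Hor Hg Hu Ho Hd.
  set (q := X z) in *. set (V1 := D1 X z) in *. set (V2 := D2 X z) in *. set (H := mean_curvature_vector X z) in *.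
  set (e := hyp q V1 V1) in *.
  assert (Hb : forall x y : C, hyp q (dmap X z x) (dmap X z y) = e * (Re x * Re y + Im x * Im y)).
  { intros x y.
    transitivity (Re x * Re y * hyp q V1 V1 + (Re x * Im y + Im x * Re y) * hyp q V1 V2 + Im x * Im y * hyp q V2 V2).
    - unfold dmap, hyp, Rdiv. fold V1 V2. generalize (/ cw q ^ 2) V1 V2.
      intros i0 [[u1 u2] u3] [[t1 t2] t3]. E3_simpl. ring.
    - rewrite HF -HE2. fold e. ring. }
  assert (Hdet : forall x y : C, det3 (dmap X z x) (dmap X z y) (vopp H) = - (Re x * Im y - Im x * Re y) * det3 V1 V2 H).
  { intros x y. unfold dmap. fold V1 V2. generalize V1 V2 H.
    intros [[u1 u2] u3] [[t1 t2] t3] [[h1 h2] h3]. unfold det3, vcross. E3_simpl. ring. }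
  rewrite Hdet in Hd. rewrite Hb in Ho.
  assert (Hort : Re v * Re g + Im v * Im g = 0).
  { apply Rmult_integral in Ho. destruct Ho; [lra | auto]. }
  assert (Hcr : Re g * Im v - Im g * Re v < 0).
  { apply Rnot_le_lt. intros Hle. nra. }
  assert (Hg2 : 0 < Re g ^ 2 + Im g ^ 2).
  { assert (Re g <> 0 \/ Im g <> 0).
    { destruct (Req_dec (Re g) 0); auto. destruct (Req_dec (Im g) 0); auto. exfalso. apply Hg. now apply C_ext. }
    destruct H0; nra. }
  set (mu := - (Re g * Im v - Im g * Re v) / (Re g ^ 2 + Im g ^ 2)).
  assert (Hmu : 0 < mu) by (apply Rdiv_lt_0_compat; lra).
  assert (Hv : v = (RtoC mu * (- Ci * g))%C).
  { apply C_ext.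
    - transitivity (mu * Im g); [ | simpl; unfold Re, Im; simpl; ring].
      transitivity (((Re v * Re g + Im v * Im g) * Re g - (Re g * Im v - Im g * Re v) * Im g) / (Re g ^ 2 + Im g ^ 2)).
      + field. lra.
      + rewrite Hort. unfold mu. field. lra.
    - transitivity (- mu * Re g); [ | simpl; unfold Re, Im; simpl; ring].
      transitivity (((Re v * Re g + Im v * Im g) * Im g + (Re g * Im v - Im g * Re v) * Re g) / (Re g ^ 2 + Im g ^ 2)).
      + field. lra.
      + rewrite Hort. unfold mu. field. lra. }
  split; [exists mu; auto | ].
  assert (Hdv : hyp q (dmap X z v) Yq = mu * hyp q (dmap X z (- Ci * g)%C) Yq).
  { rewrite Hv. unfold hyp, dmap, Rdiv. fold V1 V2. generalize (/ cw q ^ 2) V1 V2.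
    intros i0 [[u1 u2] u3] [[t1 t2] t3]. E3_simpl. ring. }
  rewrite Hdv.
  assert (Hm : mu * hnorm q (dmap X z g) = 1).
  { rewrite -Hu. unfold hnorm. rewrite -{1}(sqrt_Rsqr mu); [ | lra]. rewrite -sqrt_mult_alt; [ | apply Rle_0_sqr].
    f_equal. rewrite !Hb. clearbody mu. subst v. unfold Rsqr. simpl. unfold Re, Im; simpl. ring. }
  transitivity ((mu * hnorm q (dmap X z g)) * hyp q (dmap X z (- Ci * g)%C) Yq); [ring | ].
  rewrite Hm. ring.
Qed.

Lemma vdot_self_eq_0 (V : E3) : vdot V V = 0 -> V = ((0, 0), 0).
Proof.
  destruct V as [[x y] w]. E3_simpl. intros E.
  assert (x = 0) by (apply Rsqr_0_uniq; unfold Rsqr; nra).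
  assert (y = 0) by (apply Rsqr_0_uniq; unfold Rsqr; nra).
  assert (w = 0) by (apply Rsqr_0_uniq; unfold Rsqr; nra).
  now subst.
Qed.

(** The area element is the norm of the cross product whose direction is the
    unit normal, so their product is polynomial.  It vanishes where the two
    vectors are dependent, whatever the normal is there. *)
Lemma area_flux (q V W Yq : E3) : H3 q ->
  hyp q (unit_normal q V W) Yq * area_element q V W = det3 V W Yq / cw q ^ 3.
Proof.
  intros Hq. unfold H3 in Hq.
  set (n := vcross V W). set (N2 := vdot n n).
  assert (HN : 0 <= N2) by (unfold N2, vdot; nra).
  assert (Ha : area_element q V W = sqrt N2 / cw q ^ 2).
  { unfold area_element. replace (hyp q V V * hyp q W W - hyp q V W ^ 2) with (N2 / (cw q ^ 2) ^ 2).
    - rewrite sqrt_div_alt; [ | apply pow_lt, pow_lt; lra]. f_equal. apply sqrt_pow2. apply pow_le; lra.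
    - unfold hyp, N2, n, vcross, vdot, cu, cv, cw in *; simpl; unfold Re, Im; simpl. field. lra. }
  assert (Hh : hnorm q n = sqrt N2 / cw q).
  { unfold hnorm, hyp. fold N2. rewrite sqrt_div_alt; [ | apply pow_lt; lra]. f_equal. apply sqrt_pow2; lra. }
  rewrite Ha. unfold unit_normal. fold n. unfold hyp. rewrite vdot_vscal_l Hh.
  unfold det3. fold n.
  destruct (Req_dec N2 0) as [E | E].
  - rewrite E sqrt_0. assert (n = ((0, 0), 0)).
    { now apply vdot_self_eq_0. }
    rewrite H. unfold vdot, cu, cv, cw; simpl. unfold Rdiv; ring.
  - assert (0 < sqrt N2) by (apply sqrt_lt_R0; lra). field. split; lra.
Qed.

(** * The flux of a Killing field through a disk *)

Definition C1_onE (W : C -> Prop) (V : C -> E3) : Prop :=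
  C1_on W (fun z => cu (V z)) /\ C1_on W (fun z => cv (V z)) /\ C1_on W (fun z => cw (V z)).

(** [<V, Z> / 2] for the field [Z] obtained from [killing a b c] by multiplying
    the coefficients by [i]. *)
Definition killing_potential (a b c : C) (q V : E3) : R :=
  vdot V (killing (Ci * a) (Ci * b) (Ci * c) q) / (2 * cw q ^ 2).

Lemma C1_on_hyp_killing (W : C -> Prop) (k V : C -> E3) (a b c : C) :
  open W -> C1_onE W k -> C1_onE W V -> (forall z, W z -> cw (k z) <> 0) ->
  C1_on W (fun z => hyp (k z) (V z) (killing a b c (k z))).
Proof.
  intros HW (K1 & K2 & K3) (V1 & V2 & V3) H0.
  apply C1_on_ext with (F := fun z =>
    (cu (V z) * (Re a + (Re b * cu (k z) + (- Im b) * cv (k z)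
         + (Re c * (cu (k z) * cu (k z) + (-1) * (cv (k z) * cv (k z)) + (-1) * (cw (k z) * cw (k z))) + (-2 * Im c) * (cu (k z) * cv (k z)))))
    + (cv (V z) * (Im a + (Im b * cu (k z) + Re b * cv (k z)
         + (Im c * (cu (k z) * cu (k z) + (-1) * (cv (k z) * cv (k z)) + cw (k z) * cw (k z)) + (2 * Re c) * (cu (k z) * cv (k z)))))
    + cw (V z) * (cw (k z) * (Re b + (2 * Re c * cu (k z) + (- 2 * Im c) * cv (k z))))))
    * / (cw (k z) * cw (k z))); auto.
  - repeat match goal with
      | K : C1_on W ?F |- C1_on W ?F => exact K
      | |- C1_on W (fun _ => ?r) => apply C1_on_const
      | |- C1_on W (fun z => _ + _) => apply C1_on_plus
      | |- C1_on W (fun z => _ * _) => apply C1_on_mult; [exact HW | | ]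
      | |- C1_on W (fun z => / _) => apply C1_on_inv; [exact HW | | ]
      end.
    intros z Hz. specialize (H0 z Hz). now apply Rmult_integral_contrapositive_currified.
  - intros z Hz. specialize (H0 z Hz). unfold hyp, killing. E3_simpl. field. auto.
Qed.

Lemma C1_on_killing_potential (W : C -> Prop) (k V : C -> E3) (a b c : C) :
  open W -> C1_onE W k -> C1_onE W V -> (forall z, W z -> cw (k z) <> 0) ->
  C1_on W (fun z => killing_potential a b c (k z) (V z)).
Proof.
  intros HW Hk HV H0.
  apply C1_on_ext with (F := fun z => / 2 * hyp (k z) (V z) (killing (Ci * a) (Ci * b) (Ci * c) (k z))); auto.
  - apply C1_on_mult; [exact HW | apply C1_on_const | now apply C1_on_hyp_killing].
  - intros z Hz. unfold killing_potential, hyp. field. now apply H0.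
Qed.

(** The differential of [killing a b c] at [q] applied to [q'], for any
    [a]. *)
Definition dkilling (b c : C) (q q' : E3) : E3 :=
  ((b * fst q' + 2 * c * fst q * fst q' - Cconj c * RtoC (2 * cw q * cw q'))%C,
   Re (2 * c * fst q')%C * cw q + Re (b + 2 * c * fst q)%C * cw q').

Definition dkilling_potential (a b c : C) (q q' V V' : E3) : R :=
  killing_potential a b c q V' + vdot V (dkilling (Ci * b) (Ci * c) q q') / (2 * cw q ^ 2)
  - vdot V (killing (Ci * a) (Ci * b) (Ci * c) q) * cw q' / cw q ^ 3.

Lemma is_derive_killing_potential (a b c : C) (q V : R -> E3) (t : R) (q' V' : E3) :
  is_derive_E3 q t q' -> is_derive_E3 V t V' -> cw (q t) <> 0 ->
  is_derive (fun s => killing_potential a b c (q s) (V s)) t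
    (dkilling_potential a b c (q t) q' (V t) V').
Proof.
  intros (H1 & H2 & H3) (H4 & H5 & H6) H0.
  set (u := fun s => cu (q s)) in *. set (v := fun s => cv (q s)) in *. set (w := fun s => cw (q s)) in *.
  set (x := fun s => cu (V s)) in *. set (y := fun s => cv (V s)) in *. set (z := fun s => cw (V s)) in *.
  change (w t <> 0) in H0.
  apply (is_derive_ext (fun s =>
    (x s * (- Im a - (Re b * v s + Im b * u s) - Re c * (2 * u s * v s) - Im c * (u s ^ 2 - v s ^ 2) + Im c * w s ^ 2)
     + y s * (Re a + (Re b * u s - Im b * v s) + (Re c * (u s ^ 2 - v s ^ 2) - Im c * (2 * u s * v s)) + Re c * w s ^ 2)
     + z s * (- (Im b + 2 * (Re c * v s + Im c * u s)) * w s)) / (2 * w s ^ 2))).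
  { intros s. unfold killing_potential, killing. unfold u, v, w, x, y, z. destruct (q s) as [[q1 q2] q3]. destruct (V s) as [[V1 V2] V3].
    E3_simpl. f_equal. ring. }
  assert (E1 : ex_derive u t) by (eexists; eauto). assert (E2 : ex_derive v t) by (eexists; eauto).
  assert (E3' : ex_derive w t) by (eexists; eauto). assert (E4 : ex_derive x t) by (eexists; eauto).
  assert (E5 : ex_derive y t) by (eexists; eauto). assert (E6 : ex_derive z t) by (eexists; eauto).
  auto_derive.
  { repeat split; auto. simpl. intros E. apply H0. nra. }
  replace (Derive (fun s => u s) t) with (cu q') by (symmetry; now apply is_derive_unique).
  replace (Derive (fun s => v s) t) with (cv q') by (symmetry; now apply is_derive_unique).
  replace (Derive (fun s => w s) t) with (cw q') by (symmetry; now apply is_derive_unique).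
  replace (Derive (fun s => x s) t) with (cu V') by (symmetry; now apply is_derive_unique).
  replace (Derive (fun s => y s) t) with (cv V') by (symmetry; now apply is_derive_unique).
  replace (Derive (fun s => z s) t) with (cw V') by (symmetry; now apply is_derive_unique).
  unfold dkilling_potential, killing_potential, killing, dkilling.
  revert H0. unfold u, v, w, x, y, z. clear.
  destruct (q t) as [[q1 q2] q3]. destruct (V t) as [[V1 V2] V3]. destruct q' as [[q1' q2'] q3']. destruct V' as [[V1' V2'] V3'].
  destruct a, b, c. E3_simpl. intros H0. field. auto.
Qed.

(** The exterior derivative of [V |-> <V, Z> / 2] is the contraction of the
    volume form with [killing a b c]. *)
Lemma dkilling_potential_curl (a b c : C) (q V1 V2 V' : E3) : cw q <> 0 ->
  dkilling_potential a b c q V1 V2 V' - dkilling_potential a b c q V2 V1 V'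
  = det3 V1 V2 (killing a b c q) / cw q ^ 3.
Proof.
  intros H0. unfold dkilling_potential, killing_potential, killing, dkilling, det3, vcross.
  destruct q as [[q1 q2] q3]. destruct V1 as [[x1 x2] x3]. destruct V2 as [[y1 y2] y3]. destruct V' as [[z1 z2] z3].
  destruct a, b, c. revert H0. E3_simpl. intros H0. field. auto.
Qed.

Lemma Ck_2_schwarz (W : C -> Prop) (F : C -> R) (z : C) :
  open W -> Ck 2 W F -> W z -> d1 (d2 F) z = d2 (d1 F) z.
Proof.
  intros HW HF Hz. destruct z as [x y].
  destruct (HW _ Hz) as [e He].
  pose proof (Ck_1_grad _ _ (Ck_2_1 _ _ HF)) as G0.
  destruct HF as (_ & _ & HF1 & HF2).
  pose proof (Ck_1_grad _ _ HF1) as G1. pose proof (Ck_1_grad _ _ HF2) as G2.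
  apply (Schwarz (fun a b => F (a, b)) x y).
  - exists e. intros u v Hu Hv. assert (Hw : W (u, v)) by (apply He; split; assumption).
    refine (conj _ (conj _ (conj _ _))).
    + eexists. apply (G0 (u, v) Hw).
    + eexists. apply (G0 (u, v) Hw).
    + eexists. apply (G2 (u, v) Hw).
    + eexists. apply (G1 (u, v) Hw).
  - apply (continuous_2d_pt_of_continuous (d1 (d2 F))). apply (G2 _ Hz).
  - apply (continuous_2d_pt_of_continuous (d2 (d1 F))). apply (G1 _ Hz).
Qed.

Lemma CkE_2_C1 (W : C -> Prop) (k : C -> E3) : CkE 2 W k ->
  C1_onE W k /\ C1_onE W (D1 k) /\ C1_onE W (D2 k).
Proof.
  intros (H1 & H2 & H3).
  assert (K : forall F, Ck 2 W F -> C1_on W F /\ C1_on W (d1 F) /\ C1_on W (d2 F)).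
  { intros F HF. pose proof (Ck_1_grad _ _ (Ck_2_1 _ _ HF)) as G0.
    destruct HF as (_ & _ & HF1 & HF2).
    pose proof (Ck_1_grad _ _ HF1) as G1. pose proof (Ck_1_grad _ _ HF2) as G2.
    split; [ | split]; eexists; eexists; eauto. }
  destruct (K _ H1) as (?&?&?). destruct (K _ H2) as (?&?&?). destruct (K _ H3) as (?&?&?).
  repeat split; assumption.
Qed.

Lemma CkE_2_slices (W : C -> Prop) (k : C -> E3) (z : C) : CkE 2 W k -> W z ->
  is_derive_E3 (fun x : R => k (x, Im z)) (Re z) (D1 k z) /\
  is_derive_E3 (fun y : R => k (Re z, y)) (Im z) (D2 k z) /\
  is_derive_E3 (fun x : R => D2 k (x, Im z)) (Re z) (D1 (D2 k) z) /\
  is_derive_E3 (fun y : R => D1 k (Re z, y)) (Im z) (D2 (D1 k) z).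
Proof.
  intros (H1 & H2 & H3) Hz.
  assert (K : forall F, Ck 2 W F ->
    is_derive (fun x : R => F (x, Im z)) (Re z) (d1 F z) /\
    is_derive (fun y : R => F (Re z, y)) (Im z) (d2 F z) /\
    is_derive (fun x : R => d2 F (x, Im z)) (Re z) (d1 (d2 F) z) /\
    is_derive (fun y : R => d1 F (Re z, y)) (Im z) (d2 (d1 F) z)).
  { intros F HF. pose proof (Ck_1_grad _ _ (Ck_2_1 _ _ HF) z Hz) as G0.
    destruct HF as (_ & _ & HF1 & HF2).
    pose proof (Ck_1_grad _ _ HF1 z Hz) as G1. pose proof (Ck_1_grad _ _ HF2 z Hz) as G2.
    exact (conj (proj1 G0) (conj (proj1 (proj2 G0)) (conj (proj1 G2) (proj1 (proj2 G1))))). }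
  destruct (K _ H1) as (?&?&?&?). destruct (K _ H2) as (?&?&?&?). destruct (K _ H3) as (?&?&?&?).
  refine (conj _ (conj _ (conj _ _))); refine (conj _ (conj _ _)); assumption.
Qed.

Lemma is_derive_E3_comp_curve (W : C -> Prop) (k : C -> E3) (g : R -> C) (t : R) :
  open W -> CkE 2 W k -> W (g t) -> ex_derive (fun s => Re (g s)) t -> ex_derive (fun s => Im (g s)) t ->
  is_derive_E3 (fun s => k (g s)) t (dmap k (g t) (dcurve g t)).
Proof.
  intros HW (H1 & H2 & H3) Hz E1 E2.
  assert (K : forall F, Ck 2 W F -> is_derive (fun s => F (g s)) t (Re (dcurve g t) * d1 F (g t) + Im (dcurve g t) * d2 F (g t))).
  { intros F HF. apply (C1_grad_comp_curve W); auto. apply Ck_1_grad, Ck_2_1, HF.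
    now apply Derive_correct. now apply Derive_correct. }
  split; [exact (K _ H1) | split; [exact (K _ H2) | exact (K _ H3)]].
Qed.

Lemma dmap_linear_potential (X : C -> E3) (a b c : C) (q : E3) (z v : C) :
  killing_potential a b c q (dmap X z v)
  = killing_potential a b c q (D1 X z) * Re v + killing_potential a b c q (D2 X z) * Im v.
Proof.
  unfold killing_potential, dmap, Rdiv. generalize (D1 X z) (D2 X z) (killing (Ci * a) (Ci * b) (Ci * c) q) (/ (2 * cw q ^ 2)).
  intros [[? ?] ?] [[? ?] ?] [[? ?] ?] ?. E3_simpl. ring.
Qed.

(** Green's formula for the pull-back by [k] of the potential of the Killing
    field.  Along the boundary circle [k] and [X o gamma] have the same velocity. *)
Lemma killing_disk_term (X : C -> E3) (gamma : R -> C) (k : C -> E3) (Y : E3 -> E3) (a b c : C) (Om : C -> Prop) :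
  spanning_disk X gamma k -> (forall q, H3 q -> Y q = killing a b c q) ->
  open Om -> CkE 2 Om X -> (forall t, Om (gamma t)) -> C1_curve gamma ->
  disk_term k Y = RInt (fun t => killing_potential a b c (X (gamma t)) (velocity X gamma t)) 0 (2 * PI).
Proof.
  intros [(W0 & HW0 & Hd0 & Hk0) HkH Hbd] HY HOm HX Hg HgC.
  (* [k] takes values in the half-space on the closed disk; by continuity this
     persists on a neighbourhood, where one can divide by [w]. *)
  set (W := fun z => W0 z /\ 0 < cw (k z)).
  assert (HW : open W).
  { intros z [Hz Hw]. destruct Hk0 as (_ & _ & (K & _)).
    assert (Hl : locally z (fun z => 0 < cw (k z))).
    { apply (K z Hz (fun x => 0 < x)). now apply open_gt. }
    apply (filter_and (F := locally z)); auto. }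
  assert (Hd : forall x, Cmod x <= 1 -> W x) by (intros x Hx; split; [now apply Hd0 | now apply HkH]).
  assert (HCk : forall n F, Ck n W0 F -> Ck n W F).
  { induction n as [ | n IH]; intros F HF.
    - destruct HF as [HF _]. split; auto. intros z [Hz _]; auto.
    - destruct HF as (HF & HF' & HF1 & HF2). split; [intros z [Hz _]; auto | ].
      split; [intros z [Hz _]; auto | ]. split; apply IH; assumption. }
  assert (Hk : CkE 2 W k) by (destruct Hk0 as (?&?&?); split; [ | split]; now apply HCk).
  assert (Hw0 : forall z, W z -> cw (k z) <> 0) by (intros z [_ Hz]; lra).
  destruct (CkE_2_C1 W k Hk) as (C0 & C1 & C2).
  destruct (C1_on_killing_potential W k (D1 k) a b c HW C0 C1 Hw0) as (Px & Py & HPg).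
  destruct (C1_on_killing_potential W k (D2 k) a b c HW C0 C2 Hw0) as (Qx & Qy & HQg).
  pose proof (green_unit_disk W _ Px Py _ Qx Qy HW Hd HPg HQg) as HG.
  assert (Hcurl : forall z, W z -> Qx z - Py z = det3 (D1 k z) (D2 k z) (killing a b c (k z)) / cw (k z) ^ 3).
  { intros z Hz. destruct (CkE_2_slices W k z Hk Hz) as (S1 & S2 & S3 & S4).
    destruct (HPg z Hz) as (_ & Gy & _). destruct (HQg z Hz) as (Gx & _).
    assert (ES : D1 (D2 k) z = D2 (D1 k) z).
    { destruct Hk as (Hk1 & Hk2 & Hk3).
      apply E3_ext_R; [exact (Ck_2_schwarz W _ z HW Hk1 Hz) | exact (Ck_2_schwarz W _ z HW Hk2 Hz) | exact (Ck_2_schwarz W _ z HW Hk3 Hz)]. }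
    assert (Ezz : (Re z, Im z) = z) by now destruct z.
    assert (Hq : cw (k (Re z, Im z)) <> 0) by (rewrite Ezz; now apply Hw0).
    pose proof (is_derive_killing_potential a b c _ _ _ _ _ S1 S3 Hq) as E1.
    pose proof (is_derive_killing_potential a b c _ _ _ _ _ S2 S4 Hq) as E2.
    rewrite Ezz in E1 E2.
    rewrite -(is_derive_unique _ _ _ Gx) (is_derive_unique _ _ _ E1).
    rewrite -(is_derive_unique _ _ _ Gy) (is_derive_unique _ _ _ E2).
    rewrite ES. apply dkilling_potential_curl. now apply Hw0. }
  transitivity (disk_RInt (fun z => Qx z - Py z)).
  - unfold disk_term, disk_RInt.
    apply RInt_ext. intros r Hr. rewrite Rmin_left ?Rmax_right in Hr; try lra.
    apply RInt_ext. intros t _.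
    assert (Hm : Cmod (RtoC r * expi t)%C <= 1).
    { rewrite polar_expi. unfold polar, Cmod; simpl.
      rewrite -[X in _ <= X]sqrt_1. apply sqrt_le_1_alt.
      pose proof (sin2_cos2 t) as HH; unfold Rsqr in HH. nra. }
    rewrite Hcurl; [ | now apply Hd]. rewrite area_flux; [ | now apply HkH].
    rewrite HY; [ | now apply HkH]. reflexivity.
  - rewrite -HG. unfold form_integral. apply RInt_ext. intros t _.
    unfold form_at. rewrite -dmap_linear_potential.
    assert (Hm1 : Cmod (expi t) <= 1).
    { unfold expi, Cmod; simpl. right. rewrite -[RHS]sqrt_1. f_equal. pose proof (sin2_cos2 t) as HH; unfold Rsqr in HH. nra. }
    assert (Ev : velocity X gamma t = dmap k (expi t) (dcurve expi t)).
    { apply (is_derive_E3_unique (fun s => X (gamma s)) t).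
      - apply (is_derive_E3_comp_curve Om); auto; apply (HgC t).
      - apply (is_derive_E3_ext (fun s => k (expi s))); [exact Hbd | ].
        apply (is_derive_E3_comp_curve W); auto; simpl; auto_derive; auto. }
    rewrite Ev -Hbd. reflexivity.
Qed.

(** * The surface in terms of its holomorphic representation *)

Lemma is_derive_of_bound (f : R -> R) (x l : R) :
  (forall eps : posreal, locally x (fun u => Rabs (f u - f x - (u - x) * l) <= eps * Rabs (u - x))) ->
  is_derive f x l.
Proof.
  intros Hb. split; [apply is_linear_scal_l | ].
  intros y Hy eps. rewrite -(is_filter_lim_locally_unique _ _ Hy). exact (Hb eps).
Qed.

Lemma holomorphic_remainder (f : C -> C) (z l : C) (eps : posreal) : is_derive f z l ->
  locally z (fun u : C => Cmod (f u - f z - (u - z) * l)%C <= eps * Cmod (u - z)%C).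
Proof.
  intros [_ Hd].
  specialize (Hd z (fun P HP => HP) eps).
  apply locally_C. exact Hd.
Qed.

Lemma Re_le_Cmod (z : C) : Rabs (Re z) <= Cmod z.
Proof. eapply Rle_trans; [apply Rmax_l | apply Rmax_Cmod]. Qed.
Lemma Im_le_Cmod (z : C) : Rabs (Im z) <= Cmod z.
Proof. eapply Rle_trans; [apply Rmax_r | apply Rmax_Cmod]. Qed.

Lemma holomorphic_remainder_slices (f : C -> C) (z l : C) (eps : posreal) : is_derive f z l ->
  locally (Re z) (fun u : R => Cmod (f (u, Im z) - f z - RtoC (u - Re z) * l)%C <= eps * Rabs (u - Re z)) /\
  locally (Im z) (fun u : R => Cmod (f (Re z, u) - f z - RtoC (u - Im z) * (Ci * l))%C <= eps * Rabs (u - Im z)).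
Proof.
  intros Hf. pose proof (holomorphic_remainder f z l eps Hf) as Hr. split.
  - generalize (locally_slice1 _ _ Hr). apply filter_imp. intros u Hu.
    assert (E : RtoC (u - Re z) = ((u, Im z) - z)%C) by C_ring.
    rewrite -Cmod_R E. exact Hu.
  - generalize (locally_slice2 _ _ Hr). apply filter_imp. intros u Hu.
    assert (E : (RtoC (u - Im z) * (Ci * l))%C = (((Re z, u) - z) * l)%C) by C_ring.
    assert (E' : Rabs (u - Im z) = Cmod ((Re z, u) - z)%C).
    { rewrite -Cmod_R. unfold Cmod. f_equal. simpl. unfold Re, Im. ring. }
    rewrite E E'. exact Hu.
Qed.

(** The two real partial derivatives of a holomorphic function are [l] and
    [i l]. *)
Lemma holomorphic_slices (f : C -> C) (z l : C) : is_derive f z l ->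
  is_derive_RC (fun x => f (x, Im z)) (Re z) l /\ is_derive_RC (fun y => f (Re z, y)) (Im z) (Ci * l)%C.
Proof.
  intros Hf.
  assert (Ez : (Re z, Im z) = z) by now destruct z.
  refine (conj (conj _ _) (conj _ _)); apply is_derive_of_bound; intros eps;
    destruct (holomorphic_remainder_slices f z l eps Hf) as [H1 H2]; rewrite Ez;
    [revert H1 | revert H1 | revert H2 | revert H2]; apply filter_imp; intros u Hu;
    (eapply Rle_trans; [ | exact Hu]).
  1,3: eapply Rle_trans; [ | apply Re_le_Cmod]; right; f_equal; simpl; unfold Re, Im; simpl; ring.
  all: eapply Rle_trans; [ | apply Im_le_Cmod]; right; f_equal; simpl; unfold Re, Im; simpl; ring.
Qed.

Lemma is_derive_RC_unique (f : R -> C) (t : R) (l m : C) :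
  is_derive_RC f t l -> is_derive_RC f t m -> l = m.
Proof.
  intros [H1 H2] [K1 K2]. apply C_ext.
  - rewrite -(is_derive_unique _ _ _ H1) -(is_derive_unique _ _ _ K1). reflexivity.
  - rewrite -(is_derive_unique _ _ _ H2) -(is_derive_unique _ _ _ K2). reflexivity.
Qed.

Lemma holomorphic_comp (f g : C -> C) (z : C) : ex_derive g z -> ex_derive f (g z) ->
  is_derive (fun y => f (g y)) z (C_derive f (g z) * C_derive g z)%C.
Proof.
  intros Hg Hf.
  pose proof (C_derive_correct g z (RtoC 0) Hg) as Dg. pose proof (C_derive_correct f (g z) (RtoC 0) Hf) as Df.
  assert (Dg' : is_derive (V := AbsRing_NormedModule C_AbsRing) g z (C_derive g z)).
  { destruct Dg as [_ Dg]. split; [apply is_linear_scal_l | exact Dg]. }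
  pose proof (is_derive_comp (K := C_AbsRing) (V := C_NormedModule) f g z _ _ Df Dg') as HH.
  rewrite Cmult_comm. exact HH.
Qed.

(** Complex multiples of [(A1, B1, C1, D1)] correspond to the real linear action
    of tangent vectors of the plane, so [dX] is known from its values on [1] and
    [i]. *)
Lemma bryant_tangent_linear (A B C0 D A1 B1 C1 D1 v : C) :
  vadd (vscal (Re v) (bryant_tangent A B C0 D A1 B1 C1 D1))
       (vscal (Im v) (bryant_tangent A B C0 D (Ci * A1) (Ci * B1) (Ci * C1) (Ci * D1)))
  = bryant_tangent A B C0 D (v * A1) (v * B1) (v * C1) (v * D1).
Proof.
  apply E3_ext.
  - assert (Hf : forall r V, fst (vscal r V) = (RtoC r * fst V)%C).
    { intros r [[x y] w]. apply C_ext; E3_simpl; ring. }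
    assert (Ha : forall V V', fst (vadd V V') = (fst V + fst V')%C) by (intros [[x y] w] [[x' y'] w']; reflexivity).
    rewrite Ha !Hf. unfold bryant_tangent; cbn [fst].
    assert (Ev : v = (RtoC (Re v) + Ci * RtoC (Im v))%C) by C_ring.
    revert Ev. generalize (Re v) (Im v). intros x y ->.
    rewrite ?(Cplus_conj, Cmult_conj, Cconj_RtoC, Cconj_Ci, Cconj_conj). unfold Cdiv. ring.
  - f_equal. unfold bryant_tangent.
    set (n := (A * Cconj A + B * Cconj B)%C).
    set (S := (A1 * Cconj A + B1 * Cconj B)%C).
    replace (Ci * A1 * Cconj A + Ci * B1 * Cconj B)%C with (Ci * S)%C by (unfold S; ring).
    replace (v * A1 * Cconj A + v * B1 * Cconj B)%C with (v * S)%C by (unfold S; ring).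
    unfold Cdiv. generalize (/ (n * n))%C. intros i0. E3_simpl. ring.
Qed.

(** What the representation gives at a single point of the punctured domain:
    the matrix and its derivative with respect to the coordinate [z] itself.  The
    matrix depends on a choice of branch, but the values of [f0], [f1], [f2] do
    not. *)
Definition local_frame (X : C -> E3) (f0 f1 f2 : C -> C) (z : C) : Prop :=
  exists A B C0 D A' B' C' D' : C,
    (A * D - B * C0 = 1)%C /\ (A' * D + A * D' - B' * C0 - B * C' = 0)%C /\
    X z = bryant_point A B C0 D /\
    (forall v, dmap X z v = bryant_tangent A B C0 D (v * A') (v * B') (v * C') (v * D')) /\
    f0 z = (D * C' - C0 * D')%C /\ f1 z = (C0 * B' - D * A')%C /\ f2 z = (B * A' - A * B')%C.

(** Near [z] the covering has a holomorphic section [s], and [X] is given by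
    the matrix composed with [s].  The factor [C_derive p] relating the forms
    upstairs to their coefficients downstairs is the inverse of the derivative
    of [s]. *)
Lemma bryant_local_frame (V U : C -> Prop) (p : C -> C) (X : C -> E3) (FA FB FC FD f0 f1 f2 : C -> C) :
  holomorphic_covering U V p -> bryant_representation U p X FA FB FC FD -> CkE 2 V X ->
  (forall s, U s -> (f0 (p s) * C_derive p s)%C = wronskian FD FC s) ->
  (forall s, U s -> (f1 (p s) * C_derive p s)%C = (FC s * C_derive FB s - FD s * C_derive FA s)%C) ->
  (forall s, U s -> (f2 (p s) * C_derive p s)%C = wronskian FB FA s) ->
  forall z, V z -> local_frame X f0 f1 f2 z.
Proof.
  intros (HU & Hp & HpV & Hcov) HB HX H0 H1 H2 z Hz.
  destruct (Hcov z Hz) as (N & I & sigma & [i] & HN & HNz & HNV & Hsig & _).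
  destruct (Hsig i) as (Hhol & Hsec & _). set (s := sigma i) in *. clearbody s.
  destruct (Hsec z HNz) as [HUs Hps].
  assert (Ds : ex_derive s z) by now apply Hhol.
  assert (Dp : ex_derive p (s z)) by now apply Hp.
  set (m := C_derive s z).
  assert (DD : forall F, holomorphic_on U F -> is_derive (fun y => F (s y)) z (C_derive F (s z) * m)%C).
  { intros F HF. apply holomorphic_comp; auto. }
  assert (Hloc : locally z N) by now apply HN.
  assert (Ez : (Re z, Im z) = z) by now destruct z.
  assert (Epm : (C_derive p (s z) * m = 1)%C).
  { destruct (holomorphic_slices _ _ _ (DD p Hp)) as [S1 _].
    apply (is_derive_RC_unique _ _ _ _ S1).
    assert (S2 : is_derive_RC (fun x => (x, Im z) : C) (Re z) (RtoC 1)).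
    { split; simpl; [apply: is_derive_id | apply: is_derive_const]. }
    destruct S2 as [S2 S3].
    split.
    - eapply (is_derive_ext_loc (V := R_NormedModule) (fun x : R => Re (x, Im z))); [ | exact S2].
      generalize (locally_slice1 _ _ Hloc). apply filter_imp. intros x Hx. now rewrite (proj2 (Hsec _ Hx)).
    - eapply (is_derive_ext_loc (V := R_NormedModule) (fun x : R => Im (x, Im z))); [ | exact S3].
      generalize (locally_slice1 _ _ Hloc). apply filter_imp. intros x Hx. now rewrite (proj2 (Hsec _ Hx)). }
  destruct (holomorphic_slices _ _ _ (DD FA (br_holA _ _ _ _ _ _ _ HB))) as [A1 A2].
  destruct (holomorphic_slices _ _ _ (DD FB (br_holB _ _ _ _ _ _ _ HB))) as [B1 B2].
  destruct (holomorphic_slices _ _ _ (DD FC (br_holC _ _ _ _ _ _ _ HB))) as [C1 C2].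
  destruct (holomorphic_slices _ _ _ (DD FD (br_holD _ _ _ _ _ _ _ HB))) as [D1' D2'].
  set (A' := (C_derive FA (s z) * m)%C) in *. set (B' := (C_derive FB (s z) * m)%C) in *.
  set (C' := (C_derive FC (s z) * m)%C) in *. set (D' := (C_derive FD (s z) * m)%C) in *.
  assert (det : (FA (s z) * FD (s z) - FB (s z) * FC (s z) = 1)%C) by (apply (br_det _ _ _ _ _ _ _ HB); auto).
  assert (Edet : (FA (s (Re z, Im z)) * FD (s (Re z, Im z)) - FB (s (Re z, Im z)) * FC (s (Re z, Im z)) = 1)%C) by now rewrite Ez.
  assert (EX : forall y, N y -> X y = bryant_point (FA (s y)) (FB (s y)) (FC (s y)) (FD (s y))).
  { intros y Hy. destruct (Hsec y Hy) as [Hu He]. rewrite -{1}He. apply (br_X _ _ _ _ _ _ _ HB); auto. }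
  exists (FA (s z)), (FB (s z)), (FC (s z)), (FD (s z)), A', B', C', D'.
  assert (ED1 : D1 X z = bryant_tangent (FA (s z)) (FB (s z)) (FC (s z)) (FD (s z)) A' B' C' D').
  { destruct (CkE_2_slices V X z HX Hz) as (S1 & _).
    apply (is_derive_E3_unique _ _ _ _ S1).
    pose proof (is_derive_bryant_point _ _ _ _ _ _ _ _ _ Edet A1 B1 C1 D1') as (T1 & T2 & T3).
    rewrite Ez in T1, T2, T3.
    pose proof (locally_slice1 _ _ Hloc) as Hl1.
    refine (conj _ (conj _ _)).
    - eapply (is_derive_ext_loc (V := R_NormedModule) _ (fun x : R => cu (X (x, Im z)))); [ | exact T1].
      revert Hl1. apply filter_imp. intros x Hx. now rewrite EX.
    - eapply (is_derive_ext_loc (V := R_NormedModule) _ (fun x : R => cv (X (x, Im z)))); [ | exact T2].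
      revert Hl1. apply filter_imp. intros x Hx. now rewrite EX.
    - eapply (is_derive_ext_loc (V := R_NormedModule) _ (fun x : R => cw (X (x, Im z)))); [ | exact T3].
      revert Hl1. apply filter_imp. intros x Hx. now rewrite EX. }
  assert (ED2 : D2 X z = bryant_tangent (FA (s z)) (FB (s z)) (FC (s z)) (FD (s z)) (Ci * A') (Ci * B') (Ci * C') (Ci * D')).
  { destruct (CkE_2_slices V X z HX Hz) as (_ & S1 & _).
    apply (is_derive_E3_unique _ _ _ _ S1).
    pose proof (is_derive_bryant_point _ _ _ _ _ _ _ _ _ Edet A2 B2 C2 D2') as (T1 & T2 & T3).
    rewrite Ez in T1, T2, T3.
    pose proof (locally_slice2 _ _ Hloc) as Hl1.
    refine (conj _ (conj _ _)).
    - eapply (is_derive_ext_loc (V := R_NormedModule) _ (fun x : R => cu (X (Re z, x)))); [ | exact T1].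
      revert Hl1. apply filter_imp. intros x Hx. now rewrite EX.
    - eapply (is_derive_ext_loc (V := R_NormedModule) _ (fun x : R => cv (X (Re z, x)))); [ | exact T2].
      revert Hl1. apply filter_imp. intros x Hx. now rewrite EX.
    - eapply (is_derive_ext_loc (V := R_NormedModule) _ (fun x : R => cw (X (Re z, x)))); [ | exact T3].
      revert Hl1. apply filter_imp. intros x Hx. now rewrite EX. }
  refine (conj det (conj _ (conj (EX z HNz) (conj _ _)))).
  (* The second relation of the frame is the derivative of the determinant. *)
  - assert (S1 : is_derive_RC (fun x => (FA (s (x, Im z)) * FD (s (x, Im z)) + (- (1)) * (FB (s (x, Im z)) * FC (s (x, Im z))))%C) (Re z)
      (A' * FD (s z) + FA (s z) * D' + (0 * (FB (s z) * FC (s z)) + - (1) * (B' * FC (s z) + FB (s z) * C')))%C).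
    { pose proof (is_derive_RC_plus _ _ _ _ _ (is_derive_RC_mult _ _ _ _ _ A1 D1')
         (is_derive_RC_mult _ _ _ _ _ (is_derive_RC_const (- (1))%C (Re z)) (is_derive_RC_mult _ _ _ _ _ B1 C1))) as HH.
      rewrite Ez in HH. exact HH. }
    transitivity (A' * FD (s z) + FA (s z) * D' + (0 * (FB (s z) * FC (s z)) + - (1) * (B' * FC (s z) + FB (s z) * C')))%C; [ring | ].
    apply (is_derive_RC_unique _ _ _ _ S1).
    assert (Hl : locally (Re z) (fun x => (RtoC 1) = (FA (s (x, Im z)) * FD (s (x, Im z)) + (- (1)) * (FB (s (x, Im z)) * FC (s (x, Im z))))%C)).
    { generalize (locally_slice1 _ _ Hloc). apply filter_imp. intros x Hx.
      transitivity (FA (s (x, Im z)) * FD (s (x, Im z)) - FB (s (x, Im z)) * FC (s (x, Im z)))%C; [ | ring].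
      symmetry. apply (br_det _ _ _ _ _ _ _ HB). apply (Hsec _ Hx). }
    split; simpl.
    + eapply (is_derive_ext_loc (V := R_NormedModule) (fun x : R => Re (RtoC 1))); [ | apply: is_derive_const].
      revert Hl. apply filter_imp. intros x ->. reflexivity.
    + eapply (is_derive_ext_loc (V := R_NormedModule) (fun x : R => Im (RtoC 1))); [ | apply: is_derive_const].
      revert Hl. apply filter_imp. intros x ->. reflexivity.
  - intros v. unfold dmap. rewrite ED1 ED2. apply bryant_tangent_linear.
  - assert (Hf : forall f, (f z = f (p (s z)) * C_derive p (s z) * m)%C).
    { intros f. rewrite -Cmult_assoc Epm Hps. ring. }
    split; [ | split].
    + rewrite Hf H0; auto. unfold wronskian, C', D'. ring.
    + rewrite Hf H1; auto. unfold A', B'. ring.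
    + rewrite Hf H2; auto. unfold wronskian, A', B'. ring.
Qed.

(** * Winding numbers *)

Definition nonzero (z : C) : Prop := z <> RtoC 0.

(** [arg_x dx + arg_y dy] is the differential of the argument. *)
Definition arg_x (z : C) : R := - Im z / (Re z ^ 2 + Im z ^ 2).
Definition arg_y (z : C) : R := Re z / (Re z ^ 2 + Im z ^ 2).

Lemma nonzero_norm2 (z : C) : nonzero z <-> 0 < Re z ^ 2 + Im z ^ 2.
Proof.
  split.
  - intros Hz. destruct (Req_dec (Re z) 0) as [E | E]; [destruct (Req_dec (Im z) 0) as [E' | E'] | ].
    + exfalso. apply Hz. now apply C_ext.
    + nra.
    + nra.
  - intros H E. rewrite E in H. simpl in H. lra.
Qed.

Lemma continuous_norm2 (z : C) : continuous (fun z : C => Re z ^ 2 + Im z ^ 2) z.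
Proof.
  apply continuous_ext with (f := fun z : C => Re z * Re z + Im z * Im z).
  intros; simpl; ring.
  apply: continuous_plus; apply: continuous_mult; first [apply: continuous_fst | apply: continuous_snd].
Qed.

Lemma open_nonzero : open nonzero.
Proof.
  intros z Hz. apply nonzero_norm2 in Hz.
  generalize (continuous_norm2 z (fun x => 0 < x) (open_gt 0 _ Hz)). unfold filtermap. apply filter_imp. intros y Hy. now apply nonzero_norm2.
Qed.

Lemma C1_grad_Re (W : C -> Prop) : C1_grad W (fun z => Re z) (fun _ => 1) (fun _ => 0).
Proof.
  intros z _. refine (conj _ (conj _ (conj _ _))); try apply continuous_const; simpl.
  apply: is_derive_id. apply: is_derive_const.
Qed.
Lemma C1_grad_Im (W : C -> Prop) : C1_grad W (fun z => Im z) (fun _ => 0) (fun _ => 1).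
Proof.
  intros z _. refine (conj _ (conj _ (conj _ _))); try apply continuous_const; simpl.
  apply: is_derive_const. apply: is_derive_id.
Qed.

Lemma closed_arg_form : closed_form nonzero arg_x arg_y.
Proof.
  assert (Hn := C1_grad_plus _ _ _ _ _ _ _
     (C1_grad_mult nonzero _ _ _ _ _ _ open_nonzero (C1_grad_Re _) (C1_grad_Re _))
     (C1_grad_mult nonzero _ _ _ _ _ _ open_nonzero (C1_grad_Im _) (C1_grad_Im _))).
  assert (Hi := C1_grad_inv _ _ _ _ open_nonzero Hn). cbv beta in Hi.
  assert (H0 : forall z, nonzero z -> Re z * Re z + Im z * Im z <> 0).
  { intros z Hz. apply nonzero_norm2 in Hz. simpl in Hz. lra. }
  specialize (Hi H0).
  exists (fun z => 2 * Re z * Im z / (Re z ^ 2 + Im z ^ 2) ^ 2), (fun z => (Im z ^ 2 - Re z ^ 2) / (Re z ^ 2 + Im z ^ 2) ^ 2),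
    (fun z => - (2 * Re z * Im z) / (Re z ^ 2 + Im z ^ 2) ^ 2).
  split.
  - apply (C1_grad_ext _ _ _ _ _ _ _ open_nonzero (C1_grad_mult _ _ _ _ _ _ _ open_nonzero (C1_grad_scal _ (-1) _ _ _ (C1_grad_Im _)) Hi));
     intros z Hz; apply nonzero_norm2 in Hz; unfold arg_x; field; repeat split; apply Rgt_not_eq; nra.
  - apply (C1_grad_ext _ _ _ _ _ _ _ open_nonzero (C1_grad_mult _ _ _ _ _ _ _ open_nonzero (C1_grad_Re _) Hi));
     intros z Hz; apply nonzero_norm2 in Hz; unfold arg_y; field; repeat split; apply Rgt_not_eq; nra.
Qed.

Lemma continuous_arg (z : C) : nonzero z -> continuous arg_x z /\ continuous arg_y z.
Proof.
  destruct closed_arg_form as (Px & M & Qy & HP & HQ). intros Hz.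
  split; eapply (C1_grad_continuous nonzero); eauto; apply open_nonzero.
Qed.

Definition slit (z : C) : Prop := 0 < sqrt (Re z ^ 2 + Im z ^ 2) + Re z.

Lemma open_slit : open slit.
Proof.
  intros z Hz.
  assert (K : continuous (fun z : C => sqrt (Re z ^ 2 + Im z ^ 2) + Re z) z).
  { apply: continuous_plus; [ | apply: continuous_fst].
    apply (continuous_comp (fun z : C => Re z ^ 2 + Im z ^ 2) sqrt).
    apply continuous_norm2. apply continuous_sqrt. }
  exact (K (fun x => 0 < x) (open_gt 0 _ Hz)).
Qed.

Lemma slit_nonzero (z : C) : slit z -> nonzero z.
Proof.
  unfold slit. intros H E. rewrite E in H. simpl in H. replace (0 * (0 * 1) + 0 * (0 * 1)) with 0 in H by ring.
  rewrite sqrt_0 in H. lra.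
Qed.

Lemma slit_of_pos (z : C) : 0 < Re z -> slit z.
Proof. intros H. unfold slit. pose proof (sqrt_pos (Re z ^ 2 + Im z ^ 2)). lra. Qed.

Lemma slit_of_Im (z : C) : Im z <> 0 -> slit z.
Proof.
  intros H. unfold slit.
  assert (sqrt (Re z ^ 2) < sqrt (Re z ^ 2 + Im z ^ 2)).
  { apply sqrt_lt_1_alt. split; [apply pow2_ge_0 | ]. assert (0 < Im z ^ 2); [ | lra]. simpl. rewrite Rmult_1_r. nra. }
  rewrite -Rsqr_pow2 sqrt_Rsqr_abs in H0. rewrite Rsqr_pow2 in H0. pose proof (Rle_abs (- Re z)). rewrite Rabs_Ropp in H1. lra.
Qed.

Lemma principal_arg_partials (x y s : R) :
  s = sqrt (x ^ 2 + y ^ 2) -> 0 < x ^ 2 + y ^ 2 -> 0 < s + x ->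
  is_derive (fun x => 2 * atan (y / (sqrt (x ^ 2 + y ^ 2) + x))) x (- y / (x ^ 2 + y ^ 2)) /\
  is_derive (fun y => 2 * atan (y / (sqrt (x ^ 2 + y ^ 2) + x))) y (x / (x ^ 2 + y ^ 2)).
Proof.
  intros Es Hn Hx.
  assert (Hs : 0 < s) by (rewrite Es; now apply sqrt_lt_R0).
  assert (Hss : s ^ 2 = x ^ 2 + y ^ 2) by (rewrite Es; apply pow2_sqrt; lra).
  assert (Hd : (s + x) ^ 2 + y ^ 2 = 2 * s * (s + x)) by nra.
  split; auto_derive; change (x * (x * 1)) with (x ^ 2); change (y * (y * 1)) with (y ^ 2); rewrite -?Es.
  - repeat split; auto; lra.
  - rewrite -Hss.
    transitivity (2 * (- (y * (x / s + 1))) / ((s + x) ^ 2 + y ^ 2)).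
    + field. repeat split; try apply Rgt_not_eq; nra.
    + rewrite Hd. field. lra.
  - repeat split; auto; lra.
  - rewrite -Hss.
    transitivity (2 * (s + x - y ^ 2 / s) / ((s + x) ^ 2 + y ^ 2)).
    + field. repeat split; try apply Rgt_not_eq; nra.
    + rewrite Hd. replace (y ^ 2) with (s ^ 2 - x ^ 2) by lra. field. lra.
Qed.

(** The half-angle formula gives one expression of the argument on the whole
    plane slit along the negative axis. *)
Definition principal_arg (z : C) : R := 2 * atan (Im z / (sqrt (Re z ^ 2 + Im z ^ 2) + Re z)).

Lemma principal_arg_grad : C1_grad slit principal_arg arg_x arg_y.
Proof.
  intros z Hz. pose proof (slit_nonzero z Hz) as Hz0.
  destruct (continuous_arg z Hz0) as [K1 K2].
  destruct (principal_arg_partials (Re z) (Im z) _ eq_refl (proj1 (nonzero_norm2 z) Hz0) Hz).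
  refine (conj _ (conj _ (conj K1 K2))); assumption.
Qed.

Lemma principal_arg_pos (z : C) : slit z -> 0 < Im z -> 0 < principal_arg z.
Proof.
  intros Hz Hi. unfold principal_arg. assert (0 < Im z / (sqrt (Re z ^ 2 + Im z ^ 2) + Re z)) by now apply Rdiv_lt_0_compat.
  apply atan_increasing in H. rewrite atan_0 in H. lra.
Qed.

Lemma principal_arg_neg (z : C) : slit z -> Im z < 0 -> principal_arg z < 0.
Proof.
  intros Hz Hi. unfold principal_arg. assert (0 < - Im z / (sqrt (Re z ^ 2 + Im z ^ 2) + Re z)) by (apply Rdiv_lt_0_compat; auto; lra).
  apply atan_increasing in H. rewrite atan_0 in H. unfold Rdiv in H. rewrite Ropp_mult_distr_l_reverse atan_opp in H. unfold Rdiv. lra.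
Qed.

Definition left_half (z : C) : Prop := Re z < 0.

Lemma open_left_half : open left_half.
Proof.
  intros z Hz. assert (K : continuous (fun z : C => Re z) z) by apply: continuous_fst.
  exact (K (fun x => x < 0) (open_lt 0 _ Hz)).
Qed.

(** The argument up to the constant [PI], which does not affect increments. *)
Definition left_arg (z : C) : R := atan (Im z / Re z).

Lemma left_arg_grad : C1_grad left_half left_arg arg_x arg_y.
Proof.
  intros [x y] Hz. unfold left_half in Hz; simpl in Hz.
  destruct (continuous_arg (x, y)) as [K1 K2].
  { intros E. injection E. lra. }
  refine (conj _ (conj _ (conj K1 K2))); unfold left_arg, arg_x, arg_y; simpl Re; simpl Im;
    (auto_derive; [repeat split; lra | simpl; field; repeat split; first [lra | apply Rgt_not_eq; nra]]).
Qed.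

(** The total variation of the argument, that is, [2 PI] times the winding
    number. *)
Definition winding (g : R -> C) (z : C) : R := form_integral arg_x arg_y (fun t => (g t - z)%C) 0 (2 * PI).

Lemma is_derive_minus_const (f : R -> R) (a t : R) : ex_derive f t ->
  is_derive (fun s => f s + - a) t (Derive f t).
Proof.
  intros Hf. rewrite -[Derive f t]Rplus_0_r.
  apply: is_derive_plus; [now apply Derive_correct | apply: is_derive_const].
Qed.

Lemma dcurve_translate (g : R -> C) (z : C) (t : R) : C1_curve g -> dcurve (fun t => (g t - z)%C) t = dcurve g t.
Proof.
  intros Hg. destruct (Hg t) as [[E1 E2] _]. unfold dcurve. f_equal; apply is_derive_unique.
  - apply (is_derive_minus_const (fun s => Re (g s)) (Re z) t E1).
  - apply (is_derive_minus_const (fun s => Im (g s)) (Im z) t E2).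
Qed.

Lemma C1_curve_translate (g : R -> C) (z : C) : C1_curve g -> C1_curve (fun t => (g t - z)%C).
Proof.
  intros Hg t. destruct (Hg t) as [[E1 E2] K]. split; [split | ].
  - eexists. apply (is_derive_minus_const (fun s => Re (g s)) (Re z) t E1).
  - eexists. apply (is_derive_minus_const (fun s => Im (g s)) (Im z) t E2).
  - apply continuous_ext with (f := dcurve g); auto. intros s. symmetry. now apply dcurve_translate.
Qed.

Lemma continuous_Cminus_fun {T : UniformSpace} (f g : T -> C) (x : T) :
  continuous f x -> continuous g x -> continuous (fun y => (f y - g y)%C) x.
Proof. intros Hf Hg. apply (continuous_minus (V := C_R_NormedModule) f g x Hf Hg). Qed.

(** Moving the point is the same as translating the loop, and the translated
    loops avoid the origin. *)
Lemma winding_path (g : R -> C) (c : R -> C) :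
  C1_curve g -> g 0 = g (2 * PI) -> (forall s, continuous c s) ->
  (forall s t, 0 <= s <= 1 -> 0 <= t <= 2 * PI -> c s <> g t) ->
  winding g (c 0) = winding g (c 1).
Proof.
  intros Hg Hper Hc Hav. pose proof PI_RGT_0.
  apply (homotopy_invariance nonzero _ _ (fun x => (g (snd x) - c (fst x))%C)).
  - apply open_nonzero.
  - apply closed_arg_form.
  - lra.
  - intros x. apply continuous_Cminus_fun.
    + apply (continuous_comp snd g). apply: continuous_snd. now apply C1_curve_continuous.
    + apply (continuous_comp fst c). apply: continuous_fst. apply Hc.
  - intros s t Hs Ht E. simpl in E. apply (Hav s t Hs Ht). symmetry.
    replace (g t) with ((g t - c s) + c s)%C by ring. rewrite E. ring.
  - intros s Hs. simpl. now rewrite Hper.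
  - intros t Ht. now split.
  - now apply C1_curve_translate.
  - now apply C1_curve_translate.
Qed.

Lemma is_derive_shift (f : R -> R) (tau s : R) : ex_derive f (s + tau) ->
  is_derive (fun t => f (t + tau)) s (Derive f (s + tau)).
Proof.
  intros Hf. rewrite -[Derive f (s + tau)]Rmult_1_l.
  apply (is_derive_comp f (fun t => t + tau)); [now apply Derive_correct | auto_derive; auto; ring].
Qed.

Lemma dcurve_shift (g : R -> C) (tau s : R) : C1_curve g ->
  dcurve (fun t => g (t + tau)) s = dcurve g (s + tau).
Proof.
  intros Hg. destruct (Hg (s + tau)) as [[F1 F2] _]. unfold dcurve. f_equal; apply is_derive_unique.
  - apply (is_derive_shift (fun u => Re (g u)) tau s F1).
  - apply (is_derive_shift (fun u => Im (g u)) tau s F2).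
Qed.

Lemma C1_curve_shift (g : R -> C) (tau : R) : C1_curve g -> C1_curve (fun t => g (t + tau)).
Proof.
  intros Hg t. destruct (Hg (t + tau)) as [[E1 E2] K]. split; [split | ].
  - eexists. apply (is_derive_shift (fun u => Re (g u)) tau t E1).
  - eexists. apply (is_derive_shift (fun u => Im (g u)) tau t E2).
  - apply continuous_ext with (f := fun s => dcurve g (s + tau)).
    + intros s. symmetry. now apply dcurve_shift.
    + apply (continuous_comp (fun s => s + tau) (dcurve g)); auto.
      apply: continuous_plus; [apply continuous_id | apply continuous_const].
Qed.

(** Moving the base point of a loop is a homotopy of closed loops. *)
Lemma winding_shift (g : R -> C) (tau : R) (z : C) :
  C1_curve g -> (forall t, g (t + 2 * PI) = g t) -> (forall t, g t <> z) ->
  winding g z = winding (fun t => g (t + tau)) z.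
Proof.
  intros Hg Hper Hav. pose proof PI_RGT_0.
  pose proof (C1_curve_shift g tau Hg) as Hg'.
  apply (homotopy_invariance nonzero _ _ (fun x => (g (snd x + fst x * tau)%R - z)%C)).
  - apply open_nonzero.
  - apply closed_arg_form.
  - lra.
  - intros x. apply continuous_Cminus_fun; [ | apply continuous_const].
    apply (continuous_comp (fun x : R * R => snd x + fst x * tau) g).
    + apply: continuous_plus; [apply: continuous_snd | apply: continuous_mult; [apply: continuous_fst | apply continuous_const]].
    + now apply C1_curve_continuous.
  - intros s t Hs Ht E. simpl in E. apply (Hav (t + s * tau)).
    replace (g (t + s * tau)%R) with ((g (t + s * tau)%R - z) + z)%C by ring. rewrite E. ring.
  - intros s Hs. simpl. rewrite -(Hper (0 + s * tau)). do 2 f_equal. ring.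
  - intros t Ht. simpl. split; do 2 f_equal; ring.
  - now apply C1_curve_translate.
  - now apply C1_curve_translate.
Qed.

(** On an arc away from [z0] the variation of the argument depends
    continuously on the point it is seen from. *)
Lemma translated_integral_continuous (g : R -> C) (z0 : C) (a b : R) :
  C1_curve g -> a <= b -> (forall t, a <= t <= b -> g t <> z0) ->
  continuous (fun e : R => form_integral arg_x arg_y (fun t => (g t - (z0 + RtoC e))%C) a b) 0.
Proof.
  intros Hg Hab Hav.
  set (h := fun x : R * R => (g (snd x) - (z0 + RtoC (fst x)))%C).
  assert (Hh : forall x, continuous h x).
  { intros x. apply continuous_Cminus_fun.
    - apply (continuous_comp snd g). apply: continuous_snd. now apply C1_curve_continuous.
    - apply (continuous_plus (V := C_R_NormedModule) (fun _ : R * R => z0) (fun x : R * R => RtoC (fst x))).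
      apply continuous_const. apply (continuous_comp fst RtoC). apply: continuous_fst.
      apply continuous_Cpair. apply continuous_id. apply continuous_const. }
  destruct (lebesgue_squares nonzero h 0 0 a b open_nonzero Hh) as [d Hd].
  { intros s t Hs Ht E. apply (Hav t Ht). replace s with 0 in E by lra. unfold h in E; simpl in E.
    replace (g t) with (g t - (z0 + 0) + z0)%C by ring. rewrite E. ring. }
  assert (Hnz : forall e t, Rabs e < d -> a <= t <= b -> nonzero (h (e, t))).
  { intros e t He Ht. destruct (Hd 0 t ltac:(lra) Ht) as (z & r & Hr & Hsq). apply Hr, Hsq.
    now rewrite Rminus_0_r. rewrite Rminus_diag Rabs_R0. apply cond_pos. }
  assert (Kf : forall x, nonzero (h x) -> continuous (fun x : C => form_at arg_x arg_y (h x) (dcurve g (snd x))) x).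
  { intros x Hx. destruct (continuous_arg _ Hx) as [K1 K2].
    assert (Kd : continuous (fun x : C => dcurve g (snd x)) x).
    { apply (continuous_comp (fun x : C => snd x) (dcurve g)). apply: continuous_snd. apply Hg. }
    apply: continuous_plus; apply: continuous_mult.
    - apply (continuous_comp h arg_x); auto.
    - apply (continuous_comp (fun x : C => dcurve g (snd x)) (fun z : C => Re z)); auto. apply: continuous_fst.
    - apply (continuous_comp h arg_y); auto.
    - apply (continuous_comp (fun x : C => dcurve g (snd x)) (fun z : C => Im z)); auto. apply: continuous_snd. }
  apply continuous_ext with (f := fun e : R => RInt (fun t => form_at arg_x arg_y (h (e, t)) (dcurve g t)) a b).
  { intros e. unfold form_integral. apply RInt_ext. intros t _. now rewrite dcurve_translate. }
  apply (continuous_RInt_param (fun e t => form_at arg_x arg_y (h (e, t)) (dcurve g t))); auto.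
  - intros t Ht. apply (continuous_2d_pt_of_continuous (fun x : C => form_at arg_x arg_y (h x) (dcurve g (snd x)))).
    apply Kf. apply Hnz; auto. rewrite Rabs_R0. apply cond_pos.
  - exists d. intros e He. apply (ex_RInt_continuous (V := R_CompleteNormedModule)).
    rewrite Rmin_left ?Rmax_right; auto. intros t Ht.
    apply (continuous_slice2 (fun x : C => form_at arg_x arg_y (h x) (dcurve g (snd x))) (e, t)).
    apply Kf. apply Hnz; auto.
    unfold ball in He; simpl in He. unfold AbsRing_ball, abs, minus, plus, opp in He; simpl in He.
    now rewrite Ropp_0 Rplus_0_r in He.
Qed.

(** Seen from a point to its right, the loop stays in a half-plane on which the
    argument is single-valued. *)
Lemma winding_right_of_max (g : R -> C) (e : R) :
  C1_curve g -> g 0 = g (2 * PI) -> 0 < e ->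
  (forall t, 0 <= t <= 2 * PI -> Re (g t) <= Re (g PI)) ->
  winding g (g PI + RtoC e)%C = 0.
Proof.
  intros Hg Hper He Hmax. pose proof PI_RGT_0. unfold winding.
  rewrite (form_integral_primitive left_half left_arg).
  - rewrite Hper. ring.
  - apply open_left_half.
  - apply left_arg_grad.
  - now apply C1_curve_translate.
  - rewrite Rmin_left ?Rmax_right; try lra. intros t Ht. specialize (Hmax t Ht). unfold left_half; simpl.
    unfold Re in *. lra.
Qed.

Lemma strictly_decreasing_near (f : R -> R) (a b c : R) :
  a < c < b -> (forall t, a <= t <= b -> ex_derive f t /\ Derive f t < 0) ->
  (forall t, a <= t < c -> f c < f t) /\ (forall t, c < t <= b -> f t < f c).
Proof.
  intros Hc Hf.
  assert (K : forall s t, a <= s -> s < t -> t <= b -> f t < f s).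
  { intros s t Hs Hst Ht.
    destruct (MVT_gen f s t (Derive f)) as (x & Hx & E).
    - intros x Hx. rewrite Rmin_left ?Rmax_right in Hx; try lra. apply Derive_correct. apply Hf; lra.
    - intros x Hx. rewrite Rmin_left ?Rmax_right in Hx; try lra. apply continuity_pt_filterlim. apply: ex_derive_continuous. apply Hf; lra.
    - rewrite Rmin_left ?Rmax_right in Hx; try lra. assert (Derive f x < 0) by (apply Hf; lra). nra. }
  split; intros t Ht; apply K; lra.
Qed.

Lemma form_integral_Chasles (W : C -> Prop) (P Q : C -> R) (g : R -> C) (a b c : R) :
  (forall z, W z -> continuous P z /\ continuous Q z) -> C1_curve g -> a <= b <= c ->
  (forall t, a <= t <= c -> W (g t)) ->
  form_integral P Q g a c = form_integral P Q g a b + form_integral P Q g b c.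
Proof.
  intros HPQ Hg Habc Hin. symmetry. apply (RInt_Chasles (V := R_CompleteNormedModule)).
  - apply (ex_RInt_form W); auto. rewrite Rmin_left ?Rmax_right; try lra. intros; apply Hin; lra.
  - apply (ex_RInt_form W); auto. rewrite Rmin_left ?Rmax_right; try lra. intros; apply Hin; lra.
Qed.

(** Split the loop into a short downward arc around the rightmost point and the
    remaining arc.  Seen from [g PI + e] the total variation is [0] and the short
    arc, which passes to the left, contributes positively; so the remaining arc
    contributes negatively.  Seen from [g PI - e] the short arc passes to the
    right and contributes negatively, while the contribution of the remaining arc
    has changed little.  The total is therefore less than a full turn. *)
Lemma winding_left_of_max (g : R -> C) :
  C1_curve g -> g 0 = g (2 * PI) ->
  (forall t, 0 <= t <= 2 * PI -> Re (g t) <= Re (g PI)) ->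
  (forall t, 0 <= t <= 2 * PI -> g t = g PI -> t = PI) ->
  Im (dcurve g PI) < 0 ->
  exists e0, 0 < e0 /\ forall e, 0 < e < e0 ->
    (forall t, g t <> g PI - RtoC e)%C -> winding g (g PI - RtoC e)%C < 2 * PI.
Proof.
  intros Hg Hper Hmax Hinj Hdown. pose proof PI_RGT_0 as HPI. pose proof PI2_3_2 as HPI3.
  (* An arc along which the imaginary part decreases, so that it crosses the
     horizontal line through [g PI] only once. *)
  assert (Hnear : exists d, 0 < d < PI /\ forall t, PI - d <= t <= PI + d -> Im (dcurve g t) < 0).
  { assert (K : continuous (fun t => Im (dcurve g t)) PI) by (apply continuous_Im; apply Hg).
    destruct (K (fun x => x < 0) (open_lt 0 _ Hdown)) as [d Hd].
    exists (Rmin (d / 2) 1). pose proof (cond_pos d). pose proof (Rmin_l (d / 2) 1). pose proof (Rmin_r (d / 2) 1).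
    assert (0 < Rmin (d / 2) 1) by (apply Rmin_pos; lra).
    split; [lra | ]. intros t Ht. apply Hd. unfold ball; simpl; unfold AbsRing_ball, abs, minus, plus, opp; simpl.
    apply Rabs_lt_between. lra. }
  destruct Hnear as (d & Hd & Hneg).
  destruct (strictly_decreasing_near (fun t => Im (g t)) (PI - d) (PI + d) PI) as [Hbefore Hafter]; [lra | | ].
  { intros t Ht. split; [apply Hg | exact (Hneg t Ht)]. }
  pose proof (translated_integral_continuous g (g PI) 0 (PI - d) Hg ltac:(lra)) as KL.
  pose proof (translated_integral_continuous g (g PI) (PI + d) (2 * PI) Hg ltac:(lra)) as KR.
  specialize (KL ltac:(intros t Ht E; apply Hinj in E; lra)).
  specialize (KR ltac:(intros t Ht E; apply Hinj in E; lra)).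
  (* The remaining arc is split in two because the parameter interval is cut at
     the middle; [FN] is the contribution of the short arc. *)
  set (FL := fun e : R => form_integral arg_x arg_y (fun t => (g t - (g PI + RtoC e))%C) 0 (PI - d)) in *.
  set (FR := fun e : R => form_integral arg_x arg_y (fun t => (g t - (g PI + RtoC e))%C) (PI + d) (2 * PI)) in *.
  set (FN := fun e : R => form_integral arg_x arg_y (fun t => (g t - (g PI + RtoC e))%C) (PI - d) (PI + d)).
  destruct (KL _ (locally_ball (FL 0) (mkposreal 1 Rlt_0_1))) as [eL HL].
  destruct (KR _ (locally_ball (FR 0) (mkposreal 1 Rlt_0_1))) as [eR HR].
  assert (Hball : forall (F : R -> R) (e0 e : R) ,
    (forall y : R_UniformSpace, ball 0 e0 y -> ball (F 0) 1 (F y)) -> 0 < e < e0 -> Rabs (F e - F (- e)) < 2).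
  { intros F e0 e HF He.
    assert (B1 : Rabs (F e - F 0) < 1).
    { apply (HF e). unfold ball; simpl; unfold AbsRing_ball, abs, minus, plus, opp; simpl. rewrite Ropp_0 Rplus_0_r Rabs_pos_eq; lra. }
    assert (B2 : Rabs (F (- e) - F 0) < 1).
    { apply (HF (- e)). unfold ball; simpl; unfold AbsRing_ball, abs, minus, plus, opp; simpl. rewrite Ropp_0 Rplus_0_r Rabs_Ropp Rabs_pos_eq; lra. }
    apply Rabs_lt_between in B1. apply Rabs_lt_between in B2. apply Rabs_lt_between. lra. }
  exists (Rmin eL eR). split; [apply Rmin_pos; apply cond_pos | ].
  intros e He Hav.
  assert (HeL : 0 < e < eL) by (split; [lra | eapply Rlt_le_trans; [apply He | apply Rmin_l]]).
  assert (HeR : 0 < e < eR) by (split; [lra | eapply Rlt_le_trans; [apply He | apply Rmin_r]]).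
  pose proof (Hball FL eL e HL HeL) as BL. pose proof (Hball FR eR e HR HeR) as BR.
  assert (Htr : forall z, C1_curve (fun t => (g t - z)%C)) by (intros; now apply C1_curve_translate).
  assert (Hsplit : forall e', (forall t, 0 <= t <= 2 * PI -> nonzero (g t - (g PI + RtoC e'))%C) ->
     winding g (g PI + RtoC e')%C = FL e' + (FN e' + FR e')).
  { intros e' Hnz. unfold winding, FL, FN, FR.
    rewrite (form_integral_Chasles nonzero _ _ _ 0 (PI - d) (2 * PI) continuous_arg (Htr _) ltac:(lra)); auto.
    rewrite (form_integral_Chasles nonzero _ _ _ (PI - d) (PI + d) (2 * PI) continuous_arg (Htr _) ltac:(lra)); auto.
    intros t Ht; apply Hnz; lra. }
  assert (Hout : winding g (g PI + RtoC e)%C = 0) by (apply winding_right_of_max; auto; lra).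
  rewrite Hsplit in Hout.
  2: { intros t Ht E. specialize (Hmax t Ht). apply (f_equal Re) in E. simpl in E. unfold Re in *. lra. }
  assert (HNout : 0 < FN e).
  { unfold FN. rewrite (form_integral_primitive left_half left_arg _ _ _ _ _ open_left_half left_arg_grad (Htr _)).
    2: { rewrite Rmin_left ?Rmax_right; try lra. intros t Ht. specialize (Hmax t ltac:(lra)). unfold left_half; simpl. unfold Re in *. lra. }
    assert (M1 := Hmax (PI + d) ltac:(lra)). assert (M2 := Hmax (PI - d) ltac:(lra)).
    specialize (Hbefore (PI - d) ltac:(lra)). specialize (Hafter (PI + d) ltac:(lra)).
    unfold left_arg; simpl. unfold Re, Im in *.
    set (x1 := fst (g (PI + d)) + _). set (x2 := fst (g (PI - d)) + _).
    assert (0 < (snd (g (PI + d)) + - (snd (g PI) + 0)) / x1).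
    { replace (_ / _) with ((- (snd (g (PI + d)) + - (snd (g PI) + 0))) / (- x1)) by (field; unfold x1; lra).
      apply Rdiv_lt_0_compat; unfold x1; lra. }
    assert (0 < - ((snd (g (PI - d)) + - (snd (g PI) + 0)) / x2)).
    { replace (- (_ / _)) with ((snd (g (PI - d)) + - (snd (g PI) + 0)) / (- x2)) by (field; unfold x2; lra).
      apply Rdiv_lt_0_compat; unfold x2; lra. }
    apply atan_increasing in H, H0. rewrite atan_opp atan_0 in H0. rewrite atan_0 in H. lra. }
  replace (g PI - RtoC e)%C with (g PI + RtoC (- e))%C in Hav |- * by (rewrite RtoC_opp; ring).
  rewrite Hsplit.
  2: { intros t Ht E. apply (Hav t). replace (g t) with ((g t - (g PI + RtoC (- e))) + (g PI + RtoC (- e)))%C by ring. rewrite E. ring. }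
  assert (HNin : FN (- e) < 0).
  { unfold FN. rewrite (form_integral_primitive slit principal_arg _ _ _ _ _ open_slit principal_arg_grad (Htr _)).
    2: { rewrite Rmin_left ?Rmax_right; try lra. intros t Ht.
      destruct (Rtotal_order t PI) as [Hlt | [-> | Hgt]].
      - apply slit_of_Im. specialize (Hbefore t ltac:(lra)). simpl. unfold Im in *. apply Rgt_not_eq. lra.
      - apply slit_of_pos. simpl. unfold Re. lra.
      - apply slit_of_Im. specialize (Hafter t ltac:(lra)). simpl. unfold Im in *. apply Rlt_not_eq. lra. }
    specialize (Hbefore (PI - d) ltac:(lra)). specialize (Hafter (PI + d) ltac:(lra)).
    assert (I1 : Im (g (PI + d)%R - (g PI + RtoC (- e)))%C < 0) by (simpl; unfold Im in *; lra).
    assert (I2 : 0 < Im (g (PI - d)%R - (g PI + RtoC (- e)))%C) by (simpl; unfold Im in *; lra).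
    pose proof (principal_arg_neg _ (slit_of_Im _ (Rlt_not_eq _ _ I1)) I1).
    pose proof (principal_arg_pos _ (slit_of_Im _ (Rgt_not_eq _ _ I2)) I2). lra. }
  apply Rabs_lt_between in BL. apply Rabs_lt_between in BR.
  lra.
Qed.

(** * The direction of the boundary loop *)

Lemma periodic_Z (g : R -> C) : (forall t, g (t + 2 * PI) = g t) ->
  forall (n : Z) t, g (t - 2 * PI * IZR n) = g t.
Proof.
  intros Hper.
  assert (K : forall (n : nat) t, g (t + 2 * PI * INR n) = g t).
  { induction n as [ | n IH]; intros t.
    - f_equal. simpl. ring.
    - rewrite S_INR. replace (t + 2 * PI * (INR n + 1)) with ((t + 2 * PI * INR n) + 2 * PI) by ring.
      now rewrite Hper. }
  intros n t. destruct (Z_le_dec 0 n) as [Hn | Hn].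
  - rewrite -(K (Z.to_nat n) (t - _)). f_equal. rewrite INR_IZR_INZ Z2Nat.id; auto. ring.
  - rewrite -(K (Z.to_nat (- n)) t). f_equal. rewrite INR_IZR_INZ Z2Nat.id; [ | lia]. rewrite opp_IZR. ring.
Qed.

Lemma reduce_mod_2PI (t : R) : exists n : Z, 0 <= t - 2 * PI * IZR n < 2 * PI.
Proof.
  pose proof PI_RGT_0. exists (Int_part (t / (2 * PI))).
  destruct (base_Int_part (t / (2 * PI))) as [H1 H2].
  set (n := IZR (Int_part _)) in *.
  assert (E : t = 2 * PI * (t / (2 * PI))) by (field; lra).
  clearbody n. set (q := t / (2 * PI)) in *. clearbody q. rewrite E.
  replace (2 * PI * q - 2 * PI * n) with (2 * PI * (q - n)) by ring.
  split; [apply Rmult_le_pos; lra | ].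
  apply Rlt_le_trans with (2 * PI * 1); [apply Rmult_lt_compat_l; lra | lra].
Qed.

Lemma generating_loop_C1_curve (Omega : C -> Prop) (gamma : R -> C) : generating_loop Omega gamma -> C1_curve gamma.
Proof. intros HG t. split; [apply (gl_derivable _ _ HG) | apply (gl_C1 _ _ HG)]. Qed.

(** Simplicity is only assumed on one fundamental interval; both parameters are
    first brought there by multiples of the period. *)
Lemma simple_loop_mod (Omega : C -> Prop) (gamma : R -> C) (s t : R) :
  generating_loop Omega gamma -> Rabs (s - t) <= PI -> gamma s = gamma t -> s = t.
Proof.
  intros HG Hst E. pose proof PI_RGT_0.
  destruct (reduce_mod_2PI s) as [n Hn]. destruct (reduce_mod_2PI t) as [m Hm].
  assert (E2 : s - 2 * PI * IZR n = t - 2 * PI * IZR m).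
  { apply (gl_simple _ _ HG); auto. rewrite !(periodic_Z _ (gl_periodic _ _ HG)). exact E. }
  assert (Ek : s - t = 2 * PI * IZR (n - m)) by (rewrite minus_IZR; lra).
  rewrite Ek in Hst. apply Rabs_le_between in Hst.
  assert (n - m < 1)%Z by (apply lt_IZR; nra).
  assert (- 1 < n - m)%Z by (apply lt_IZR; nra).
  replace (n - m)%Z with 0%Z in Ek by lia. simpl in Ek. lra.
Qed.

Lemma is_derive_circle (r eps t : R) :
  is_derive (fun s => Re (RtoC r * expi (eps * s))%C) t (- r * eps * sin (eps * t)) /\
  is_derive (fun s => Im (RtoC r * expi (eps * s))%C) t (r * eps * cos (eps * t)).
Proof.
  split.
  - apply (is_derive_ext (fun s => r * cos (eps * s))). intros s; simpl; ring. auto_derive; auto; ring.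
  - apply (is_derive_ext (fun s => r * sin (eps * s))). intros s; simpl; ring. auto_derive; auto; ring.
Qed.

Lemma dcurve_circle (r eps t : R) :
  dcurve (fun s => (RtoC r * expi (eps * s))%C) t = (- r * eps * sin (eps * t), r * eps * cos (eps * t)).
Proof. destruct (is_derive_circle r eps t). unfold dcurve. f_equal; now apply is_derive_unique. Qed.

Lemma C1_curve_circle (r eps : R) : C1_curve (fun s => (RtoC r * expi (eps * s))%C).
Proof.
  intros t. destruct (is_derive_circle r eps t). split; [split; eexists; eauto | ].
  apply continuous_ext with (f := fun t => (- r * eps * sin (eps * t), r * eps * cos (eps * t)) : C).
  - intros s. now rewrite dcurve_circle.
  - apply continuous_Cpair; apply: ex_derive_continuous; auto_derive; auto.
Qed.

(** By hypothesis every point just to the right of [gamma] can be joined to the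
    puncture off the curve, so its winding number is [eps].  At the rightmost
    point the tangent is vertical.  If it pointed up, the right side would be the
    outside, of winding number [0]; so it points down, and
    [winding_left_of_max] excludes [eps = 1]. *)
Lemma orientation_clockwise (Omega : C -> Prop) (gamma : R -> C) (r eps : R) (h : R * R -> C) :
  generating_loop Omega gamma ->
  (forall t, exists mu, 0 < mu /\ points_to_puncture Omega gamma t (RtoC mu * (- Ci * dcurve gamma t))%C) ->
  0 < r -> (eps = 1 \/ eps = -1) ->
  (forall x, continuous h x) ->
  (forall s t, 0 <= s <= 1 -> 0 <= t <= 2 * PI -> punctured Omega (h (s, t))) ->
  (forall t, 0 <= t <= 2 * PI -> h (0, t) = gamma t /\ h (1, t) = (RtoC r * expi (eps * t))%C) ->
  (forall s, 0 <= s <= 1 -> h (s, 0) = h (s, 2 * PI)) ->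
  eps = -1.
Proof.
  intros HG Hpt Hr Heps Hh Hin Hends Hhper. pose proof PI_RGT_0 as HPI.
  pose proof (generating_loop_C1_curve _ _ HG) as Hg.
  pose proof (gl_periodic _ _ HG) as Hper.
  assert (Hper0 : gamma 0 = gamma (2 * PI)) by (rewrite -(Hper 0); f_equal; ring).
  assert (W0 : winding gamma (RtoC 0) = 2 * PI * eps).
  { unfold winding.
    rewrite (homotopy_invariance nonzero arg_x arg_y h _ (fun t => (RtoC r * expi (eps * t))%C)).
    - unfold form_integral. rewrite (RInt_ext _ (fun _ => eps)).
      + rewrite RInt_const. unfold scal; simpl; unfold mult; simpl. ring.
      + intros t _. rewrite dcurve_circle. unfold form_at, arg_x, arg_y, expi; simpl.
        pose proof (sin2_cos2 (eps * t)) as HH; unfold Rsqr in HH.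
        set (c := cos (eps * t)) in *. set (s := sin (eps * t)) in *.
        replace ((r * c - 0 * s) * ((r * c - 0 * s) * 1) + (r * s + 0 * c) * ((r * s + 0 * c) * 1)) with (r * r * (s * s + c * c)) by ring.
        rewrite HH. transitivity (eps * (s * s + c * c)); [field; lra | rewrite HH; ring].
    - apply open_nonzero.
    - apply closed_arg_form.
    - lra.
    - exact Hh.
    - intros s t Hs Ht. apply (Hin s t Hs Ht).
    - exact Hhper.
    - intros t Ht. destruct (Hends t Ht) as [-> ->]. split; [ring | reflexivity].
    - now apply C1_curve_translate.
    - apply C1_curve_circle. }
  assert (Wright : forall t, exists e1, 0 < e1 /\ forall e, 0 < e < e1 ->
     winding gamma (gamma t + RtoC e * (- Ci * dcurve gamma t))%C = 2 * PI * eps /\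
     forall s, gamma s <> (gamma t + RtoC e * (- Ci * dcurve gamma t))%C).
  { intros t. destruct (Hpt t) as (mu & Hmu & e0 & He0 & Hp).
    exists (e0 * mu). split; [nra | ]. intros e He.
    assert (He' : 0 < e / mu < e0).
    { split; [apply Rdiv_lt_0_compat; lra | ]. apply Rmult_lt_reg_r with mu; auto. unfold Rdiv. rewrite Rmult_assoc Rinv_l; lra. }
    destruct (Hp (e / mu) He') as (c & (Hc & Hcin) & Hc0 & Hc1).
    assert (Ec : c 0 = (gamma t + RtoC e * (- Ci * dcurve gamma t))%C).
    { rewrite Hc0. f_equal. rewrite Cmult_assoc -RtoC_mult. do 2 f_equal. field; lra. }
    split.
    - rewrite -Ec -W0 -Hc1. apply winding_path; auto.
      intros s u Hs Hu. apply (Hcin s Hs).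
    - intros s. rewrite -Ec. intros E. symmetry in E. revert E. apply Hcin. lra. }
  destruct (continuity_ab_maj (fun t => Re (gamma t)) 0 (2 * PI)) as (t1 & Hmax & Ht1); [lra | | ].
  { intros t _. apply continuity_pt_filterlim. apply: ex_derive_continuous. apply Hg. }
  assert (Hmax' : forall t, Re (gamma t) <= Re (gamma t1)).
  { intros t. destruct (reduce_mod_2PI t) as [n Hn]. rewrite -(periodic_Z _ Hper n t). apply Hmax. lra. }
  set (tau := t1 - PI). set (g := fun t => gamma (t + tau)).
  assert (EgPI : g PI = gamma t1) by (unfold g, tau; f_equal; ring).
  assert (Hg' : C1_curve g) by now apply C1_curve_shift.
  assert (Hg0 : g 0 = g (2 * PI)).
  { unfold g. rewrite -(Hper (0 + tau)). f_equal. ring. }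
  assert (Hgmax : forall t, 0 <= t <= 2 * PI -> Re (g t) <= Re (g PI)) by (intros t _; rewrite EgPI; apply Hmax').
  assert (Hginj : forall t, 0 <= t <= 2 * PI -> g t = g PI -> t = PI).
  { intros t Ht E. rewrite EgPI in E. apply (simple_loop_mod _ _ _ _ HG) in E.
    - unfold tau in E. lra.
    - unfold tau. apply Rabs_le_between. lra. }
  assert (Edg : dcurve g PI = dcurve gamma t1).
  { unfold g. rewrite dcurve_shift; auto. f_equal. unfold tau. ring. }
  assert (Hvert : Re (dcurve gamma t1) = 0).
  { destruct (Hg t1) as [[D1 D2] _]. simpl.
    assert (pr : derivable_pt (fun t => Re (gamma t)) t1) by (now apply ex_derive_Reals_0).
    rewrite -(Derive_Reals _ _ pr). apply (deriv_maximum _ (t1 - 1) (t1 + 1)); try lra. intros x _ _. apply Hmax'. }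
  assert (Eval : (- Ci * dcurve gamma t1 = RtoC (Im (dcurve gamma t1)))%C).
  { apply C_ext; [simpl; unfold Im; ring | ].
    transitivity (- Re (dcurve gamma t1)); [simpl; unfold Re; ring | rewrite Hvert; simpl; ring]. }
  assert (Hne : Im (dcurve gamma t1) <> 0).
  { intros E. apply (gl_regular _ _ HG t1). now apply C_ext. }
  destruct (Wright t1) as (e1 & He1 & HW1). rewrite Eval in HW1.
  set (m := Im (dcurve gamma t1)) in *.
  destruct (Rtotal_order m 0) as [Hm | [Hm | Hm]]; [ | contradiction | ].
  - destruct (winding_left_of_max g Hg' Hg0 Hgmax Hginj) as (e2 & He2 & HW2); [rewrite Edg; exact Hm | ].
    (* The point [gamma t1 + e m] is [g PI - e (- m)], so both bounds must hold for
     [e] and for [e (- m)]. *)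
    set (e := Rmin (e1 / 2) (e2 / (- 2 * m))).
    assert (He2' : 0 < e2 / (- 2 * m)) by (apply Rdiv_lt_0_compat; lra).
    assert (Hee : 0 < e) by (apply Rmin_pos; lra).
    assert (Hee1 : e < e1) by (eapply Rle_lt_trans; [apply Rmin_l | lra]).
    assert (Hee2 : e * - m < e2).
    { apply Rle_lt_trans with (e2 / (- 2 * m) * - m).
      - apply Rmult_le_compat_r; [lra | apply Rmin_r].
      - replace (e2 / (- 2 * m) * - m) with (e2 / 2) by (field; lra). lra. }
    destruct (HW1 e (conj Hee Hee1)) as [E1 E2].
    assert (Epoint : (gamma t1 + RtoC e * RtoC m = g PI - RtoC (e * - m))%C).
    { rewrite EgPI RtoC_mult RtoC_opp. ring. }
    rewrite Epoint in E1 E2.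
    rewrite (winding_shift gamma tau _ Hg Hper E2) in E1. fold g in E1.
    assert (Hlt : winding g (g PI - RtoC (e * - m))%C < 2 * PI).
    { apply HW2; [nra | ]. intros t. apply E2. }
    destruct Heps as [-> | ->]; [ | reflexivity]. lra.
  - exfalso. set (e := e1 / 2).
    assert (Hee : 0 < e < e1) by (unfold e; lra).
    destruct (HW1 e Hee) as [E1 E2].
    assert (Epoint : (gamma t1 + RtoC e * RtoC m = g PI + RtoC (e * m))%C) by (rewrite EgPI RtoC_mult; ring).
    rewrite Epoint in E1 E2.
    rewrite (winding_shift gamma tau _ Hg Hper E2) in E1. fold g in E1.
    rewrite (winding_right_of_max g (e * m) Hg' Hg0) in E1; auto; [ | nra].
    destruct Heps as [-> | ->]; lra.
Qed.

(** * The flux of the end *)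

(** The flux density at [z] in the direction [v]; the branch of the
    representation has disappeared from the right side. *)
Lemma local_frame_density (X : C -> E3) (f0 f1 f2 : C -> C) (a b c z v : C) :
  local_frame X f0 f1 f2 z ->
  hyp (X z) (dmap X z (- Ci * v)%C) (killing a b c (X z))
  - hyp (X z) (dmap X z v) (killing (Ci * a) (Ci * b) (Ci * c) (X z))
  = - 2 * Im ((a * f2 z - b * f1 z + c * f0 z) * v)%C.
Proof.
  intros (A & B & C0 & D & A' & B' & C' & D' & det & det1 & EX & Ed & E0 & E1 & E2).
  assert (det1' : (v * A' * D + A * (v * D') - v * B' * C0 - B * (v * C') = 0)%C).
  { transitivity (v * (A' * D + A * D' - B' * C0 - B * C'))%C; [ring | rewrite det1; ring]. }
  pose proof (bryant_flux_density A B C0 D (v * A') (v * B') (v * C') (v * D') a b c det det1') as HH.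
  cbv zeta in HH. rewrite -EX in HH. rewrite !Ed.
  replace (- Ci * v * A')%C with (- Ci * (v * A'))%C by ring.
  replace (- Ci * v * B')%C with (- Ci * (v * B'))%C by ring.
  replace (- Ci * v * C')%C with (- Ci * (v * C'))%C by ring.
  replace (- Ci * v * D')%C with (- Ci * (v * D'))%C by ring.
  rewrite HH E0 E1 E2. f_equal. f_equal. ring.
Qed.

Lemma open_punctured (Omega : C -> Prop) : open Omega -> open (punctured Omega).
Proof.
  intros HO z [Hz Hz0]. apply (filter_and (F := locally z)); [now apply HO | exact (open_nonzero z Hz0)].
Qed.

Lemma holomorphic_on_comb (V : C -> Prop) (f0 f1 f2 : C -> C) (a b c : C) :
  holomorphic_on V f0 -> holomorphic_on V f1 -> holomorphic_on V f2 ->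
  forall z, V z -> exists l,
    is_derive_RC (fun x => (a * f2 (x, Im z) - b * f1 (x, Im z) + c * f0 (x, Im z))%C) (Re z) l /\
    is_derive_RC (fun y => (a * f2 (Re z, y) - b * f1 (Re z, y) + c * f0 (Re z, y))%C) (Im z) (Ci * l)%C.
Proof.
  intros H0 H1 H2 z Hz.
  destruct (holomorphic_slices _ _ _ (C_derive_correct _ _ (RtoC 0) (H0 z Hz))) as [A0 B0].
  destruct (holomorphic_slices _ _ _ (C_derive_correct _ _ (RtoC 0) (H1 z Hz))) as [A1 B1].
  destruct (holomorphic_slices _ _ _ (C_derive_correct _ _ (RtoC 0) (H2 z Hz))) as [A2 B2].
  exists (a * C_derive f2 z - b * C_derive f1 z + c * C_derive f0 z)%C.
  assert (K : forall (g0 g1 g2 : R -> C) t l0 l1 l2, is_derive_RC g0 t l0 -> is_derive_RC g1 t l1 -> is_derive_RC g2 t l2 ->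
     is_derive_RC (fun s => (a * g2 s - b * g1 s + c * g0 s)%C) t (a * l2 - b * l1 + c * l0)%C).
  { intros g0 g1 g2 t l0 l1 l2 G0 G1 G2.
    pose proof (is_derive_RC_plus _ _ _ _ _ (is_derive_RC_plus _ _ _ _ _
       (is_derive_RC_mult _ _ _ _ _ (is_derive_RC_const a t) G2) (is_derive_RC_mult _ _ _ _ _ (is_derive_RC_const (- b)%C t) G1))
       (is_derive_RC_mult _ _ _ _ _ (is_derive_RC_const c t) G0)) as HH.
    eapply is_derive_RC_ext; [ | | exact HH]; [intros s; cbv beta; ring | cbv beta; ring]. }
  split; [now apply K | ].
  replace (Ci * _)%C with (a * (Ci * C_derive f2 z) - b * (Ci * C_derive f1 z) + c * (Ci * C_derive f0 z))%C by ring.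
  now apply K.
Qed.

(** Regularity comes from the expression of the form through [X], which is of
    class C2; the equality of the mixed derivatives comes from the
    Cauchy-Riemann equations for the holomorphic coefficient. *)
Lemma flux_form_closed (V : C -> Prop) (X : C -> E3) (f0 f1 f2 : C -> C) (a b c : C) :
  open V -> CkE 2 V X -> (forall z, V z -> H3 (X z)) ->
  (forall z, V z -> local_frame X f0 f1 f2 z) ->
  holomorphic_on V f0 -> holomorphic_on V f1 -> holomorphic_on V f2 ->
  closed_form V (fun z => - 2 * Im (a * f2 z - b * f1 z + c * f0 z)%C)
    (fun z => - 2 * Re (a * f2 z - b * f1 z + c * f0 z)%C).
Proof.
  intros HV HX HH Hfr H0 H1 H2.
  destruct (CkE_2_C1 V X HX) as (K0 & K1 & K2).
  assert (Hw : forall z, V z -> cw (X z) <> 0) by (intros z Hz; apply Rgt_not_eq; now apply HH).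
  assert (HP : C1_on V (fun z => - 2 * Im (a * f2 z - b * f1 z + c * f0 z)%C)).
  { apply C1_on_ext with (F := fun z => (-1) * hyp (X z) (D2 X z) (killing a b c (X z))
       + (-1) * hyp (X z) (D1 X z) (killing (Ci * a) (Ci * b) (Ci * c) (X z))); auto.
    - apply C1_on_plus; (apply C1_on_mult; [exact HV | apply C1_on_const | apply C1_on_hyp_killing; assumption]).
    - intros z Hz. pose proof (local_frame_density X f0 f1 f2 a b c z (RtoC 1) (Hfr z Hz)) as E.
      rewrite !Cmult_1_r in E. rewrite -E. unfold dmap, hyp, Rdiv. generalize (/ cw (X z) ^ 2).
      generalize (D1 X z) (D2 X z) (killing a b c (X z)) (killing (Ci * a) (Ci * b) (Ci * c) (X z)).
      intros [[? ?] ?] [[? ?] ?] [[? ?] ?] [[? ?] ?] ?. E3_simpl. ring. }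
  assert (HQ : C1_on V (fun z => - 2 * Re (a * f2 z - b * f1 z + c * f0 z)%C)).
  { apply C1_on_ext with (F := fun z => hyp (X z) (D1 X z) (killing a b c (X z))
       + (-1) * hyp (X z) (D2 X z) (killing (Ci * a) (Ci * b) (Ci * c) (X z))); auto.
    - apply C1_on_plus; [apply C1_on_hyp_killing; assumption | ].
      apply C1_on_mult; [exact HV | apply C1_on_const | apply C1_on_hyp_killing; assumption].
    - intros z Hz. pose proof (local_frame_density X f0 f1 f2 a b c z Ci (Hfr z Hz)) as E.
      transitivity (- 2 * Im ((a * f2 z - b * f1 z + c * f0 z) * Ci)%C).
      + rewrite -E. unfold dmap, hyp, Rdiv. generalize (/ cw (X z) ^ 2).
        generalize (D1 X z) (D2 X z) (killing a b c (X z)) (killing (Ci * a) (Ci * b) (Ci * c) (X z)).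
        intros [[? ?] ?] [[? ?] ?] [[? ?] ?] [[? ?] ?] ?. E3_simpl. ring.
      + generalize (a * f2 z - b * f1 z + c * f0 z)%C. intros w. simpl. unfold Re, Im. ring. }
  destruct HP as (Px & Py & HP). destruct HQ as (Qx & Qy & HQ).
  exists Px, Py, Qy. split; auto.
  apply (C1_grad_ext V _ _ _ _ _ _ HV HQ); auto.
  intros z Hz. destruct (holomorphic_on_comb V f0 f1 f2 a b c H0 H1 H2 z Hz) as (l & [L1 _] & [_ L2]).
  destruct (HP z Hz) as (_ & GP & _). destruct (HQ z Hz) as (GQ & _).
  apply (is_derive_scal _ _ (- 2)) in L1. apply (is_derive_scal _ _ (- 2)) in L2.
  rewrite -(is_derive_unique _ _ _ GQ) (is_derive_unique _ _ _ L1).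
  rewrite -(is_derive_unique _ _ _ GP) (is_derive_unique _ _ _ L2).
  simpl. unfold Re, Im. ring.
Qed.

Lemma is_RInt_Im_scal (k : C) (f : R -> C) (a b : R) (l : C) :
  is_RInt (V := C_R_NormedModule) f a b l -> is_RInt (fun t => Im (k * f t)%C) a b (Im (k * l)%C).
Proof.
  intros Hf.
  pose proof (is_RInt_fct_extend_fst (U := R_NormedModule) (V := R_NormedModule) f a b l Hf) as H1.
  pose proof (is_RInt_fct_extend_snd (U := R_NormedModule) (V := R_NormedModule) f a b l Hf) as H2.
  apply (is_RInt_scal _ _ _ (Im k)) in H1. apply (is_RInt_scal _ _ _ (Re k)) in H2.
  pose proof (is_RInt_plus _ _ _ _ _ _ H2 H1) as HH.
  exact HH.
Qed.

(** Running the circle backwards changes the sign, so [- 2 Im (- 2 PI i rho)] is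
    obtained. *)
Lemma clockwise_circle_integral (f0 f1 f2 : C -> C) (a b c rho0 rho1 rho2 : C) (r : R) :
  let f := fun z => (a * f2 z - b * f1 z + c * f0 z)%C in
  let res := fun (f : C -> C) rho => is_RInt (V := C_R_NormedModule)
      (fun t => f (RtoC r * expi t) * (Ci * RtoC r * expi t))%C 0 (2 * PI) (RtoC (2 * PI) * Ci * rho)%C in
  res f0 rho0 -> res f1 rho1 -> res f2 rho2 ->
  form_integral (fun z => - 2 * Im (f z)) (fun z => - 2 * Re (f z)) (fun t => (RtoC r * expi (-1 * t))%C) 0 (2 * PI)
  = 4 * PI * Re (a * rho2 - b * rho1 + c * rho0)%C.
Proof.
  intros f res R0 R1 R2.
  set (G := fun t => 2 * Im (f (RtoC r * expi t) * (Ci * RtoC r * expi t))%C).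
  assert (HG : is_RInt G 0 (2 * PI) (4 * PI * Re (a * rho2 - b * rho1 + c * rho0)%C)).
  { apply (is_RInt_Im_scal c) in R0. apply (is_RInt_Im_scal (- b)%C) in R1. apply (is_RInt_Im_scal a) in R2.
    pose proof (is_RInt_scal _ _ _ 2 _ (is_RInt_plus _ _ _ _ _ _ (is_RInt_plus _ _ _ _ _ _ R0 R1) R2)) as HH.
    replace (4 * PI * Re (a * rho2 - b * rho1 + c * rho0)%C) with
     (scal 2 (plus (plus (Im (c * (RtoC (2 * PI) * Ci * rho0))%C) (Im (- b * (RtoC (2 * PI) * Ci * rho1))%C)) (Im (a * (RtoC (2 * PI) * Ci * rho2))%C))).
    - eapply is_RInt_ext; [ | exact HH]. intros t _. unfold G, f.
      unfold scal, plus; simpl; unfold mult; simpl. unfold Re, Im. ring.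
    - unfold scal, plus; simpl; unfold mult; simpl. unfold Re, Im. ring. }
  unfold form_integral. apply is_RInt_unique.
  pose proof (is_RInt_swap _ _ _ _ HG) as HS.
  assert (HC : is_RInt G (- 1 * 0 + 2 * PI) (- 1 * (2 * PI) + 2 * PI) (opp (4 * PI * Re (a * rho2 - b * rho1 + c * rho0)%C))).
  { replace (- 1 * 0 + 2 * PI) with (2 * PI) by ring. replace (- 1 * (2 * PI) + 2 * PI) with 0 by ring. exact HS. }
  apply is_RInt_comp_lin in HC. apply is_RInt_opp in HC.
  rewrite opp_opp in HC.
  eapply is_RInt_ext; [ | exact HC]. intros t _.
  assert (Ex : expi (-1 * t + 2 * PI) = expi (-1 * t)).
  { unfold expi. now rewrite cos_plus sin_plus cos_2PI sin_2PI !Rmult_1_r !Rmult_0_r Rminus_0_r Rplus_0_r. }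
  transitivity (- (- 1 * G (-1 * t + 2 * PI))); [reflexivity | ].
  unfold G. rewrite Ex dcurve_circle. unfold form_at.
  generalize (f (r * expi (-1 * t))%C). intros w. unfold expi. simpl. unfold Re, Im. ring.
Qed.

Theorem theorem2 :
  forall (Omega : C -> Prop) (X : C -> E3) (U : C -> Prop) (p : C -> C)
         (FA FB FC FD : C -> C) (rho0 rho1 rho2 : C) (P Q : sphere) (Y : E3 -> E3),
    bryant_end Omega X ->
    universal_covering U (punctured Omega) p ->
    bryant_representation U p X FA FB FC FD ->
    is_form_residue U (punctured Omega) p (wronskian FD FC) rho0 ->
    is_form_residue U (punctured Omega) p
      (fun s => FC s * C_derive FB s - FD s * C_derive FA s)%C rho1 ->
    is_form_residue U (punctured Omega) p (wronskian FB FA) rho2 ->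
    P <> Q ->
    is_rotation_killing_field P Q Y ->
    let phi0 := (RtoC (4 * PI) * rho0)%C in
    let phi1 := (RtoC (4 * PI) * rho1)%C in
    let phi2 := (RtoC (4 * PI) * rho2)%C in
    is_flux Omega X Y (- Im (flux_fraction phi0 phi1 phi2 P Q)).
Proof.
  intros Omega X U p FA FB FC FD rho0 rho1 rho2 P Q Y HE [_ Hcov] HB
    (f0 & Hf0 & Hg0 & d0 & Hd0 & Hr0) (f1 & Hf1 & Hg1 & d1' & Hd1 & Hr1) (f2 & Hf2 & Hg2 & d2' & Hd2 & Hr2)
    _ HY phi0 phi1 phi2 gamma eta k HG HO HK.
  pose proof PI_RGT_0 as HPI.
  destruct HE as [HOm HOm0 HX HX3 Hconf _ Hori].
  set (V := punctured Omega) in *.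
  assert (HV : open V) by now apply open_punctured.
  destruct (rotation_killing_field _ _ _ HY) as (a & b & c & HYk & Hfrac).
  assert (Hfr : forall z, V z -> local_frame X f0 f1 f2 z).
  { intros z Hz. now apply (bryant_local_frame V U p X FA FB FC FD f0 f1 f2 Hcov HB HX Hg0 Hg1 Hg2). }
  pose proof (flux_form_closed V X f0 f1 f2 a b c HV HX HX3 Hfr Hf0 Hf1 Hf2) as Hclosed.
  pose proof (generating_loop_C1_curve _ _ HG) as HgC.
  assert (HgV : forall t, V (gamma t)) by apply (gl_in _ _ HG).
  assert (Hconormal : forall t, (exists mu, 0 < mu /\ points_to_puncture Omega gamma t (RtoC mu * (- Ci * dcurve gamma t))%C) /\
    hyp (X (gamma t)) (eta t) (Y (X (gamma t))) * hnorm (X (gamma t)) (velocity X gamma t)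
    = hyp (X (gamma t)) (dmap X (gamma t) (- Ci * dcurve gamma t)%C) (killing a b c (X (gamma t)))).
  { intros t. destruct (oc_tangent _ _ _ _ HO t) as (v & Ev & Hv).
    destruct (conormal_eq X (gamma t) (dcurve gamma t) v (Y (X (gamma t)))) as [(mu & Hmu & Emu) E].
    - apply Hconf, HgV.
    - apply Hori, HgV.
    - apply (gl_regular _ _ HG).
    - rewrite -Ev. apply (oc_unit _ _ _ _ HO).
    - rewrite -Ev. apply (oc_normal _ _ _ _ HO).
    - rewrite -Ev. apply (oc_oriented _ _ _ _ HO).
    - split; [exists mu; split; auto; now rewrite -Emu | ].
      unfold velocity. rewrite Ev E HYk; [reflexivity | apply HX3, HgV]. }
  set (f := fun z => (a * f2 z - b * f1 z + c * f0 z)%C).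
  set (PP := fun z => - 2 * Im (f z)). set (QQ := fun z => - 2 * Re (f z)).
  change (closed_form V PP QQ) in Hclosed.
  assert (Hcont : forall z, V z -> continuous PP z /\ continuous QQ z).
  { destruct Hclosed as (Px & M & Qy & GP & GQ). intros z Hz. split; eapply C1_grad_continuous; eauto. }
  assert (Hflux : curve_term X gamma eta (fun t => Y (X (gamma t))) - 2 * disk_term k Y = form_integral PP QQ gamma 0 (2 * PI)).
  { rewrite (killing_disk_term X gamma k Y a b c V HK HYk HV HX HgV HgC).
    unfold curve_term.
    set (kp := fun t => killing_potential a b c (X (gamma t)) (velocity X gamma t)).
    assert (Ikp : ex_RInt kp 0 (2 * PI)).
    { destruct (CkE_2_C1 V X HX) as (K0 & K1 & K2).
      assert (Hw : forall z, V z -> cw (X z) <> 0) by (intros z Hz; apply Rgt_not_eq; now apply HX3).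
      apply (ex_RInt_ext (fun t => form_at (fun z => killing_potential a b c (X z) (D1 X z))
         (fun z => killing_potential a b c (X z) (D2 X z)) (gamma t) (dcurve gamma t))).
      { intros t _. unfold kp, velocity. now rewrite dmap_linear_potential. }
      apply (ex_RInt_form V); [ | exact HgC | intros; apply HgV].
      intros z Hz. split; apply (C1_on_continuous V); try assumption;
        apply C1_on_killing_potential; assumption. }
    rewrite (RInt_ext _ (fun t => plus (form_at PP QQ (gamma t) (dcurve gamma t)) (scal 2 (kp t)))).
    - rewrite RInt_plus.
      + rewrite RInt_scal; auto. unfold plus, scal; simpl; unfold mult; simpl. unfold form_integral. ring.
      + apply (ex_RInt_form V); [exact Hcont | exact HgC | intros; apply HgV].
      + now apply (ex_RInt_scal (V := R_NormedModule)).
    - intros t _. rewrite (proj2 (Hconormal t)).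
      pose proof (local_frame_density X f0 f1 f2 a b c (gamma t) (dcurve gamma t) (Hfr _ (HgV t))) as E.
      fold (f (gamma t)) in E.
      unfold plus, scal; simpl; unfold mult; simpl.
      assert (Ef : form_at PP QQ (gamma t) (dcurve gamma t) = - 2 * Im (f (gamma t) * dcurve gamma t)%C).
      { unfold form_at, PP, QQ. generalize (f (gamma t)) (dcurve gamma t). intros w w'. simpl. unfold Re, Im. ring. }
      rewrite Ef -E. unfold kp, killing_potential, velocity, hyp. field.
      apply Rgt_not_eq. now apply HX3. }
  rewrite Hflux.
  destruct (gl_generator _ _ HG) as (r & eps & h & Hr & Hdisc & Heps & Hh & Hin & Hends & Hhper).
  assert (Eeps : eps = -1).
  { apply (orientation_clockwise Omega gamma r eps h); auto. intros t. apply Hconormal. }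
  rewrite Eeps in Hends.
  rewrite (homotopy_invariance V PP QQ h gamma (fun t => (RtoC r * expi (-1 * t))%C) (2 * PI)); auto; try lra.
  2: apply C1_curve_circle.
  (* The circle given by the homotopy need not lie where the three residues are
     computed; it is shrunk concentrically. *)
  set (r' := Rmin (Rmin r d0) (Rmin d1' d2') / 2).
  assert (Hr' : 0 < r' /\ r' < r /\ r' < d0 /\ r' < d1' /\ r' < d2').
  { assert (Hp : 0 < Rmin (Rmin r d0) (Rmin d1' d2')) by (repeat apply Rmin_pos; auto).
    pose proof (Rmin_l (Rmin r d0) (Rmin d1' d2')). pose proof (Rmin_r (Rmin r d0) (Rmin d1' d2')).
    pose proof (Rmin_l r d0). pose proof (Rmin_r r d0). pose proof (Rmin_l d1' d2'). pose proof (Rmin_r d1' d2').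
    unfold r'. repeat split; lra. }
  assert (Hexpi : forall t, Cmod (expi t) = 1).
  { intros t. unfold expi, Cmod; simpl. rewrite -[RHS]sqrt_1. f_equal. pose proof (sin2_cos2 t) as HH; unfold Rsqr in HH. nra. }
  rewrite (homotopy_invariance V PP QQ (fun x => (RtoC (r + fst x * (r' - r)) * expi (-1 * snd x))%C)
     _ (fun t => (RtoC r' * expi (-1 * t))%C) (2 * PI)); auto; try lra.
  - rewrite (clockwise_circle_integral f0 f1 f2 a b c rho0 rho1 rho2 r').
    + rewrite Hfrac. unfold phi0, phi1, phi2. simpl. unfold Re, Im. ring.
    + apply Hr0; lra.
    + apply Hr1; lra.
    + apply Hr2; lra.
  - intros x. apply continuous_ext with (f := fun x : R * R => ((r + fst x * (r' - r)) * cos (-1 * snd x), (r + fst x * (r' - r)) * sin (-1 * snd x)) : C).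
    { intros y. apply C_ext; simpl; ring. }
    assert (K1 : continuous (fun x : R * R => r + fst x * (r' - r)) x).
    { apply: continuous_plus; [apply continuous_const | apply: continuous_mult; [apply: continuous_fst | apply continuous_const]]. }
    assert (K2 : continuous (fun x : R * R => -1 * snd x) x).
    { apply: continuous_mult; [apply continuous_const | apply: continuous_snd]. }
    apply continuous_Cpair; apply: continuous_mult; auto.
    + apply (continuous_comp (fun x : R * R => -1 * snd x) cos); auto. apply continuous_cos.
    + apply (continuous_comp (fun x : R * R => -1 * snd x) sin); auto. apply continuous_sin.
  - intros s t Hs Ht. cbn [fst snd].
    assert (Hrad : 0 < r + s * (r' - r) <= r) by nra.
    assert (Hm : Cmod (RtoC (r + s * (r' - r)) * expi (-1 * t))%C = r + s * (r' - r)).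
    { rewrite Cmod_mult Hexpi Cmod_R Rmult_1_r Rabs_pos_eq; lra. }
    split.
    + apply Hdisc. rewrite Hm. lra.
    + intros E. rewrite E Cmod_0 in Hm. lra.
  - intros s _. cbn [fst snd]. f_equal. unfold expi.
    replace (-1 * (2 * PI)) with (- (2 * PI)) by ring. replace (-1 * 0) with 0 by ring.
    now rewrite cos_neg sin_neg cos_2PI sin_2PI cos_0 sin_0 Ropp_0.
  - intros t _. cbn [fst snd]. split; f_equal; f_equal; ring.
  - apply C1_curve_circle.
  - apply C1_curve_circle.
Qed.
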